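(* Assume the Kernel conjecture holds, i.e. $\ker(D_{<N})\cap\mathcal Z^{\mathfrak f}_N=\mathbb Q\,\zeta^{\mathfrak f}(N)$ for all $N\ge2$. Then for all integers $a,b\ge0$, $\zeta^{\mathfrak f}(\{2\}^a,3,\{2\}^b)=\sum_{r=1}^{a+b+1}c_{a,b}^r\,\zeta^{\mathfrak f}(2r+1)\,\zeta^{\mathfrak f}(\{2\}^{a+b+1-r})$, where $c_{a,b}^r=2(-1)^r\Big(\binom{2r}{2b+2}-(1-2^{-2r})\binom{2r}{2a+1}\Big)$.
   Context: Formal MZVs: $\mathcal X=\{x_0,x_1\}$, $\mathbb Q\langle\mathcal X\rangle$ free noncommutative polynomials (weight = number of letters), $ш$ shuffle product. $\mathcal Z^{\mathfrak f}=(\mathbb Q\langle\mathcal X\rangle,ш)/R$, $R$ the ideal generated by $x_0,x_1$ and $uш v-\iota(\iota^{-1}(u)*\iota^{-1}(v))$ for $u\in\mathbb Q\mathbf1+x_0\mathbb Q\langle\mathcal X\rangle x_1$, $v\in\mathbb Q\mathbf1+\mathbb Q\langle\mathcal X\rangle x_1$, with $\iota(y_{k_1}\cdots y_{k_d})=x_0^{k_1-1}x_1\cdots x_0^{k_d-1}x_1$ and $*$ the stuffle product on $\mathbb Q\langle y_1,y_2,\dots\rangle$ ($y_iu*y_jv=y_i(u*y_jv)+y_j(y_iu*v)+y_{i+j}(u*v)$). $\zeta^{\mathfrak f}(k_1,\dots,k_d)$ is the class of $x_0^{k_1-1}x_1\cdots x_0^{k_d-1}x_1$; $\{2\}^n$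 means $n$ entries equal to $2$, and $\zeta^{\mathfrak f}(\{2\}^0)=1$. $\mathcal Z^{\mathfrak f}_N$ is the weight-$N$ part. $D_{<N}$: let $\mathcal A^{\mathfrak f}=\mathcal Z^{\mathfrak f}/(\zeta^{\mathfrak f}(2))$ with projection $\alpha$, and the Goncharov coaction $\Delta_{\mathrm{Gon}}:\mathcal Z^{\mathfrak f}\to\mathcal A^{\mathfrak f}\otimes\mathcal Z^{\mathfrak f}$, $\zeta^{\mathfrak f}(w)\mapsto(\alpha\circ\zeta^{\mathfrak f}\otimes\zeta^{\mathfrak f})(\Delta_{\mathrm{Gon}}(w))$, where $\Delta_{\mathrm{Gon}}(\varepsilon_1\cdots\varepsilon_n)=\sum_k\sum_{0<i_1<\dots<i_k<n+1}\big(\mathop{ш}_{p=0}^kI(\varepsilon_{i_p};\varepsilon_{i_p+1}\cdots\varepsilon_{i_{p+1}-1};\varepsilon_{i_{p+1}})\big)\otimes\varepsilon_{i_1}\cdots\varepsilon_{i_k}$ ($i_0=0,i_{k+1}=n+1,\varepsilon_0=x_1,\varepsilon_{n+1}=x_0$; $I(x_1;f;x_0)=f$, $I(x_0;f;x_1)=S(f)$, $S(\varepsilon_1\cdots\varepsilon_m)=(-1)^m\varepsilon_m\cdots\varepsilon_1$, $I(\varepsilon;f;\varepsilon)$ = coefficient of $\mathbf1$ in $f$ times $\mathbf1$). With $\mathcal L^{\mathfrak f}=\mathcal A^{\mathfrak f}_{>0}/(\mathcal A^{\mathfrak f}_{>0})^2$, $\pi_{2r+1}:\mathcal A^{\mathfrak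 f}_{>0}\to\mathcal L^{\mathfrak f}_{2r+1}$ the projection, $D_{2r+1}=(\pi_{2r+1}\otimes\mathrm{id})\circ(\Delta_{\mathrm{Gon}}-\mathbf1\otimes\mathrm{id})$ and $D_{<N}=\bigoplus_{3\le2r+1<N}D_{2r+1}$. *)

(* Defs.v *)
(* Formal MZVs Z^f = (Q<x0,x1>, ш)/R, encoded concretely:
   letters are booleans (false = x0, true = x1), a polynomial is a finite
   formal sum given as a list of (coefficient, word); two lists denote the
   same polynomial iff they have the same coefficient function.  The quotient
   Z^f is handled by the congruence "p - q is in the ideal R". *)
From mathcomp Require Import all_boot all_algebra.
Import GRing.Theory Num.Theory.

Set Implicit Arguments.
Unset Strict Implicit.
Unset Printing Implicit Defensive.

Definition word := seq bool.               (* false = x0, true = x1 *)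
Definition poly := seq (rat * word).
Definition tens := seq (rat * word * word).

Definition coef (p : poly) (w : word) : rat := (\sum_(t <- p | t.2 == w) t.1)%R.
Definition peq (p q : poly) : Prop := forall w, coef p w = coef q w.

Definition tcoef (T : tens) (w1 w2 : word) : rat :=
  (\sum_(t <- T | (t.1.2 == w1) && (t.2 == w2)) t.1.1)%R.
Definition teq (T U : tens) : Prop := forall w1 w2, tcoef T w1 w2 = tcoef U w1 w2.

Definition pword (w : word) : poly := [:: (1%R, w)].
Definition pone : poly := pword [::].
Definition pscale (c : rat) (p : poly) : poly := [seq ((c * t.1)%R, t.2) | t <- p].
Definition psub (p q : poly) : poly := p ++ pscale (-1)%R q.

Fixpoint shw (u v : word) {struct u} : seq word :=
  match u with
  | [::] => [:: v]
  | a :: u' =>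
    let fix aux (v : word) : seq word :=
      match v with
      | [::] => [:: u]
      | b :: v' => [seq a :: s | s <- shw u' v] ++ [seq b :: s | s <- aux v']
      end in aux v
  end.

Definition psh (p q : poly) : poly :=
  flatten [seq flatten [seq [seq ((a.1 * b.1)%R, s) | s <- shw a.2 b.2] | b <- q] | a <- p].

(* stuffle of words in y_1, y_2, ... (y_k encoded as k) *)
Fixpoint stw (u v : seq nat) {struct u} : seq (seq nat) :=
  match u with
  | [::] => [:: v]
  | i :: u' =>
    let fix aux (v : seq nat) : seq (seq nat) :=
      match v with
      | [::] => [:: u]
      | j :: v' => [seq i :: s | s <- stw u' v] ++ [seq j :: s | s <- aux v']
                   ++ [seq (i + j)%N :: s | s <- stw u' v']
      end in aux v
  end.

Definition iw (ks : seq nat) : word := flatten [seq rcons (nseq k.-1 false) true | k <- ks].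

(* iota^{-1} on words ending in x1 (or empty) *)
Fixpoint iinv_aux (c : nat) (w : word) : seq nat :=
  match w with
  | [::] => [::]
  | b :: w' => if b then c.+1 :: iinv_aux 0 w' else iinv_aux c.+1 w'
  end.
Definition iotainv (w : word) : seq nat := iinv_aux 0 w.

Definition pst (u v : poly) : poly :=
  flatten [seq flatten [seq [seq ((a.1 * b.1)%R, iw s) | s <- stw (iotainv a.2) (iotainv b.2)]
                        | b <- v] | a <- u].

Definition condU (w : word) : bool :=
  (w == [::]) || ((head true w == false) && (last false w == true)).
Definition condV (w : word) : bool := (w == [::]) || (last false w == true).

Definition isGen (g : poly) : Prop :=
  g = pword [:: false] \/ g = pword [:: true] \/
  exists u v : poly, all (fun t => condU t.2) u /\ all (fun t => condV t.2) v /\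
                     g = psub (psh u v) (pst u v).

Definition inR (p : poly) : Prop :=
  exists gs : seq (poly * poly), (forall g, g \in gs -> isGen g.1) /\
    peq p (flatten [seq psh g.1 g.2 | g <- gs]).

Definition zeq (p q : poly) : Prop := inR (psub p q).

Definition hom (n : nat) (p : poly) : bool := all (fun t => size t.2 == n) p.
Definition posw (p : poly) : bool := all (fun t => size t.2 != 0)%N p.

Definition zeta (ks : seq nat) : poly := pword (iw ks).

(* preimage in Q<X> of (zeta^f(2)) + (A^f_{>0})^2 under Q<X> -> Z^f -> A^f,
   i.e. the kernel of Q<X>_{>0} -> L^f (on homogeneous parts) *)
Definition inJ (p : poly) : Prop :=
  exists (r h : poly) (ab : seq (poly * poly)),
    inR r /\ (forall x, x \in ab -> posw x.1 /\ posw x.2) /\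
    peq p (r ++ psh (zeta [:: 2%N]) h ++ flatten [seq psh x.1 x.2 | x <- ab]).

Definition Iseg (a : bool) (f : word) (b : bool) : poly :=
  if a == b then (if f == [::] then pone else [::])
  else if a then pword f
  else [:: (((-1) ^+ size f)%R, rev f)].          (* I(x0; f; x1) = S(f) *)

Definition ptens (p q : poly) : tens :=
  flatten [seq [seq ((a.1 * b.1)%R, a.2, b.2) | b <- q] | a <- p].

Definition tshl (P : poly) (c : bool) (T : tens) : tens :=
  flatten [seq flatten [seq [seq ((t.1.1 * q.1)%R, s, c :: t.2) | s <- shw q.2 t.1.2]
                        | q <- P] | t <- T].

(* Goncharov coaction on a word: current segment starts at letter a with
   interior seg; rest is the unread part of the word; final endpoint eps_{n+1}=x0 *)
Fixpoint gon (a : bool) (seg : word) (rest : word) : tens :=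
  match rest with
  | [::] => ptens (Iseg a seg false) pone
  | c :: rest' => gon a (rcons seg c) rest' ++ tshl (Iseg a seg c) c (gon c [::] rest')
  end.

(* Delta_Gon on Q<X> (eps_0 = x1), linearly extended *)
Definition Delta (p : poly) : tens :=
  flatten [seq [seq ((q.1 * t.1.1)%R, t.1.2, t.2) | t <- gon true [::] q.2] | q <- p].

(* D_k(p) = 0 in L^f_k (x) Z^f, for k = 2r+1 >= 3: the left-weight-k part of
   Delta_Gon(p) lies in J_k (x) Q<X> + Q<X>_k (x) R  (tensor of quotients) *)
Definition Dvanish (k : nat) (p : poly) : Prop :=
  exists js ps : seq (poly * poly),
    (forall x, x \in js -> hom k x.1 /\ inJ x.1) /\
    (forall x, x \in ps -> hom k x.1 /\ inR x.2) /\
    teq [seq t <- Delta p | size t.1.2 == k]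
        (flatten [seq ptens x.1 x.2 | x <- js] ++ flatten [seq ptens x.1 x.2 | x <- ps]).

Definition KernelConjecture : Prop :=
  forall N : nat, (2 <= N)%N -> forall p : poly, hom N p ->
    ((forall r : nat, (1 <= r)%N -> (2 * r + 1 < N)%N -> Dvanish (2 * r + 1) p) <->
     exists c : rat, zeq p (pscale c (zeta [:: N]))).

Definition cab (a b r : nat) : rat :=
  (2 * (-1) ^+ r * ('C(2 * r, 2 * b + 2)%:R
                    - (1 - (2 ^+ (2 * r))^-1) * 'C(2 * r, 2 * a + 1)%:R))%R.

(* Main.v *)
(* Write p for the difference of the two sides, N = 2(a+b+1)+1.

   Infinitesimally (modulo products on the left), the Goncharov coaction is a
   derivation for the shuffle product, and the factors it cuts out of
   {2}^a 3 {2}^b are again of this shape, of lower weight.  By induction on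
   a + b each of them is, modulo products, a known rational multiple of
   zeta(2r+1); summing the binomial coefficients gives D_{<N} p = 0.  The Kernel
   conjecture then yields p = c zeta(N) for some rational c.

   To see that c = 0, evaluate at real multiple zeta values: the
   shuffle-regularised polylogarithms at t -> 1 define a map [zreg] on words that
   kills the ideal R and is positive on zeta(N).  That [zreg] kills p is Zagier's
   theorem over the reals.  Expanding in even powers of cos x on [0, pi/2] gives
     zeta({2}^a, 3, {2}^b) * pi/2
       = int (2x)^(2a+1)/(2a+1)! * (pi-2x)^(2b+2)/(2b+2)! * tan x dx,
   and replacing tan x by its formal Fourier series
   2 sum_k (-1)^k sin(2(k+1)x), integration by parts against the polynomial
   factor produces the right-hand side. *)
Require Import Defs.
From mathcomp Require Import all_boot all_algebra.
From HB Require Import structures.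

Set Implicit Arguments.
Unset Strict Implicit.
Unset Printing Implicit Defensive.

(** The formal half is dual: polynomials are tested by functions on words, [g] on the left tensor
    factor with values in Q<X>/J and [h] on the right with rational values. Among the cut factors
    there is also {2}^r x0, which ends in x0, so that the induction hypothesis does not reach it.
    Its class modulo products comes from x0 ш {2}^r, and the formula for the coefficients extends to
    it with b = -1. In the real half one obstacle is that the stuffle generators of R allow a second
    factor that starts with x1, while [zreg] is built from the shuffle product. No correction term
    arises because leading letters x1 can only come from that second factor, and at t < 1 the defect
    of the stuffle relation is (1-t)^(1/4) up to powers of log(1-t). The other obstacle is that the
    Fourier series of tan diverges. The polynomial factor has a zero of order at least two at pi/2,
    so the error of a partial sum is an oscillating integral of a function with bounded
    derivative. *)

Module Formal.
From mathcomp Require Import ring lra zify boolp.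
Import GRing.Theory Num.Theory.
Local Open Scope ring_scope.
Local Open Scope quotient_scope.
Local Notation fpoly := Defs.poly.

(** * Infinitesimal Goncharov coaction *)

Section ShuffleSums.
Variable V : zmodType.
Implicit Types (u v w : word) (f g : word -> V).

(** Polynomials enter only through functions on words extended linearly; this is the value of such a
    function on the product u ш v, independent of any list representation. *)
Definition sh f u v : V := \sum_(s <- shw u v) f s.

Lemma sh_nil f v : sh f [::] v = f v.
Proof. by rewrite /sh /= big_seq1. Qed.

Lemma sh_nilr f u : sh f u [::] = f u.
Proof. by case: u => [|a u]; rewrite /sh /= big_seq1. Qed.

Lemma sh_cons f a u b v : sh f (a :: u) (b :: v) =
  sh (fun s => f (a :: s)) u (b :: v) + sh (fun s => f (b :: s)) (a :: u) v.
Proof. by rewrite /sh /= big_cat !big_map. Qed.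

Lemma eq_sh f g u v : f =1 g -> sh f u v = sh g u v.
Proof. by move=> e; apply: eq_bigr => s _. Qed.

Lemma shD f g u v : sh (fun s => f s + g s) u v = sh f u v + sh g u v.
Proof. exact: big_split. Qed.

Lemma sh0 u v : sh (fun=> 0) u v = 0.
Proof. by rewrite /sh big1. Qed.

Lemma shN f u v : sh (fun s => - f s) u v = - sh f u v.
Proof. exact: sumrN. Qed.

Lemma sh_sum (I : Type) (r : seq I) (F : I -> word -> V) u v :
  sh (fun s => \sum_(i <- r) F i s) u v = \sum_(i <- r) sh (F i) u v.
Proof. exact: exchange_big. Qed.

Lemma shC f u v : sh f u v = sh f v u.
Proof.
elim: u v f => [|a u IHu] v f; first by rewrite sh_nil sh_nilr.
elim: v f => [|b v IHv] f; first by rewrite sh_nil sh_nilr.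
by rewrite !sh_cons IHu IHv addrC.
Qed.

Lemma size_shw u v s : s \in shw u v -> size s = (size u + size v)%N.
Proof.
elim: u v s => [|a u IHu] v s; first by rewrite inE => /eqP ->.
elim: v s => [|b v IHv] s; first by rewrite inE => /eqP -> /=; rewrite addn0.
rewrite /= mem_cat => /orP[] /mapP[t ht ->] /=.
  by rewrite (IHu _ _ ht).
by rewrite (IHv _ ht) /= !addnS.
Qed.

Lemma eq_sh_size f g u v :
  (forall s, size s = (size u + size v)%N -> f s = g s) -> sh f u v = sh g u v.
Proof. by move=> e; apply: eq_big_seq => s /size_shw/e. Qed.

(** Pairing of [F] with the deconcatenation coproduct of [w]. *)
Fixpoint dec (F : word -> word -> V) (w : word) {struct w} : V :=
  F [::] w + if w is a :: w' then dec (fun p q => F (a :: p) q) w' else 0.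

Lemma eq_dec (F G : word -> word -> V) w :
  (forall p q, F p q = G p q) -> dec F w = dec G w.
Proof.
elim: w F G => [|a w IH] F G e /=; first by rewrite e.
by rewrite e; congr (_ + _); apply: IH => p q; apply: e.
Qed.

Lemma decD (F G : word -> word -> V) w :
  dec (fun p q => F p q + G p q) w = dec F w + dec G w.
Proof.
elim: w F G => [|a w IH] F G /=; first by rewrite !addr0.
by rewrite (IH (fun p q => F (a :: p) q)) addrACA.
Qed.

Lemma dec0 w : dec (fun _ _ => 0) w = 0.
Proof. by elim: w => [|a w IH] /=; rewrite ?addr0 // IH addr0. Qed.

(** Deconcatenation is a morphism for the shuffle product, the bialgebra axiom behind [sh_cut],
    [sh_dlast] and [sh_Lireg]. *)
Lemma sh_dec (F : word -> word -> V) u v :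
  sh (dec F) u v =
  dec (fun u1 u2 => dec (fun v1 v2 => sh (fun p => sh (F p) u2 v2) u1 v1) v) u.
Proof.
elim: u v F => [|a u IHu] v F.
  rewrite sh_nil /= addr0; apply: eq_dec => p q.
  by rewrite !sh_nil.
elim: v F => [|b v IHv] F.
  rewrite sh_nilr /=; rewrite sh_nil sh_nilr; congr (_ + _); first by rewrite addr0.
  by apply: eq_dec => p q /=; rewrite !sh_nilr addr0.
rewrite sh_cons /= !shD IHu IHv /= sh_nil.
rewrite (sh_cons (F [::])).
rewrite [LHS]addrACA -[RHS]addrA; congr (_ + _).
rewrite addrCA; congr (_ + _).
  by apply: eq_dec => p q; rewrite !sh_nil.
rewrite -decD; apply: eq_dec => u1 u2.
rewrite !sh_nilr -addrA; congr (_ + _).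
by rewrite -decD; apply: eq_dec => v1 v2; rewrite sh_cons.
Qed.

End ShuffleSums.

Lemma dec_nill (V : zmodType) (F : word -> V) w :
  dec (fun p q => if p is [::] then F q else 0) w = F w.
Proof. by case: w => [|a w] /=; rewrite ?addr0 // dec0 addr0. Qed.

Section Infinitesimal.
Variables (M : lmodType rat) (g : word -> M).
(** Such a [g] is a linear map on the indecomposables of the shuffle algebra, that is, an
    infinitesimal character. *)
Hypothesis g_nil : g [::] = 0.
Hypothesis g_prod : forall u v, u != [::] -> v != [::] -> sh g u v = 0.
Implicit Types (h : word -> rat) (a b c : bool) (u v w : word).

(** With [r] empty, this is the antipode sum of (-1)^|p| rev(p) ш q over d = pq; [r] accumulates the
    reversed prefix. *)
Fixpoint altsh (f : word -> M) (r d : word) : M :=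
  sh f r d - (if d is c :: d' then altsh f (c :: r) d' else 0).

(** Shuffles beginning with the letter moved last occur in two consecutive terms with opposite
    signs, so the sum telescopes. *)
Lemma altsh_cons f x r d : altsh f (x :: r) d = sh (fun s => f (x :: s)) r d.
Proof.
elim: d x r => [|c d IH] x r /=; first by rewrite !sh_nilr subr0.
by rewrite IH sh_cons addrK.
Qed.

Lemma altsh_g r d : r != [::] -> altsh g r d = (-1) ^+ size d *: g (catrev d r).
Proof.
elim: d r => [|c d IH] r r0 /=; first by rewrite sh_nilr subr0 scale1r.
by rewrite g_prod // sub0r IH // exprS -scalerA scaleN1r.
Qed.

(* The antipode of the shuffle Hopf algebra is -1 on indecomposables. *)
Lemma g_rev f : (-1) ^+ size f *: g (rev f) = - g f.
Proof.
case: f => [|a d]; first by rewrite g_nil scaler0 oppr0.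
have /esym := altsh_cons g a [::] d; rewrite sh_nil altsh_g // => ->.
by rewrite /= exprS mulN1r scaleNr.
Qed.

(** Sign of I(a; f; b) modulo products; for a = x0, b = x1 the antipode contributes -1 by
    [g_rev]. *)
Definition endsgn a b : rat := a%:R - b%:R.

Definition evalp (p : Defs.poly) : M := \sum_(t <- p) t.1 *: g t.2.

Lemma evalp_Iseg a f b : evalp (Iseg a f b) = endsgn a b *: g f.
Proof.
rewrite /evalp /Iseg /endsgn; case: (a =P b) => [->|ab].
  rewrite subrr scale0r; case: (f =P [::]) => [_|_]; last by rewrite big_nil.
  by rewrite big_seq1 /= g_nil scaler0.
case: a b ab => [] [] //= _; rewrite big_seq1 /=; last first.
  by rewrite g_rev sub0r scaleN1r.
by rewrite subr0.
Qed.

Definition evalt h (T : tens) : M := \sum_(t <- T) (t.1.1 * h t.2) *: g t.1.2.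

(** A factor is cut out immediately after the letter [a], with [seg] already read; the default in
    [head false q] is the final endpoint x0. *)
Definition cut h a seg : word -> M :=
  dec (fun f q => (endsgn a (head false q) * h q) *: g (seg ++ f)).

(* [(g (x) h)] applied to the part of the coaction with exactly one nontrivial
   left factor; [a] is the letter preceding the word. *)
Fixpoint der h a w : M :=
  if w is c :: w' then cut h a [::] w + der (fun s => h (c :: s)) c w' else 0.

Definition counitT h (T : tens) : rat :=
  \sum_(t <- T | t.1.2 == [::]) t.1.1 * h t.2.

Lemma evalt_cat h T U : evalt h (T ++ U) = evalt h T + evalt h U.
Proof. exact: big_cat. Qed.

Lemma counitT_cat h T U : counitT h (T ++ U) = counitT h T + counitT h U.
Proof. exact: big_cat. Qed.

Lemma sh_gE u v : sh g u v = (if u is [::] then g v else 0) + (if v is [::] then g u else 0).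
Proof.
case: u => [|a u]; case: v => [|b v]; rewrite ?sh_nil ?sh_nilr ?g_nil ?addr0 ?add0r //.
exact: g_prod.
Qed.

(** Since [g] kills products, a shuffle of two left factors contributes only where one of them is
    the empty word. *)
Lemma evalt_tshl h P c T : evalt h (tshl P c T) =
  counitT (fun s => h (c :: s)) T *: evalp P
  + (\sum_(q <- P | q.2 == [::]) q.1) *: evalt (fun s => h (c :: s)) T.
Proof.
rewrite /evalt /tshl big_flatten big_map /=.
under eq_bigr => t _.
  rewrite big_flatten big_map.
  under eq_bigr => q _.
    rewrite big_map /= -scaler_sumr -/(sh g _ _) sh_gE.
    over.
  over.
rewrite /= /counitT /evalp scaler_suml scaler_sumr.
under eq_bigr => t _ do under eq_bigr => q _ do rewrite scalerDr.
under eq_bigr => t _ do rewrite big_split.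
rewrite big_split /= addrC; congr (_ + _).
  rewrite [RHS]big_mkcond; apply: eq_bigr => t _.
  rewrite scaler_sumr; case: eqP => [->|/eqP t0]; last first.
    by rewrite big1 // => q _; case: (t.1.2) t0 => // *; rewrite scaler0.
  apply: eq_bigr => q _; rewrite scalerA; congr (_ *: _); ring.
apply: eq_bigr => t _.
rewrite scaler_suml [RHS]big_mkcond; apply: eq_bigr => q _.
case: eqP => [->|/eqP t0]; last by case: (q.2) t0 => // *; rewrite scaler0.
by rewrite scalerA; congr (_ *: _); ring.
Qed.

Lemma counitT_tshl h P c T : counitT h (tshl P c T) =
  (\sum_(q <- P | q.2 == [::]) q.1) * counitT (fun s => h (c :: s)) T.
Proof.
rewrite /counitT /tshl big_flatten big_map /= mulr_sumr [RHS]big_mkcond.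
apply: eq_bigr => t _; rewrite big_flatten big_map.
case: ifP => t0.
  rewrite mulr_suml [RHS]big_mkcond; apply: eq_bigr => q _; rewrite big_map (eqP t0) /= /sh.
  have -> : shw q.2 [::] = [:: q.2] by case: (q.2).
  by rewrite big_cons big_nil; case: eqP; rewrite ?mul0r ?addr0 //; lra.
apply: big1 => q _; rewrite big_map big1_seq // => s /andP[/eqP s0 /size_shw].
by rewrite /= in s0; rewrite s0 /=; case: (t.1.2) t0 => //= *; lia.
Qed.

Lemma Iseg_unit a f b : \sum_(q <- Iseg a f b | q.2 == [::]) q.1 = (f == [::])%:R.
Proof.
rewrite /Iseg; case: (a == b).
  by case: eqP => [_|_]; rewrite ?big_nil // big_mkcond big_seq1.
case: a => /=; rewrite big_mkcond big_seq1 /=; first by case: eqP.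
case: f => [|x f] //=; first by rewrite rev_cons; case: (rev f).
Qed.

(** An empty left factor means that no letter is cut, which excludes a pending segment. *)
Lemma counitT_gon h a seg rest :
  counitT h (gon a seg rest) = if seg is [::] then h rest else 0.
Proof.
elim: rest h a seg => [|c rest IH] h a seg /=.
  rewrite /ptens /counitT big_flatten big_map /=.
  under eq_bigr => q _ do rewrite big_mkcond big_seq1 /= mulr1.
  rewrite -big_mkcond /= -mulr_suml Iseg_unit.
  by case: seg => [|x s]; rewrite /= ?mul1r ?mul0r.
rewrite counitT_cat IH counitT_tshl Iseg_unit IH.
by case: seg => [|x seg] /=; rewrite ?mul1r ?mul0r ?add0r ?addr0.
Qed.

(** Either the single nontrivial factor starts with the pending segment, or it lies further right
    and the pending segment is empty. *)
Lemma evalt_gon h a seg rest :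
  evalt h (gon a seg rest) = cut h a seg rest
    + (if seg is [::] then if rest is c :: rest' then der (fun s => h (c :: s)) c rest' else 0
       else 0).
Proof.
elim: rest h a seg => [|c rest IH] h a seg /=.
  rewrite /cut /= /ptens /evalt big_flatten big_map /=.
  under eq_bigr => q _ do rewrite big_seq1 /= mulr1 mulrC -scalerA.
  rewrite -scaler_sumr -/(evalp _) evalp_Iseg scalerA cats0 !addr0.
  by rewrite mulrC; case: seg => [|x s]; rewrite addr0.
rewrite evalt_cat IH evalt_tshl Iseg_unit evalp_Iseg counitT_gon scalerA.
have -> : (if rcons seg c is [::] then if rest is c0 :: rest' then der (fun s => h (c0 :: s)) c0 rest' else 0 else 0) = 0 :> M.
  by case: seg.
rewrite addr0 IH /cut /= cats0 (mulrC (h _)).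
rewrite addrA [X in X + _]addrC.
congr (_ + _ + _).
  by apply: eq_dec => p q; rewrite -cats1 -catA.
case: seg => [|x seg] /=; last by rewrite scale0r.
rewrite scale1r; case: rest {IH} => [|d rest] /=; rewrite ?addr0 //.
all: by rewrite /= /cut /= g_nil scaler0 ?add0r.
Qed.

Lemma evalt_gon_nil h a w : evalt h (gon a [::] w) = der h a w.
Proof.
rewrite evalt_gon /=; case: w => [|c w] //=; rewrite addr0 /cut /= g_nil scaler0 addr0 //.
Qed.

Lemma eq_cut h1 h2 a s w : h1 =1 h2 -> cut h1 a s w = cut h2 a s w.
Proof. by move=> e; apply: eq_dec => p q; rewrite e. Qed.

Lemma eq_der h1 h2 a w : h1 =1 h2 -> der h1 a w = der h2 a w.
Proof.
elim: w h1 h2 a => [|c w IH] h1 h2 a e //=.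
by rewrite (eq_cut _ _ _ e); congr (_ + _); apply: IH => s; apply: e.
Qed.

Lemma cutD h1 h2 a s w : cut (fun q => h1 q + h2 q) a s w = cut h1 a s w + cut h2 a s w.
Proof.
rewrite /cut -decD; apply: eq_dec => p q; by rewrite mulrDr scalerDl.
Qed.

Lemma derD h1 h2 a w : der (fun q => h1 q + h2 q) a w = der h1 a w + der h2 a w.
Proof.
elim: w h1 h2 a => [|c w IH] h1 h2 a /=; first by rewrite addr0.
by rewrite cutD IH addrACA.
Qed.

(** The factor cut from a shuffle is a shuffle of prefixes of [u] and [v]; [g] leaves only prefixes
    taken from one of the two words. *)
Lemma sh_cut h a u v :
  sh (cut h a [::]) u v =
  dec (fun f w => sh (fun q => endsgn a (head false q) * h q) w v *: g f) u
  + dec (fun f w => sh (fun q => endsgn a (head false q) * h q) u w *: g f) v.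
Proof.
rewrite sh_dec; set k := fun q => endsgn a (head false q) * h q.
have E u1 v1 u2 v2 : sh (fun p => sh (fun q => k q *: g ([::] ++ p)) u2 v2) u1 v1 =
    (if u1 is [::] then sh k u2 v2 *: g v1 else 0)
    + (if v1 is [::] then sh k u2 v2 *: g u1 else 0).
  transitivity (sh k u2 v2 *: sh g u1 v1).
    by rewrite /sh scaler_sumr; apply: eq_bigr => p _; rewrite scaler_suml.
  rewrite sh_gE scalerDr.
  by congr (_ + _); [case: u1|case: v1] => *; rewrite ?scaler0.
transitivity (dec (fun u1 u2 => dec (fun v1 v2 =>
    (if u1 is [::] then sh k u2 v2 *: g v1 else 0)
    + (if v1 is [::] then sh k u2 v2 *: g u1 else 0)) v) u).
  by apply: eq_dec => u1 u2; apply: eq_dec => v1 v2; apply: E.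
transitivity (dec (fun u1 u2 => (if u1 is [::] then dec (fun v1 v2 => sh k u2 v2 *: g v1) v else 0)
   + sh k u2 v *: g u1) u).
  apply: eq_dec => u1 u2; rewrite decD; congr (_ + _).
    by case: u1 => //; rewrite dec0.
  by rewrite (dec_nill (fun v2 => sh k u2 v2 *: g u1)).
by rewrite decD (dec_nill (fun u2 => dec (fun v1 v2 => sh k u2 v2 *: g v1) v)) addrC.
Qed.

(** The additivity endsgn a y + endsgn y x = endsgn a x merges the cuts made before and after the
    inserted letter [y]. *)
Lemma cut_sh_step h a u y v :
  dec (fun f w => sh (fun q => endsgn a (head false q) * h q) w (y :: v) *: g f) u
  + cut (fun w => sh (fun s => h (y :: s)) w v) y [::] u
  = cut (fun w => sh h w (y :: v)) a [::] u.
Proof.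
rewrite /cut -decD; apply: eq_dec => f w /=; rewrite -scalerDl; congr (_ *: _).
case: w => [|x w]; first by rewrite !sh_nil /= /endsgn; ring.
rewrite !sh_cons /= /sh -!mulr_sumr /endsgn; ring.
Qed.

Lemma cut_sh_stepr h a u y v :
  dec (fun f w => sh (fun q => endsgn a (head false q) * h q) (y :: v) w *: g f) u
  + cut (fun w => sh (fun s => h (y :: s)) v w) y [::] u
  = cut (fun w => sh h (y :: v) w) a [::] u.
Proof.
have := cut_sh_step h a u y v.
rewrite (eq_cut _ _ _ (fun w => shC (fun s => h (y :: s)) w v)).
rewrite (eq_cut _ _ _ (fun w => shC h w (y :: v))) => <-.
by congr (_ + _); apply: eq_dec => f w; rewrite shC.
Qed.

Lemma der_nil_cut h a c w :
  der h a (c :: w) = cut h a [::] (c :: w) + der (fun s => h (c :: s)) c w.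
Proof. by []. Qed.

(** Induction on both words after splitting off the cuts at the first position; the two sums in
    [sh_cut] are what completes these cuts for each word alone. *)
Theorem sh_der h a u v :
  sh (der h a) u v = der (fun w => sh h w v) a u + der (fun w => sh h u w) a v.
Proof.
elim: u v h a => [|x u IHu] v h a.
  by rewrite sh_nil add0r; apply: eq_der => w; rewrite sh_nil.
elim: v h a => [|y v IHv] h a.
  by rewrite sh_nilr addr0; apply: eq_der => w; rewrite sh_nilr.
have step : sh (der h a) (x :: u) (y :: v) = sh (cut h a [::]) (x :: u) (y :: v)
   + sh (der (fun s => h (x :: s)) x) u (y :: v)
   + sh (der (fun s => h (y :: s)) y) (x :: u) v.
  rewrite [LHS]sh_cons (sh_cons (cut h a [::])) -[RHS]addrA [RHS]addrACA.
  by congr (_ + _); rewrite -shD.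
rewrite step IHu IHv sh_cut !der_nil_cut {step}.
rewrite -(cut_sh_step h a (x :: u)) -(cut_sh_stepr h a (y :: v)).
have E1 : der (fun s => sh h (x :: s) (y :: v)) x u =
   der (fun w => sh (fun s => h (x :: s)) w (y :: v)) x u
   + der (fun w => sh (fun s => h (y :: s)) (x :: w) v) x u.
  by rewrite -derD; apply: eq_der => w; rewrite sh_cons.
have E2 : der (fun s => sh h (x :: u) (y :: s)) y v =
   der (fun w => sh (fun s => h (x :: s)) u (y :: w)) y v
   + der (fun w => sh (fun s => h (y :: s)) (x :: u) w) y v.
  by rewrite -derD; apply: eq_der => w; rewrite sh_cons.
rewrite E1 E2.
set d1 := dec _ _; set d2 := dec _ _.
by rewrite [LHS](AC (2*(1*2)*(2*1)) ((1*6*(3*7))*(2*4*(5*8)))).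
Qed.

End Infinitesimal.

(** * The coaction on words of twos with one three *)

Definition wtwos m : word := iw (nseq m 2%N).
(** For q > 0 the word of {2}^p,3,{2}^(q-1). The words with q = 0, ending in x0, occur among the cut
    factors too. *)
Definition wthree p q : word := wtwos p ++ false :: wtwos q.
Definition wodd s : word := nseq (2 * s) false ++ [:: true].

Lemma wtwosS m : wtwos m.+1 = false :: true :: wtwos m. Proof. by []. Qed.

Lemma wtwosD i j : wtwos (i + j) = wtwos i ++ wtwos j.
Proof. by elim: i => [|i IH] //; rewrite addSn !wtwosS IH. Qed.

Lemma size_wtwos m : size (wtwos m) = (2 * m)%N.
Proof. by elim: m => [|m IH] //; rewrite wtwosS /= IH; lia. Qed.

Lemma size_wthree p q : size (wthree p q) = (2 * (p + q)).+1.
Proof. rewrite size_cat /= !size_wtwos; lia. Qed.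

Lemma size_wodd s : size (wodd s) = (2 * s).+1.
Proof. by rewrite size_cat size_nseq addn1. Qed.

Lemma wthreeS p q : wthree p.+1 q = false :: true :: wthree p q. Proof. by []. Qed.

Lemma wtwos_rcons m : wtwos m ++ [:: false; true] = wtwos m.+1.
Proof. by rewrite -[_ ++ _](wtwosD m 1) addn1. Qed.

Lemma rev_wtwos m : false :: rev (wtwos m) = wtwos m ++ [:: false].
Proof.
elim: m => [|m IH] //.
by rewrite -{1}wtwos_rcons rev_cat /= IH.
Qed.

Lemma drop_wtwos m i : (i <= m)%N -> drop (2 * i) (wtwos m) = wtwos (m - i).
Proof.
move=> im; rewrite -{1}(subnKC im) wtwosD drop_size_cat // size_wtwos; lia.
Qed.

Lemma drop_wtwosS m i : (i < m)%N -> drop (2 * i).+1 (wtwos m) = true :: wtwos (m - i.+1).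
Proof.
move=> im; rewrite -add1n -drop_drop drop_wtwos; last lia.
have -> : (m - i = (m - i.+1).+1)%N by lia.
by rewrite wtwosS drop1.
Qed.

Lemma take_wtwos m i : (i <= m)%N -> take (2 * i) (wtwos m) = wtwos i.
Proof. by move=> im; rewrite -{1}(subnKC im) wtwosD take_size_cat // size_wtwos; lia. Qed.

Lemma take_wtwosS m i : (i < m)%N -> take (2 * i).+1 (wtwos m) = wtwos i ++ [:: false].
Proof.
move=> im; have -> : m = (i + (m - i.+1).+1)%N by lia.
rewrite wtwosD wtwosS take_cat size_wtwos ltnNge leqnSn /=.
have -> : ((2 * i).+1 - 2 * i = 1)%N by lia.
by [].
Qed.

Section Weight.
Variables (M : lmodType rat) (g : word -> M) (r : nat).
Hypothesis r_gt0 : (0 < r)%N.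
Local Notation k := (2 * r).+1.
Hypothesis g_prod : forall u v, u != [::] -> v != [::] -> sh g u v = 0.
Hypothesis g_size : forall w, size w != k -> g w = 0.
Implicit Types (h : word -> rat) (a b c : bool) (u v w : word).
Local Notation cut h a w := (cut g h a [::] w).
Local Notation der := (der g).

Lemma dec_at (F : word -> word -> M) n w :
  (forall f q, size f != n -> F f q = 0) ->
  dec F w = if (n <= size w)%N then F (take n w) (drop n w) else 0.
Proof.
elim: w n F => [|a w IH] n F Fn /=.
  rewrite addr0 leqn0; case: (n =P 0%N) => [_ //|/eqP n0]; apply: Fn.
  by rewrite eq_sym.
case: n Fn => [|n] Fn; last first.
  by rewrite Fn // add0r (IH n) // => f q fn; apply: Fn.
rewrite (@eq_dec _ _ (fun _ _ => 0)) ?dec0 ?addr0 // => p q.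
exact: Fn.
Qed.

Lemma cutE h a w : cut h a w = if (k <= size w)%N then
   (endsgn a (head false (drop k w)) * h (drop k w)) *: g (take k w) else 0.
Proof. by apply: dec_at => f q fk; rewrite g_size ?scaler0. Qed.

Lemma g_nil : g [::] = 0. Proof. exact: g_size. Qed.

(** x0 ш x0^m = (m+1) x0^(m+1), so a power of x0 of weight [k] is a rational multiple of a
    product. *)
Lemma g_nseq n : g (nseq n false) = 0.
Proof.
case: (eqVneq n k) => [->|nk]; last by apply: g_size; rewrite size_nseq.
have E m : sh g [:: false] (nseq m false) = (m.+1)%:R *: g (nseq m.+1 false).
  have G (f : word -> M) : sh f [:: false] (nseq m false) = (m.+1)%:R *: f (nseq m.+1 false).
    elim: m f => [|m IH] f; first by rewrite sh_nilr scale1r.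
    rewrite [nseq m.+1 _]/= sh_cons sh_nil IH /=.
    by rewrite (mulrS 1 m.+1) scalerDl scale1r.
  exact: G.
have := E (2 * r)%N; rewrite g_prod //; last by case: r r_gt0.
by move/esym/eqP; rewrite scaler_eq0 pnatr_eq0 /= => /eqP.
Qed.

Lemma der_cons h a c w : der h a (c :: w) = cut h a (c :: w) + der (fun s => h (c :: s)) c w.
Proof. by []. Qed.

(** The letters flanking an odd-length factor of an alternating word agree, so the sign vanishes;
    the endpoints x1 and x0 continue the alternation. *)
Lemma cut_true_wtwos h m : cut h false (true :: wtwos m) = 0.
Proof.
rewrite cutE; case: ifP => // /=; rewrite size_wtwos ltnS => km.
rewrite drop_wtwos; last by lia.
by case: (m - r)%N => [|x]; rewrite /= /endsgn subrr mul0r scale0r.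
Qed.

Lemma cut_wtwos h m : cut h true (wtwos m) = 0.
Proof.
rewrite cutE size_wtwos; case: ifP => // km.
by rewrite drop_wtwosS /= /endsgn ?subrr ?mul0r ?scale0r //; lia.
Qed.

Lemma der_wtwos h m : der h true (wtwos m) = 0.
Proof.
elim: m h => [|m IH] h //.
by rewrite wtwosS 2!der_cons IH cut_true_wtwos -wtwosS cut_wtwos !addr0.
Qed.

(** A cut factor either is a power of x0 or runs to the end of the word, and then both flanking
    letters are x0. *)
Lemma der_nseq h n : der h false (nseq n false ++ [:: true]) = 0.
Proof.
elim: n h => [|n IH] h.
  by rewrite /= cutE /= addr0; case: r r_gt0.
rewrite der_cons IH addr0 cutE -cat_cons -[_ :: nseq n _]/(nseq n.+1 false).
rewrite size_cat size_nseq addn1; case: ifP => // kn.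
case: (ltnP n.+1 k) => kn1; last first.
  have -> : take k (nseq n.+1 false ++ [:: true]) = nseq k false.
    by rewrite takel_cat ?size_nseq // take_nseq.
  by rewrite g_nseq scaler0.
rewrite drop_oversize ?size_cat ?size_nseq ?addn1 //=.
by rewrite /endsgn subrr mul0r scale0r.
Qed.

Lemma der_wodd h s : der h true (wodd s) = ((s == r)%:R * h [::]) *: g (wodd r).
Proof.
case: s => [|s].
  by rewrite /= cutE /= addr0; case: r r_gt0 => // r' _; rewrite mul0r scale0r.
have -> : wodd s.+1 = false :: nseq (2 * s).+1 false ++ [:: true].
  by rewrite /wodd -cat_cons; congr (_ ++ _); rewrite -[_ :: _]/(nseq (2*s).+2 false); congr nseq; lia.
rewrite der_cons der_nseq addr0 -cat_cons -[_ :: nseq _ _]/(nseq (2 * s).+2 false).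
rewrite cutE size_cat size_nseq addn1.
case: eqP => [<-|/eqP sr].
  rewrite ifT; last lia.
  have -> : nseq (2 * s).+2 false ++ [:: true] = wodd s.+1 by rewrite /wodd; congr (nseq _ _ ++ _); lia.
  by rewrite drop_oversize ?take_oversize ?size_wodd //= /endsgn subr0.
rewrite mul0r scale0r; case: ifP => // kn.
have -> : take k (nseq (2 * s).+2 false ++ [:: true]) = nseq k false.
  by rewrite takel_cat ?size_nseq ?take_nseq //; lia.
by rewrite g_nseq scaler0.
Qed.

Lemma sh_der_wodd_wtwos h s m : sh (der h true) (wodd s) (wtwos m) = ((s == r)%:R * h (wtwos m)) *: g (wodd r).
Proof.
rewrite sh_der //; last exact: g_nil.
by rewrite der_wtwos addr0 der_wodd sh_nil.
Qed.

(** Alternation is broken only at the extra x0, so the initial factor survives exactly when it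
    contains that letter. *)
Lemma cut_wthree h p q : cut h true (wthree p q) =
  if (p <= r <= p + q)%N then h (wtwos (p + q - r)) *: g (wthree p (r - p)) else 0.
Proof.
rewrite cutE size_wthree ltnS leq_mul2l /=; case: (leqP r (p + q)) => rpq; last by rewrite andbF.
rewrite andbT; case: leqP => pr; last first.
  rewrite drop_cat size_wtwos ifT; last lia.
  by rewrite drop_wtwosS //= /endsgn subrr mul0r scale0r.
rewrite /wthree drop_cat take_cat size_wtwos.
rewrite !ifF; try lia.
have -> : ((2 * r).+1 - 2 * p = (2 * (r - p)).+1)%N by lia.
rewrite /= drop_wtwos ?take_wtwos; try lia.
have -> : (q - (r - p) = p + q - r)%N by lia.
by case: (p + q - r)%N => [|x]; rewrite /= /endsgn subr0 mul1r.
Qed.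

Lemma g_revk f : size f = k -> g (rev f) = g f.
Proof.
move=> fk; apply: oppr_inj; rewrite -(g_rev g_nil g_prod f) fk.
by rewrite -signr_odd /= oddM /= scaleN1r.
Qed.

(** The surviving factor starts with x1 and ends with x0; in odd weight it may be reversed without
    sign ([g_revk]), which restores the shape of [wthree]. *)
Lemma cut_true_wthree h p q : cut h false (true :: wthree p q) =
  - if (p < r <= p + q)%N then h (true :: wtwos (p + q - r)) *: g (wthree (r - p.+1) p.+1) else 0.
Proof.
rewrite cutE /= size_wthree !ltnS.
have -> : (2 * r <= (2 * (p + q)).+1)%N = (r <= p + q)%N by lia.
case: (leqP r (p + q)) => rpq; last by rewrite andbF oppr0.
rewrite andbT; case: ltnP => pr; last first.
  rewrite /wthree drop_cat size_wtwos oppr0.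
  case: ltnP => pr2.
    rewrite drop_wtwos; last lia.
    have [x ->] : exists x, (p - r = x.+1)%N by exists (p - r.+1)%N; lia.
    by rewrite wtwosS /= /endsgn subrr mul0r scale0r.
  have -> : (2 * r - 2 * p = 0)%N by lia.
  by rewrite drop0 /= /endsgn subrr mul0r scale0r.
rewrite -(@g_revk (true :: _)); last first.
  rewrite /= size_take size_wthree; case: ifP; lia.
rewrite /wthree drop_cat take_cat size_wtwos !ifF; try lia.
have -> : (2 * r - 2 * p = (2 * (r - p.+1)).+2)%N by lia.
have -> : drop (2 * (r - p.+1)).+2 (false :: wtwos q) = drop (2 * (r - p.+1)).+1 (wtwos q) by [].
have -> : take (2 * (r - p.+1)).+2 (false :: wtwos q) = false :: take (2 * (r - p.+1)).+1 (wtwos q) by [].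
rewrite drop_wtwosS ?take_wtwosS; try lia.
have -> : (q - (r - p.+1).+1 = p + q - r)%N by lia.
rewrite [head _ _]/= {1}/endsgn sub0r mulN1r scaleNr; congr (- (_ *: g _)).
rewrite rev_cons rev_cat rev_cons rev_cat -cats1 -cats1 /= -!catA /=.
rewrite -cat_cons rev_wtwos -catA /=; congr (_ ++ false :: _).
by rewrite -cat_cons rev_wtwos -catA /= wtwos_rcons.
Qed.

Lemma cut_false_wtwos h q : cut h false (wtwos q) =
  - if (r < q)%N then h (true :: wtwos (q - r.+1)) *: g (wthree r 0) else 0.
Proof.
rewrite cutE size_wtwos.
have -> : ((2 * r).+1 <= 2 * q)%N = (r < q)%N by lia.
case: ifP => rq; last by rewrite oppr0.
by rewrite drop_wtwosS // take_wtwosS //= /endsgn sub0r mulN1r scaleNr.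
Qed.

Variable z : M.

(** [cab] with its second index shifted by one, so that b = 0 covers the words ending in x0. *)
Definition zagcoef (a b : nat) : rat :=
  2 * (-1) ^+ r * ('C(2 * r, 2 * b)%:R - (1 - (2 ^+ (2 * r))^-1) * 'C(2 * r, (2 * a).+1)%:R).

(** The two signs are the cuts flanked by (x1, x0) and by (x0, x1); each recursion step removes a
    leading x0 x1. *)
Fixpoint dercoef p q : rat :=
  (if (p <= r <= p + q)%N then zagcoef p (r - p) else 0)
  - (if (p <= r < p + q)%N then zagcoef (r - p) p else 0)
  + (if p is p'.+1 then dercoef p' q else 0).

Lemma dercoef0 p q : (p + q < r)%N -> dercoef p q = 0.
Proof.
elim: p => [|p IH] pq /=; (case: ifP => [|_]; first lia); (case: ifP => [|_]; first lia).
  by rewrite subr0 addr0.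
by rewrite subr0 IH ?addr0 //; lia.
Qed.

(** The symmetry C(2r, m) = C(2r, 2r-m) cancels the even binomials of each pair of cuts and turns
    the odd ones into the telescoping difference C(2r, 2p+1) - C(2r, 2p-1). The term C(2r, 2q) comes
    from the boundary case r = p + q, where the second cut is absent. *)
Lemma dercoefE p q : (0 < q)%N -> (r <= p + q)%N -> dercoef p q = zagcoef p q.
Proof.
move=> q0; elim: p => [|p IH] pq.
  rewrite /= !add0n subn0 addr0 pq.
  case: (ltngtP r q) pq => // [rq|->] _; last first.
    by rewrite subr0.
  rewrite /zagcoef muln0 bin0 binn (@bin_small _ (2 * q)) ?(@bin_small _ (2 * r).+1) //; try lia.
  by ring.
rewrite [dercoef _ _]/=; case: (eqVneq r (p.+1 + q)%N) => [e|e].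
  rewrite dercoef0; last lia.
  have c1 : (p < r <= p.+1 + q)%N by lia.
have c2 : (p < r < p.+1 + q)%N = false by lia.
rewrite c1 c2.
  by rewrite subr0 addr0; congr zagcoef; lia.
rewrite IH; last lia.
case: (leqP p.+1 r) => pr; last first.
  rewrite /=.
  rewrite /zagcoef (@bin_small _ (2 * p).+1) ?(@bin_small _ (2 * p.+1).+1); try lia.
  by ring.
have c1 : (r <= p.+1 + q)%N by lia.
have c2 : (r < p.+1 + q)%N by lia.
rewrite /= c1 c2.
rewrite /zagcoef.
have -> : 'C(2 * r, 2 * (r - p.+1)) = 'C(2 * r, 2 * p.+1).
  by rewrite -bin_sub; [congr binomial|]; lia.
have -> : 'C(2 * r, (2 * (r - p.+1)).+1) = 'C(2 * r, (2 * p).+1).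
  by rewrite -bin_sub; [congr binomial|]; lia.
by ring.
Qed.

Hypothesis gZ : forall a b : nat, (a + b)%N = r -> g (wthree a b) = zagcoef a b *: z.

Lemma der_wthree h p q : der h true (wthree p q) = (dercoef p q * h (wtwos (p + q - r))) *: z.
Proof.
elim: p h => [|p IH] h.
  have -> : wthree 0 q = false :: wtwos q by [].
  rewrite der_cons -[false :: wtwos q]/(wthree 0 q) cut_wthree.
  have -> : der (fun s => h (false :: s)) false (wtwos q) =
      - if (r < q)%N then h (wtwos (q - r)) *: g (wthree r 0) else 0.
    case: q => [|q]; first by rewrite oppr0.
    rewrite wtwosS 2!der_cons cut_true_wtwos der_wtwos !addr0 -wtwosS cut_false_wtwos; case: ifP => // rq.
    by have -> : (q.+1 - r = (q.+1 - r.+1).+1)%N by lia.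
  rewrite [dercoef 0 q]/= !add0n addr0 !subn0 !leq0n !andTb mulrBl scalerBl; congr (_ - _).
    by case: ifP => rq; rewrite ?mul0r ?scale0r // gZ // scalerA mulrC.
  by case: ifP => rq; rewrite ?mul0r ?scale0r // gZ ?addn0 // scalerA mulrC.
rewrite wthreeS 2!der_cons IH -wthreeS cut_wthree cut_true_wthree [dercoef p.+1 q]/= addrA !mulrDl !scalerDl.
congr (_ + _ + _).
- by case: ifP => rq; rewrite ?mul0r ?scale0r // gZ 1?scalerA 1?mulrC //; lia.
- rewrite mulNr scaleNr; congr (- _).
  have -> : (p < r < p.+1 + q)%N = (p < r <= p + q)%N by lia.
  case: ifP => rq; rewrite ?mul0r ?scale0r //.
  rewrite gZ; last lia.
  rewrite scalerA mulrC; congr (_ * h _ *: _).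
  by rewrite -wtwosS; congr wtwos; lia.
- case: (leqP r (p + q)) => rpq; last by rewrite dercoef0 ?mul0r.
  by rewrite -wtwosS; congr (_ * h (wtwos _) *: _); lia.
Qed.

End Weight.

(** * Binomial sums and the words ending in x0 *)

Lemma sum_pairs (V : zmodType) (F : nat -> V) m :
  \sum_(i < 2 * m) F i = \sum_(i < m) (F (2 * i)%N + F (2 * i).+1).
Proof.
elim: m => [|m IH]; first by rewrite muln0 !big_ord0.
rewrite [RHS]big_ord_recr /= -IH.
have -> : (2 * m.+1 = (2 * m).+2)%N by lia.
by rewrite 2!big_ord_recr /= addrA.
Qed.

Lemma sum_bin n : \sum_(i < n.+1) 'C(n, i)%:R = 2 ^+ n :> rat.
Proof.
have := exprDn (1 : rat) 1 n; rewrite -[1 + 1]/2 => ->.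
by apply: eq_bigr => i _; rewrite !expr1n mulr1.
Qed.

(** Pascal's rule writes each entry as a sum of two consecutive entries of the row 2r-1. *)
Lemma sum_bin_odd r : (0 < r)%N -> \sum_(i < r) 'C(2 * r, (2 * i).+1)%:R = 2 ^+ (2 * r).-1 :> rat.
Proof.
case: r => // r _; have -> : (2 * r.+1 = (2 * r).+2)%N by lia.
rewrite -sum_bin -[(2 * r).+2.-1.+1]/(2 * r).+2.
have e : ((2 * r).+2 = 2 * r.+1)%N by lia.
transitivity (\sum_(i < 2 * r.+1) 'C((2 * r).+1, i)%:R : rat); last by rewrite -e.
rewrite (sum_pairs (fun i => 'C((2 * r).+1, i)%:R)).
by apply: eq_bigr => i _; rewrite binS natrD addrC.
Qed.

(** The alternating sum of the row vanishes; the omitted index 0 accounts for the -1. *)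
Lemma sum_bin_even r : (0 < r)%N ->
  \sum_(i < r) 'C(2 * r, 2 * (r - i))%:R = 2 ^+ (2 * r).-1 - 1 :> rat.
Proof.
move=> r0; rewrite -(sum_bin_odd r0).
have : \sum_(i < (2 * r).+1) (-1) ^+ i * 'C(2 * r, i)%:R = 0 :> rat.
  have := exprDn (1 : rat) (-1) (2 * r); rewrite subrr expr0n (_ : (2 * r == 0)%N = false); last by lia.
  move=> e; rewrite [RHS]e; apply: eq_bigr => i _.
  by rewrite expr1n mul1r mulr_natr.
rewrite big_ord_recr /= (sum_pairs (fun i => (-1) ^+ i * 'C(2 * r, i)%:R)) /=.
under eq_bigr => i _ do rewrite exprS exprM sqrrN !expr1n mulr1 mul1r mulN1r.
rewrite exprM sqrrN !expr1n mul1r binn sumrB.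
have -> : \sum_(i < r) 'C(2 * r, 2 * (r - i))%:R = \sum_(i < r) 'C(2 * r, 2 * i)%:R :> rat.
  by apply: eq_bigr => i _; rewrite -bin_sub; [congr (_%:R); congr binomial|]; have := ltn_ord i; lia.
by move=> e; lra.
Qed.

Lemma sum_zagcoef r : (0 < r)%N -> \sum_(i < r) zagcoef r i (r - i) = - (-1) ^+ r.
Proof.
move=> r0; rewrite /zagcoef -mulr_sumr sumrB -mulr_sumr sum_bin_odd // sum_bin_even //.
have -> : (2 : rat) ^+ (2 * r) = 2 * 2 ^+ (2 * r).-1.
  by rewrite -exprS; congr (_ ^+ _); lia.
have : (2 : rat) ^+ (2 * r).-1 != 0 by rewrite expf_eq0 andbF.
move: (2 ^+ _) => x x0; field.
by [].
Qed.

(** Inserting x0 on either side of an existing x0 gives the same word, hence the factor 2; only the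
    insertion at the end occurs once. *)
Lemma sh_x0_wtwos (V : zmodType) (f : word -> V) m :
  sh f [:: false] (wtwos m) = f (wthree m 0) + (\sum_(i < m) f (wthree i (m - i))) *+ 2.
Proof.
elim: m f => [|m IH] f.
  by rewrite big_ord0 mul0rn addr0 sh_nilr.
rewrite wtwosS 2!sh_cons !sh_nil IH big_ord_recl subn0 mulrnDl mulr2n addrA.
rewrite addrCA; congr (_ + (_ + _ *+ 2)).
Qed.

(** The product x0 ш {2}^r is killed by [g] and expresses {2}^r x0 through the words ending in
    x1. *)
Lemma zagier_coeff_of_lower (M : lmodType rat) (g : word -> M) r (z : M) :
  (0 < r)%N ->
  (forall u v, u != [::] -> v != [::] -> sh g u v = 0) ->
  (forall a b, (a + b.+1)%N = r -> g (wthree a b.+1) = zagcoef r a b.+1 *: z) ->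
  forall a b, (a + b)%N = r -> g (wthree a b) = zagcoef r a b *: z.
Proof.
move=> r0 gp gZ a [|b]; last exact: gZ.
rewrite addn0 => ->; have := gp [:: false] (wtwos r) isT.
have -> : wtwos r != [::] by case: (r) r0.
move=> /(_ isT); rewrite sh_x0_wtwos => /eqP; rewrite addr_eq0 => /eqP ->.
under eq_bigr => i _.
  have -> : (r - i = (r - i.+1).+1)%N by have := ltn_ord i; lia.
  rewrite gZ; last by have := ltn_ord i; lia.
  have -> : ((r - i.+1).+1 = r - i)%N by have := ltn_ord i; lia.
  over.
rewrite -scaler_suml sum_zagcoef // -scaler_nat scalerA -scaleNr; congr (_ *: _).
by rewrite /zagcoef muln0 bin0 (@bin_small (2 * r)) //; ring.
Qed.

(** * The quotient by R, zeta(2) and products *)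

Section Evaluation.
Variables (M : lmodType rat) (g : word -> M).
Implicit Types p q : fpoly.

Lemma evalp_cat p q : evalp g (p ++ q) = evalp g p + evalp g q.
Proof. exact: big_cat. Qed.

Lemma evalp_nil : evalp g [::] = 0. Proof. exact: big_nil. Qed.

Lemma evalp_pword w : evalp g (pword w) = g w.
Proof. by rewrite /evalp big_seq1 scale1r. Qed.

Lemma evalp_scale c p : evalp g (pscale c p) = c *: evalp g p.
Proof. by rewrite /evalp big_map scaler_sumr; apply: eq_bigr => t _; rewrite scalerA. Qed.

Lemma evalp_sub p q : evalp g (psub p q) = evalp g p - evalp g q.
Proof. by rewrite evalp_cat evalp_scale scaleN1r. Qed.

Lemma evalp_flatten (s : seq fpoly) : evalp g (flatten s) = \sum_(p <- s) evalp g p.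
Proof. by rewrite /evalp big_flatten. Qed.

Lemma evalp_psh p q :
  evalp g (psh p q) = \sum_(a <- p) \sum_(b <- q) (a.1 * b.1) *: sh g a.2 b.2.
Proof.
rewrite /evalp /psh big_flatten big_map; apply: eq_bigr => a _.
rewrite big_flatten big_map; apply: eq_bigr => b _.
by rewrite big_map -scaler_sumr.
Qed.

Lemma evalp_psh_pword u v : evalp g (psh (pword u) (pword v)) = sh g u v.
Proof. by rewrite evalp_psh !big_seq1 mulr1 scale1r. Qed.

Lemma evalp_psh_scaler c p q : evalp g (psh p (pscale c q)) = c *: evalp g (psh p q).
Proof.
rewrite !evalp_psh scaler_sumr; apply: eq_bigr => a _.
rewrite big_map scaler_sumr; apply: eq_bigr => b _.
by rewrite scalerA /= mulrCA.
Qed.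

Lemma evalp_psh_nilr p : evalp g (psh p [::]) = 0.
Proof. by rewrite evalp_psh big1 // => a _; rewrite big_nil. Qed.

Lemma evalp_coef p (s : seq word) : uniq s -> {subset map snd p <= s} ->
  evalp g p = \sum_(w <- s) coef p w *: g w.
Proof.
move=> us; elim: p => [|t p IH] sub.
  by rewrite evalp_nil big1 // => w _; rewrite /coef big_nil scale0r.
rewrite -cat1s evalp_cat IH; last by move=> w wp; apply: sub; rewrite inE wp orbT.
rewrite {1}/evalp big_seq1.
under [in RHS]eq_bigr => w _ do rewrite /coef big_cat scalerDl.
rewrite big_split; congr (_ + _).
have ts : t.2 \in s by apply: sub; rewrite inE eqxx.
rewrite (bigD1_seq t.2) //= big_mkcond big_seq1 eqxx big1 ?addr0 // => w wt.
by rewrite big_mkcond big_seq1 eq_sym (negPf wt) scale0r.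
Qed.

Lemma peq_evalp p q : peq p q -> evalp g p = evalp g q.
Proof.
move=> e; rewrite (@evalp_coef p (undup (map snd (p ++ q)))) ?undup_uniq //; last first.
  by move=> w wp; rewrite mem_undup map_cat mem_cat wp.
rewrite (@evalp_coef q (undup (map snd (p ++ q)))) ?undup_uniq //; last first.
  by move=> w wp; rewrite mem_undup map_cat mem_cat wp orbT.
by apply: eq_bigr => w _; rewrite e.
Qed.

End Evaluation.

Lemma coefE p w : coef p w = evalp (fun v => (v == w)%:R : rat^o) p.
Proof.
rewrite /coef /evalp big_mkcond; apply: eq_bigr => t _.
by case: eqP => _; rewrite ?scaler0 // /GRing.scale /= mulr1.
Qed.

(** A coefficient is itself an evaluation, so identities between lists reduce to linear algebra in
    an arbitrary module. *)
Lemma peqP p q : (forall (M : lmodType rat) (g : word -> M), evalp g p = evalp g q) -> peq p q.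
Proof. by move=> e w; rewrite !coefE e. Qed.

Lemma peq_inR p q : peq p q -> inR p -> inR q.
Proof. by move=> e [gs [h1 h2]]; exists gs; split => // w; rewrite -e. Qed.

Lemma inR_scale c p : inR p -> inR (pscale c p).
Proof.
move=> [gs [h1 h2]]; exists [seq (x.1, pscale c x.2) | x <- gs]; split.
  by move=> x /mapP[y yg ->]; apply: (h1 y).
apply: peqP => M g; rewrite evalp_scale (peq_evalp g h2) !evalp_flatten !big_map scaler_sumr.
by apply: eq_bigr => x _; rewrite evalp_psh_scaler.
Qed.

Lemma inR_cat p q : inR p -> inR q -> inR (p ++ q).
Proof.
move=> [gs [h1 h2]] [gs' [h1' h2']]; exists (gs ++ gs'); split.
  by move=> x; rewrite mem_cat => /orP[/h1|/h1'].
apply: peqP => M g.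
by rewrite map_cat flatten_cat !evalp_cat (peq_evalp g h2) (peq_evalp g h2').
Qed.

Lemma inR_nil : inR [::].
Proof. by exists [::]; split. Qed.

Lemma peq_inJ p q : peq p q -> inJ p -> inJ q.
Proof. by move=> e [r [h [ab [h1 [h2 h3]]]]]; exists r, h, ab; do 2 split => //; move=> w; rewrite -e. Qed.

Lemma evalp_cat3 (M : lmodType rat) (g : word -> M) r z s :
  evalp g (r ++ z ++ s) = evalp g r + (evalp g z + evalp g s).
Proof. by rewrite evalp_cat (evalp_cat g z). Qed.

Lemma inJ_scale c p : inJ p -> inJ (pscale c p).
Proof.
move=> [r [h [ab [h1 [h2 h3]]]]].
exists (pscale c r), (pscale c h), [seq (x.1, pscale c x.2) | x <- ab]; split; last split.
- exact: inR_scale.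
- move=> x /mapP[y /h2[y1 y2] ->]; split => //=.
  by apply/allP => t /mapP[t' /(allP y2) t'2 ->].
apply: peqP => M g; rewrite evalp_scale (peq_evalp g h3) !evalp_cat3 (evalp_scale g c r) evalp_psh_scaler.
rewrite !scalerDr; congr (_ + (_ + _)); rewrite !evalp_flatten !big_map scaler_sumr.
by apply: eq_bigr => x _; rewrite evalp_psh_scaler.
Qed.

Lemma evalp_psh_catr (M : lmodType rat) (g : word -> M) p q1 q2 :
  evalp g (psh p (q1 ++ q2)) = evalp g (psh p q1) + evalp g (psh p q2).
Proof. by rewrite !evalp_psh -big_split; apply: eq_bigr => a _; rewrite big_cat. Qed.

Lemma inJ_cat p q : inJ p -> inJ q -> inJ (p ++ q).
Proof.
move=> [r [h [ab [h1 [h2 h3]]]]] [r' [h' [ab' [h1' [h2' h3']]]]].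
exists (r ++ r'), (h ++ h'), (ab ++ ab'); split; last split.
- exact: inR_cat.
- by move=> x; rewrite mem_cat => /orP[/h2|/h2'].
apply: peqP => M g; rewrite evalp_cat (peq_evalp g h3) (peq_evalp g h3').
rewrite map_cat flatten_cat !evalp_cat3 evalp_psh_catr (evalp_cat g r) (evalp_cat g (flatten _)).
by rewrite [LHS](AC ((1*2)*(1*2)) ((1*4)*((2*5)*(3*6)))).
Qed.

Lemma inR_inJ p : inR p -> inJ p.
Proof.
move=> h; exists p, [::], [::]; split => //; split => //.
by apply: peqP => M g; rewrite evalp_cat3 evalp_psh_nilr !addr0.
Qed.

Lemma inJ_prod u v : u != [::] -> v != [::] -> inJ (psh (pword u) (pword v)).
Proof.
move=> u0 v0; exists [::], [::], [:: (pword u, pword v)]; split; last split.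
- exact: inR_nil.
- by move=> x; rewrite inE => /eqP ->; rewrite /posw /= !andbT; case: (u) u0; case: (v) v0.
by apply: peqP => M g; rewrite evalp_cat3 !evalp_psh_nilr ?evalp_nil !add0r /= cats0.
Qed.

Definition eqJ (p q : fpoly) : bool := `[< inJ (psub p q) >].

Lemma eqJ_refl : reflexive eqJ.
Proof.
move=> p; apply/asboolP; apply: (peq_inJ _ (inR_inJ inR_nil)).
by apply: peqP => M g; rewrite evalp_sub subrr evalp_nil.
Qed.

Lemma eqJ_sym : symmetric eqJ.
Proof.
suff h p q : eqJ p q -> eqJ q p by move=> p q; apply/idP/idP; apply: h.
move=> /asboolP /(inJ_scale (-1)) h; apply/asboolP; apply: peq_inJ h.
by apply: peqP => M g; rewrite evalp_scale !evalp_sub scaleN1r opprB.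
Qed.

Lemma eqJ_trans : transitive eqJ.
Proof.
move=> q p r /asboolP h1 /asboolP h2; apply/asboolP; apply: (peq_inJ _ (inJ_cat h1 h2)).
by apply: peqP => M g; rewrite evalp_cat !evalp_sub addrA subrK.
Qed.

Definition eqJ_equiv := EquivRel eqJ eqJ_refl eqJ_sym eqJ_trans.
(** Q<X>/J, made into a rational vector space below; membership of a left tensor factor in J becomes
    an equation there. *)
Definition Lquot := {eq_quot eqJ_equiv}.
HB.instance Definition _ := Choice.on Lquot.
HB.instance Definition _ := EqQuotient.on Lquot.

Definition cls (p : fpoly) : Lquot := \pi_Lquot p.

Lemma clsP p q : inJ (psub p q) -> cls p = cls q.
Proof. by move=> h; apply/eqmodP/asboolP. Qed.

Lemma cls_eqJ p q : cls p = cls q -> inJ (psub p q).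
Proof. by move=> /eqmodP/asboolP. Qed.

Lemma cls_repr x : cls (repr x) = x.
Proof. exact: reprK. Qed.

Lemma cls_peq p q : peq p q -> cls p = cls q.
Proof.
move=> e; apply: clsP; apply: (peq_inJ _ (inR_inJ inR_nil)).
by apply: peqP => M g; rewrite evalp_sub (peq_evalp g e) subrr evalp_nil.
Qed.

Definition addL (x y : Lquot) : Lquot := cls (repr x ++ repr y).
Definition scaleL (c : rat) (x : Lquot) : Lquot := cls (pscale c (repr x)).

Lemma addL_cls p q : addL (cls p) (cls q) = cls (p ++ q).
Proof.
have := inJ_cat (cls_eqJ (cls_repr (cls p))) (cls_eqJ (cls_repr (cls q))) => h.
apply: clsP; apply: peq_inJ h; apply: peqP => M g.
rewrite !(evalp_cat, evalp_scale) scalerDr addrACA //.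
Qed.

Lemma scaleL_cls c p : scaleL c (cls p) = cls (pscale c p).
Proof.
have := inJ_scale c (cls_eqJ (cls_repr (cls p))) => h.
apply: clsP; apply: peq_inJ h; apply: peqP => M g.
by rewrite !(evalp_cat, evalp_scale) scalerDr !scalerA mulrC.
Qed.

Lemma addLA : associative addL.
Proof.
by move=> x y z; rewrite -(cls_repr x) -(cls_repr y) -(cls_repr z) !addL_cls catA.
Qed.

Lemma addLC : commutative addL.
Proof.
move=> x y; rewrite -(cls_repr x) -(cls_repr y) !addL_cls.
by apply: cls_peq; apply: peqP => M g; rewrite !evalp_cat addrC.
Qed.

Lemma add0L : left_id (cls [::]) addL.
Proof. by move=> x; rewrite -(cls_repr x) addL_cls. Qed.

Lemma addNL : left_inverse (cls [::]) (scaleL (-1)) addL.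
Proof.
move=> x; rewrite -(cls_repr x) scaleL_cls addL_cls.
by apply: cls_peq; apply: peqP => M g; rewrite evalp_cat evalp_scale scaleN1r addNr evalp_nil.
Qed.

HB.instance Definition _ := GRing.isZmodule.Build Lquot addLA addLC add0L addNL.

Lemma scaleLA a b x : scaleL a (scaleL b x) = scaleL (a * b) x.
Proof.
rewrite -(cls_repr x) !scaleL_cls.
by apply: cls_peq; apply: peqP => M g; rewrite !evalp_scale scalerA.
Qed.

Lemma scale1L : left_id 1 scaleL.
Proof.
move=> x; rewrite -(cls_repr x) !scaleL_cls.
by apply: cls_peq; apply: peqP => M g; rewrite !evalp_scale scale1r.
Qed.

Lemma scaleLDr : right_distributive scaleL +%R.
Proof.
move=> c x y; rewrite -(cls_repr x) -(cls_repr y) -![_ + _]/(addL _ _).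
rewrite !(scaleL_cls, addL_cls).
by apply: cls_peq; apply: peqP => M g; rewrite !(evalp_cat, evalp_scale) scalerDr.
Qed.

Lemma scaleLDl x : {morph scaleL^~ x : a b / a + b}.
Proof.
move=> a b /=; rewrite -(cls_repr x) -[RHS]/(addL _ _) !(scaleL_cls, addL_cls).
by apply: cls_peq; apply: peqP => M g; rewrite !(evalp_cat, evalp_scale) scalerDl.
Qed.

HB.instance Definition _ :=
  GRing.Zmodule_isLmodule.Build rat Lquot scaleLA scale1L scaleLDr scaleLDl.

Definition clsw (w : word) : Lquot := cls (pword w).

Lemma clsE p : cls p = evalp clsw p.
Proof.
elim: p => [|t p IH]; first by rewrite evalp_nil.
rewrite -cat1s evalp_cat -IH -addL_cls; congr addL.
rewrite /evalp big_seq1 /clsw -[RHS]/(scaleL _ _) scaleL_cls.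
by apply: cls_peq; apply: peqP => M g; rewrite evalp_scale evalp_pword /evalp big_seq1.
Qed.

Lemma inJ_cls p : inJ p <-> evalp clsw p = 0.
Proof.
rewrite -clsE -[0]/(cls [::]); split => [h|/cls_eqJ h].
  apply: clsP; apply: peq_inJ h.
  by apply: peqP => M g; rewrite evalp_sub evalp_nil subr0.
by apply: peq_inJ h; apply: peqP => M g; rewrite evalp_sub evalp_nil subr0.
Qed.

(** * Testing the vanishing of D_k by functionals on the right factor *)

Section Weight.
Variable k : nat.

Definition clsk (w : word) : Lquot := if size w == k then clsw w else 0.

Lemma clsk_size w : size w != k -> clsk w = 0.
Proof. by rewrite /clsk => /negPf ->. Qed.

Lemma clsk_prod u v : u != [::] -> v != [::] -> sh clsk u v = 0.
Proof.
move=> u0 v0; case: (eqVneq (size u + size v)%N k) => e.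
  rewrite (@eq_sh_size _ clsk clsw) => [|s es]; last by rewrite /clsk es e eqxx.
  by rewrite -evalp_psh_pword; apply/inJ_cls/inJ_prod.
rewrite (@eq_sh_size _ clsk (fun=> 0)) ?sh0 // => s es.
by apply: clsk_size; rewrite es.
Qed.

Lemma evalt_Delta h p : evalt clsk h (Delta p) = evalp (fun w => evalt clsk h (gon true [::] w)) p.
Proof.
rewrite /evalt /Delta big_flatten big_map; apply: eq_bigr => q _.
rewrite big_map scaler_sumr; apply: eq_bigr => t _.
by rewrite scalerA mulrA.
Qed.

(** Collect the weight-k terms by their right word w. Taking for [h] the indicator of w shows that
    the collected left factor lies in J. *)
Lemma DvanishP p : (forall h, evalt clsk h (Delta p) = 0) -> Dvanish k p.
Proof.
set T := Delta p => hT; pose Tk := [seq t <- T | size t.1.2 == k].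
pose slice w : fpoly := [seq (t.1.1, t.1.2) | t <- Tk & t.2 == w].
pose ws := undup (map snd Tk).
exists [seq (slice w, pword w) | w <- ws], [::]; split; last split => //.
  move=> x /mapP[w _ ->] /=; split.
    apply/allP => t /mapP[t']; rewrite mem_filter => /andP[_].
    by rewrite mem_filter => /andP[h _] ->.
  apply/inJ_cls; rewrite -[RHS](hT (fun v => (v == w)%:R)).
  rewrite /evalt /evalp big_map big_filter big_filter_cond.
  rewrite big_mkcond; apply: eq_bigr => t _ /=; rewrite /clsk.
  by case: (size _ == k); case: (t.2 == w); rewrite /= ?scaler0 ?mulr0 ?scale0r // mulr1.
move=> w1 w2; rewrite cats0 -map_comp /tcoef big_flatten big_map.
rewrite -/Tk.
under [RHS]eq_bigr => w _.
  rewrite /= /ptens big_flatten /= big_map.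
  under eq_bigr => t _ do rewrite big_mkcond big_seq1 /= mulr1.
  rewrite -big_mkcond /slice big_map big_filter_cond /=.
  over.
rewrite /=.
transitivity (\sum_(w <- ws) \sum_(i <- Tk | (i.2 == w) && ((i.1.2 == w1) && (i.2 == w2))) i.1.1).
  rewrite (exchange_big_dep (fun t => (t.1.2 == w1) && (t.2 == w2))) /= => [|w i _ /andP[] //]; rewrite big_seq_cond [RHS]big_seq_cond.
  apply: eq_bigr => t /andP[tT /andP[t1 t2]].
  have tw : t.2 \in ws by rewrite mem_undup map_f.
  under eq_bigl => w do rewrite t1 t2 !andbT eq_sym.
  rewrite -big_filter (_ : [seq i <- ws | i == t.2] = [:: t.2]) ?big_seq1 //.
  by rewrite filter_pred1_uniq ?undup_uniq.
apply: eq_bigr => w _; apply: eq_bigl => t.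
by case: (t.2 =P w) => [->|].
Qed.

End Weight.

(** * Both sides of the identity, and the vanishing of D on their difference *)

Definition lhs a b : fpoly := zeta (nseq a 2%N ++ 3%N :: nseq b 2%N).
Definition rhs a b : fpoly :=
  flatten [seq pscale (cab a b r)
                 (psh (zeta [:: (2 * r + 1)%N]) (zeta (nseq (a + b + 1 - r) 2%N)))
          | r <- iota 1 (a + b + 1)].

Lemma iw_cat s t : iw (s ++ t) = iw s ++ iw t.
Proof. by rewrite /iw map_cat flatten_cat. Qed.

Lemma lhsE a b : lhs a b = pword (wthree a b.+1).
Proof. by rewrite /lhs /zeta iw_cat. Qed.

Lemma zeta_oddE r : zeta [:: (2 * r + 1)%N] = pword (wodd r).
Proof.
by rewrite /zeta /iw /wodd /= cats0 -cats1; congr (pword (nseq _ _ ++ _)); lia.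
Qed.

Lemma evalp_rhs (M : lmodType rat) (g : word -> M) a b : evalp g (rhs a b) =
  \sum_(r <- iota 1 (a + b + 1)) cab a b r *: sh g (wodd r) (wtwos (a + b + 1 - r)).
Proof.
rewrite /rhs evalp_flatten big_map; apply: eq_bigr => r _.
by rewrite evalp_scale zeta_oddE -[zeta _]/(pword (wtwos _)) evalp_psh_pword.
Qed.

Lemma zagcoefE a b r : zagcoef r a b.+1 = cab a b r.
Proof.
rewrite /zagcoef /cab; congr (_ * (_ - _ * _)); congr (_%:R); congr binomial; lia.
Qed.

Lemma hom_psub n p q : Defs.hom n p -> Defs.hom n q -> Defs.hom n (psub p q).
Proof.
rewrite /Defs.hom /psub all_cat => -> /allP h; apply/allP => t /mapP[t' /h tseq ->].
exact: tseq.
Qed.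

Lemma hom_identity a b : Defs.hom (2 * (a + b + 1)).+1 (psub (lhs a b) (rhs a b)).
Proof.
apply: hom_psub.
  by rewrite lhsE /Defs.hom /= andbT size_wthree; apply/eqP; congr (_.+1); lia.
apply/allP => t /flattenP[p /mapP[r]]; rewrite mem_iota => hr -> /mapP[t' + ->] /=.
rewrite zeta_oddE -[zeta _]/(pword (wtwos _)) /psh /= !cats0 => /mapP[s /size_shw + ->] /=.
rewrite size_wodd size_wtwos => ->; apply/eqP; lia.
Qed.

Lemma zagier_cls a b : zeq (lhs a b) (rhs a b) ->
  clsw (wthree a b.+1) = cab a b (a + b + 1) *: clsw (wodd (a + b + 1)).
Proof.
move=> /inR_inJ/inJ_cls; rewrite evalp_sub lhsE evalp_pword evalp_rhs => /eqP.
rewrite subr_eq0 => /eqP ->.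
(* Only the last summand, whose second factor is the empty word, is not a product. *)
rewrite iotaD big_cat /= big_seq1 big_seq big1 ?add0r => [|r].
  have -> : (1 + (a + b) = a + b + 1)%N by lia.
  by rewrite subnn sh_nilr.
rewrite mem_iota => hr.
rewrite -evalp_psh_pword (_ : evalp _ _ = 0) ?scaler0 //.
apply/inJ_cls/inJ_prod; first by rewrite -size_eq0 size_wodd.
by rewrite -size_eq0 size_wtwos; apply/eqP; lia.
Qed.

Lemma Dvanish_identity a b r :
  (forall a' b', (a' + b' < a + b)%N -> zeq (lhs a' b') (rhs a' b')) ->
  (0 < r)%N -> (r < a + b + 1)%N ->
  Dvanish (2 * r).+1 (psub (lhs a b) (rhs a b)).
Proof.
move=> IH r0 rn; apply: DvanishP => h.
set k := (2 * r).+1; have gp := @clsk_prod k; have gs := @clsk_size k.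
have gn : clsk k [::] = 0 by apply: gs.
rewrite evalt_Delta.
transitivity (evalp (der (clsk k) h true) (psub (lhs a b) (rhs a b))).
  by apply: eq_bigr => t _; rewrite evalt_gon_nil.
(* The factors have weight 2r+1, less than that of the whole word, so the induction hypothesis gives
   the classes of those ending in x1. *)
have gZ : forall a' b', (a' + b')%N = r -> clsk k (wthree a' b') = zagcoef r a' b' *: clsk k (wodd r).
  apply: zagier_coeff_of_lower => // a' b' e; rewrite /clsk size_wthree e size_wodd eqxx zagcoefE.
  rewrite zagier_cls; last by apply: IH; lia.
  by congr (cab _ _ _ *: clsw (wodd _)); lia.
rewrite evalp_sub lhsE evalp_pword evalp_rhs (der_wthree r0 gp gs gZ).
rewrite dercoefE //; last lia.
under eq_bigr => s _ do rewrite (sh_der_wodd_wtwos r0 gp gs) scalerA.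
(* On the right-hand side D_(2r+1) sees only the summand containing zeta(2r+1). *)
rewrite (bigD1_seq r) ?iota_uniq ?mem_iota /=; try lia.
rewrite big1 ?addr0 => [|s /negPf ->]; last by rewrite mul0r mulr0 scale0r.
rewrite eqxx mul1r zagcoefE.
have -> : (a + b.+1 - r = a + b + 1 - r)%N by lia.
exact: subrr.
Qed.

(** * Taylor coefficients of multiple polylogarithms *)

Section LastLetter.
Variable V : zmodType.
Implicit Types (g : word -> V) (u v w : word).

(** Removing a final x0 is differentiation in log t of a polylogarithm expanded in powers of log
    t. *)
Definition dlast g w : V :=
  if w is a :: s then if last a s then 0 else g (belast a s) else 0.

Lemma dec_last g w : dec (fun p q => if q == [:: false] then g p else 0) w = dlast g w.
Proof.
elim: w g => [|a w IH] g; first by rewrite /= addr0.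
rewrite [LHS]/= IH; case: w {IH} => [|b w]; first by case: a; rewrite /= ?addr0.
rewrite (_ : (_ == _) = false) ?add0r //.
by case: a.
Qed.

Lemma dec_nilr (F : word -> V) w : dec (fun p q => if q is [::] then F p else 0) w = F w.
Proof. by elim: w F => [|a w IH] F /=; rewrite ?addr0 // add0r (IH (fun p => F (a :: p))). Qed.

Lemma sh_single x u v :
  sh (fun q => if q == [:: false] then x else 0) u v =
  (if v is [::] then if u == [:: false] then x else 0 else 0)
  + (if u is [::] then if v == [:: false] then x else 0 else 0) :> V.
Proof.
case: u => [|a u]; case: v => [|b v]; rewrite ?sh_nil ?sh_nilr ?addr0 ?add0r //.
rewrite /sh big1_seq // => s /andP[_ /size_shw]; case: eqP => [->|//] /=; lia.
Qed.

(** A derivation, since the last letter of a shuffle comes from one of the two words. *)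
Lemma sh_dlast g u v :
  sh (dlast g) u v = dlast (fun s => sh g s v) u + dlast (fun s => sh g u s) v.
Proof.
rewrite -(eq_sh _ _ (dec_last g)) sh_dec.
transitivity (dec (fun u1 u2 => dec (fun v1 v2 =>
   (if v2 is [::] then if u2 == [:: false] then sh g u1 v1 else 0 else 0)
  + (if u2 is [::] then if v2 == [:: false] then sh g u1 v1 else 0 else 0)) v) u).
  apply: eq_dec => u1 u2; apply: eq_dec => v1 v2.
  rewrite (eq_sh _ _ (fun p => sh_single (g p) u2 v2)) shD; congr (_ + _).
    by case: v2 => [|? ?]; case: (u2 == _); rewrite ?sh0.
  by case: u2 => [|? ?]; case: (v2 == _); rewrite ?sh0.
transitivity (dec (fun u1 u2 => (if u2 == [:: false] then sh g u1 v else 0) +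
  if u2 is [::] then dec (fun v1 v2 => if v2 == [:: false] then sh g u1 v1 else 0) v else 0) u).
  apply: eq_dec => u1 u2; rewrite decD; congr (_ + _).
    by case: (u2 == _); rewrite ?dec_nilr // -[RHS](dec0 V v); apply: eq_dec => ? [|? ?].
  by case: u2 => [|? ?]; rewrite ?dec0.
by rewrite decD dec_last dec_nilr dec_last.
Qed.

End LastLetter.

Section Polylog.
Variable K : numFieldType.
Implicit Types (f g : nat -> K) (u v w : word).

Definition conv f g n : K := \sum_(i < n.+1) f i * g (n - i)%N.
(** Multiplication by t/(1-t) for x1 and by 1 for x0: the forms dt/(1-t) and dt/t, read against the
    operator t d/dt. *)
Definition omega (a : bool) f n : K := if a then \sum_(i < n) f i else f n.

(** The differential equation is recursive both in the tail of the word and in the word without its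
    last letter, hence the fuel. *)
Fixpoint lic_rec_fuel m w n : K :=
  match m, w with
  | m'.+1, a :: s =>
      if n is 0%N then 0 else
      n%:R^-1 * (omega a (lic_rec_fuel m' s) n - if last a s then 0 else lic_rec_fuel m' (belast a s) n)
  | _, _ => (n == 0)%:R
  end.

(* The coefficient of t^n in the multiple polylogarithm of w, a power series in t
   whose coefficients are polynomials in log t, after setting log t to 0. *)
Definition lic w n : K := lic_rec_fuel (size w) w n.

Lemma lic_nil n : lic [::] n = (n == 0)%:R. Proof. by []. Qed.

Lemma lic_cons0 a w : lic (a :: w) 0 = 0. Proof. by []. Qed.

Lemma lic_rec a w n :
  n%:R * lic (a :: w) n = omega a (lic w) n - dlast (lic^~ n) (a :: w).
Proof.
case: n => [|n]; last by rewrite /lic /= mulVKf ?pnatr_eq0 // size_belast.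
rewrite mul0r /omega; case: a => /=; case: w => [|b w] /=; rewrite ?big_ord0 /lic /=.
- by rewrite subrr.
- by case: ifP; rewrite subr0.
- by rewrite subrr.
- by case: ifP; rewrite subr0.
Qed.

Lemma omega_conv a f g n : omega a (conv f g) n = conv (omega a f) g n.
Proof.
rewrite /omega; case: a => //; elim: n => [|n IH]; first by rewrite /conv big_ord0 big_ord1 big_ord0 mul0r.
rewrite big_ord_recr /= IH /conv [RHS]big_ord_recl big_ord0 mul0r add0r -big_split.
by apply: eq_bigr => i _; rewrite /= /bump /= add1n big_ord_recr /= mulrDl.
Qed.

Lemma convC f g n : conv f g n = conv g f n.
Proof.
rewrite /conv (reindex_inj rev_ord_inj); apply: eq_bigr => i _ /=.
by rewrite mulrC subSS subKn // -ltnS.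
Qed.

Lemma convD f f' g n : conv (fun i => f i - f' i) g n = conv f g n - conv f' g n.
Proof. by rewrite /conv -sumrB; apply: eq_bigr => i _; rewrite mulrBl. Qed.

Lemma conv_lic_nil f n : conv (lic [::]) f n = f n.
Proof.
rewrite /conv big_ord_recl subn0 mul1r big1 ?addr0 // => i _.
by rewrite lic_nil mul0r.
Qed.

Lemma conv_deriv f g n :
  n%:R * conv f g n = conv (fun i => i%:R * f i) g n + conv f (fun i => i%:R * g i) n.
Proof.
rewrite /conv mulr_sumr -big_split; apply: eq_bigr => i _ /=.
by rewrite -{1}(subnKC (ltn_ord i : i <= n)%N) natrD; ring.
Qed.

Lemma eq_conv f f' g g' n : f =1 f' -> g =1 g' -> conv f g n = conv f' g' n.
Proof. by move=> e e'; apply: eq_bigr => i _; rewrite e e'. Qed.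

Lemma dlast_conv w g n :
  dlast (fun s => conv (lic s) g n) w = conv (fun i => dlast (lic^~ i) w) g n.
Proof.
case: w => [|a s] /=; first by rewrite /conv big1 // => i _; rewrite mul0r.
by case: last => //; rewrite /conv big1 // => i _; rewrite mul0r.
Qed.

Lemma eq_dlast_size (g1 g2 : word -> K) w :
  (forall s, (size s < size w)%N -> g1 s = g2 s) -> dlast g1 w = dlast g2 w.
Proof.
by case: w => [|a s] //= e; case: ifP => // _; apply: e; rewrite size_belast.
Qed.

Lemma omega_sh a u v n : omega a (fun m => sh (lic^~ m) u v) n = sh (fun s => omega a (lic s) n) u v.
Proof. by case: a => //=; rewrite sh_sum. Qed.

Lemma eq_omega a f f' n : f =1 f' -> omega a f n = omega a f' n.
Proof. by case: a => //= e; apply: eq_bigr => i _. Qed.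

(** Multiplying by n is t d/dt, a derivation of the Cauchy product, and removing a final x0 is a
    derivation of the shuffle product; both sides then satisfy the same recursion. *)
Lemma sh_lic u v n : sh (lic^~ n) u v = conv (lic u) (lic v) n.
Proof.
have [N] := ubnP (size u + size v); elim: N u v n => // N IH u v n.
case: u => [|a u]; first by rewrite sh_nil conv_lic_nil.
case: v => [|b v]; first by rewrite sh_nilr convC conv_lic_nil.
move=> hN; case: n => [|n].
  rewrite sh_cons (eq_sh _ _ (lic_cons0 a)) (eq_sh _ _ (lic_cons0 b)) !sh0 addr0.
  by rewrite /conv big_ord1 lic_cons0 mul0r.
set m := n.+1; have m0 : m%:R != 0 :> K by rewrite pnatr_eq0.
apply: (mulfI m0); rewrite conv_deriv.
rewrite (eq_conv _ (fun i => lic_rec a u i) (fun=> erefl)) convD.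
rewrite (eq_conv _ (fun=> erefl) (fun i => lic_rec b v i)) (convC (lic (a :: u))) convD.
rewrite -!omega_conv -!dlast_conv.
transitivity (sh (fun s => m%:R * lic s m) (a :: u) (b :: v)).
  by rewrite /sh mulr_sumr.
rewrite sh_cons (eq_sh _ _ (fun s => lic_rec a s m)) (eq_sh _ _ (fun s => lic_rec b s m)).
rewrite !shD !shN -!omega_sh addrACA -opprD.
rewrite -(sh_cons (dlast (lic^~ m))) sh_dlast opprD addrACA.
congr (_ - _ + (_ - _)).
- by apply: eq_omega => i; apply: IH; move: hN => /=; lia.
- apply: eq_dlast_size => s hs; apply: IH; move: hN hs => /=; lia.
- apply: eq_omega => i; rewrite convC; apply: IH; move: hN => /=; lia.
- apply: eq_dlast_size => s hs; rewrite convC; apply: IH; move: hN hs => /=; lia.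
Qed.

(** * Harmonic sums and the stuffle product *)

Definition hsum ks m : K := \sum_(i < m.+1) lic (iw ks) i.

Lemma last_iw k ks b : last b (iw (k :: ks)) = true.
Proof.
rewrite /iw /= last_cat -[flatten _]/(iw ks) last_rcons.
elim: ks => [|j ks IH] //; rewrite /iw /= last_cat last_rcons; exact: IH.
Qed.

Lemma iw_cons k ks : iw (k.+1 :: ks) = nseq k false ++ true :: iw ks.
Proof. by rewrite /iw /= cat_rcons. Qed.

Lemma dlast_iw (g : word -> K) k ks : dlast g (iw (k :: ks)) = 0.
Proof.
case e : (iw (k :: ks)) => [|a s] //=.
by have := last_iw k ks a; rewrite e /= => ->.
Qed.

(** Each Taylor coefficient is 1/n^k times the inner sum up to n-1, so the partial sums [hsum] are
    truncated multiple zeta values. *)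
Lemma lic_iw k ks n : lic (iw (k.+1 :: ks)) n.+1 = n.+1%:R^-1 ^+ k.+1 * hsum ks n.
Proof.
have n0 : n.+1%:R != 0 :> K by rewrite pnatr_eq0.
apply: (mulfI (expf_neq0 k.+1 n0)); rewrite mulrA -exprMn divff // expr1n mul1r.
elim: k => [|k IH].
  have e : iw (1%N :: ks) = true :: iw ks by rewrite iw_cons.
  by rewrite expr1 e lic_rec -e dlast_iw subr0.
have e : iw (k.+2 :: ks) = false :: iw (k.+1 :: ks) by rewrite !iw_cons.
by rewrite exprSr -mulrA e lic_rec -e dlast_iw subr0.
Qed.

Lemma hsumS k ks m : hsum (k.+1 :: ks) m.+1 = hsum (k.+1 :: ks) m + m.+1%:R^-1 ^+ k.+1 * hsum ks m.
Proof. by rewrite {1}/hsum big_ord_recr /= -lic_iw. Qed.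

Lemma hsum0 k ks : hsum (k.+1 :: ks) 0 = 0.
Proof. by rewrite /hsum big_ord1 iw_cons; case: k. Qed.

Lemma hsum_nil m : hsum [::] m = 1.
Proof. by rewrite /hsum big_ord_recl big1 ?addr0. Qed.

Definition stsum (h : seq nat -> K) ks ls : K := \sum_(s <- stw ks ls) h s.

Lemma stsum_nil h ls : stsum h [::] ls = h ls. Proof. by rewrite /stsum big_seq1. Qed.
Lemma stsum_nilr h ks : stsum h ks [::] = h ks. Proof. by case: ks => [|i ks]; rewrite /stsum big_seq1. Qed.
Lemma stsum_cons h i ks j ls : stsum h (i :: ks) (j :: ls) =
  stsum (fun s => h (i :: s)) ks (j :: ls) + stsum (fun s => h (j :: s)) (i :: ks) ls
  + stsum (fun s => h ((i + j)%N :: s)) ks ls.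
Proof. by rewrite /stsum /= !big_cat /= !big_map addrA. Qed.

(** In the inner induction on m, expanding the product of the two sums with their new terms gives
    the three branches of the stuffle recursion. *)
Lemma stsum_hsum ks ls m : all (ltn 0) ks -> all (ltn 0) ls ->
  stsum (hsum^~ m) ks ls = hsum ks m * hsum ls m.
Proof.
have [N] := ubnP (size ks + size ls); elim: N ks ls m => // N IH ks ls m.
case: ks => [|i ks]; first by rewrite stsum_nil hsum_nil mul1r.
case: ls => [|j ls]; first by rewrite stsum_nilr hsum_nil mulr1.
move=> hN /andP[i0 hk] /andP[j0 hl]; case: i i0 hN => // i _; case: j j0 => // j _ hN.
elim: m => [|m IHm].
  by rewrite stsum_cons /stsum !big1 ?hsum0 ?mul0r ?addr0 // => s _; rewrite ?addSn hsum0.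
have E k a b : (size a + size b < N)%N -> all (ltn 0) a -> all (ltn 0) b ->
   stsum (fun s => hsum (k.+1 :: s) m.+1) a b =
   stsum (fun s => hsum (k.+1 :: s) m) a b + m.+1%:R^-1 ^+ k.+1 * (hsum a m * hsum b m).
  move=> ab a0 b0; rewrite -IH // /stsum mulr_sumr -big_split.
  by apply: eq_bigr => s _; rewrite hsumS.
rewrite stsum_cons addSn !E //=; try (move: hN => /=; lia).
rewrite !hsumS -addSn exprD.
move: IHm; rewrite stsum_cons; set a := stsum _ _ _; set b := stsum _ _ _; set c := stsum _ _ _ => IHm.
set x := m.+1%:R^-1 ^+ i.+1; set y := m.+1%:R^-1 ^+ j.+1.
transitivity (a + b + c + (x * (hsum ks m * hsum (j.+1 :: ls) m) +
   y * (hsum (i.+1 :: ks) m * hsum ls m) + x * y * (hsum ks m * hsum ls m))); first by ring.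
by rewrite IHm; ring.
Qed.

End Polylog.

(** * Derivatives of beta polynomials *)

Section BetaPoly.
Variables (K : numFieldType) (c : K).

(** Normalised so that the derivatives at 0 and at [c] are, up to sign, binomial coefficients times
    divided powers of [c]. *)
Definition bpoly a q : {poly K} := (a`!%:R^-1 * q`!%:R^-1) *: ('X^a * (c%:P - 'X) ^+ q).

Lemma bpoly_comp a q : bpoly a q \Po (c%:P - 'X) = bpoly q a.
Proof.
rewrite /bpoly comp_polyZ comp_polyM comp_Xn_poly rmorphXn /= comp_polyB comp_polyC comp_polyX.
by rewrite subKr; congr (_ *: _); rewrite mulrC.
Qed.

Lemma derivn_comp_reflect (p : {poly K}) i :
  (p \Po (c%:P - 'X))^`(i) = (-1) ^+ i *: (p^`(i) \Po (c%:P - 'X)).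
Proof.
elim: i => [|i IH]; first by rewrite scale1r.
rewrite !derivnS IH derivZ deriv_comp derivB derivC derivX sub0r mulrN1 scalerN exprS mulN1r scaleNr.
by [].
Qed.

Lemma bpoly_at_c a q i : (bpoly a q)^`(i).[c] = (-1) ^+ i * (bpoly q a)^`(i).[0].
Proof.
rewrite -(bpoly_comp q a) derivn_comp_reflect hornerZ horner_comp hornerD hornerN hornerC hornerX subrr.
by [].
Qed.

Lemma coef_reflectX q m : ((c%:P - 'X) ^+ q)`_m = (-1) ^+ m * c ^+ (q - m) *+ 'C(q, m).
Proof.
elim: q m => [|q IH] m.
  rewrite expr0 coef1; case: m => [|m]; first by rewrite bin0 mulr1n mul1r.
  by rewrite bin_small.
rewrite exprS mulrBl coefB coefCM coefXM; case: m => [|m].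
  by rewrite subr0 IH !bin0 !mulr1n !mul1r !subn0 exprS.
rewrite !IH /= subSS binS mulrnDr; congr (_ + _); last first.
  by rewrite exprS mulN1r mulNr mulNrn.
case: (ltnP m q) => h; last by rewrite bin_small // !mulr0n ?mulr0.
have -> : (q - m = (q - m.+1).+1)%N by lia.
by rewrite mulrnAr; congr (_ *+ _); rewrite [c ^+ _.+1]exprS; ring.
Qed.

Lemma bpoly_at0 a q i : (i <= a + q)%N -> (bpoly a q)^`(i).[0] =
  (-1) ^+ (i - a) * 'C(i, a)%:R * c ^+ (a + q - i) / (a + q - i)`!%:R.
Proof.
move=> hi; rewrite horner_coef0 coef_derivn addn0 ffactnn coefZ coefXnM.
case: ltnP => ia; first by rewrite bin_small // !mulr0 !mul0r mul0rn.
rewrite coef_reflectX.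
have [m em] : exists m, i = (a + m)%N by exists (i - a)%N; lia.
subst i; rewrite addKn; have [l el] : exists l, q = (m + l)%N by exists (q - m)%N; lia.
subst q; rewrite addKn; have -> : (a + (m + l) - (a + m) = l)%N by lia.
have fn n : n`!%:R != 0 :> K by rewrite pnatr_eq0 -lt0n fact_gt0.
have e1 : 'C(a + m, a)%:R * (a`!%:R * m`!%:R) = (a + m)`!%:R :> K.
  by rewrite -!natrM -[in RHS](bin_fact (leq_addr m a)) addKn.
have e2 : 'C(m + l, m)%:R * (m`!%:R * l`!%:R) = (m + l)`!%:R :> K.
  by rewrite -!natrM -[in RHS](bin_fact (leq_addr l m)) addKn.
rewrite -[_ *+ (a + m)`!]mulr_natr -[_ *+ 'C(_, _)]mulr_natr -e1 -e2.
have c0 : 'C(m + l, m)%:R != 0 :> K by rewrite pnatr_eq0 -lt0n bin_gt0 leq_addr.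
have := fn a; have := fn m; have := fn l.
move: (a`!%:R) (m`!%:R) (l`!%:R) c0 => A M L; move: ('C(m + l, m)%:R) => C C0 L0 M0 A0.
field.
by rewrite C0 L0 M0 A0.
Qed.

Lemma size_bpoly a q : (size (bpoly a q) <= (a + q).+1)%N.
Proof.
apply: (leq_trans (size_scale_leq _ _)); apply: (leq_trans (size_polyMleq _ _)).
rewrite size_polyXn /=.
have := size_poly_exp_leq (c%:P - 'X) q.
have : (size (c%:P - 'X : {poly K})%R <= 2)%N by rewrite -opprB size_polyN size_XsubC.
move: (size (c%:P - 'X)%R) (size ((c%:P - 'X) ^+ q)%R) => s t; nia.
Qed.

End BetaPoly.

End Formal.

Module Numeric.
From Stdlib Require Import Reals Lra Factorial.
From Coquelicot Require Import Coquelicot.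
From mathcomp Require Import all_boot all_algebra.
From mathcomp Require Import Rstruct zify.
Import Defs Formal.
Import GRing.Theory Num.Theory.
Local Open Scope R_scope.
Local Notation fpoly := Defs.poly.

(** * Polylogarithms as real power series *)

Definition licR (w : word) (n : nat) : R := @lic R w n.

Fixpoint psum (f : nat -> R) (n : nat) : R := if n is S n' then psum f n' + f n' else 0.

Lemma psumE f n : psum f n = \big[@GRing.add R/@GRing.zero R]_(i < n) f i.
Proof. by elim: n => [|n IH]; rewrite ?big_ord0 // big_ord_recr -IH. Qed.

Lemma licR_nil n : licR [::] n = if n is O then 1 else 0.
Proof. by case: n. Qed.

Lemma licR0 a w : licR (a :: w) 0 = 0.
Proof. by []. Qed.

Definition omegaR (a : bool) f n := if a then psum f n else f n.

Lemma licR_rec a w n :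
  INR n * licR (a :: w) n = omegaR a (licR w) n - dlast (fun s => licR s n : R) (a :: w).
Proof.
have := lic_rec R a w n; rewrite INRE /licR RmultE => ->.
by rewrite /omegaR /omega; case: a; rewrite ?psumE.
Qed.

Lemma psum_bound f M n : (forall i, Rabs (f i) <= M) -> Rabs (psum f n) <= INR n * M.
Proof.
move=> h; elim: n => [|n IH].
  by rewrite /= Rabs_R0; lra.
rewrite S_INR /=; have := Rabs_triang (psum f n) (f n); have := h n; lra.
Qed.

Lemma dlast_abs (g : word -> R) w M : 0 <= M ->
  (forall s, (size s < size w)%N -> Rabs (g s) <= M) -> Rabs (dlast g w) <= M.
Proof.
move=> M0; case: w => [|a s] h /=; first by rewrite (_ : GRing.zero = 0) // Rabs_R0.
case: ifP => _; first by rewrite (_ : GRing.zero = 0) // Rabs_R0.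
by apply: h; rewrite size_belast.
Qed.

(** Each letter at most doubles the bound: the recursion gives n |c_n| <= n M + M. *)
Lemma licR_bound w n : Rabs (licR w n) <= 2 ^ size w.
Proof.
have [N] := ubnP (size w); elim: N w n => // N IH w n hN.
case: w hN => [|a w] hN.
  by rewrite licR_nil /=; case: n => [|n]; rewrite ?Rabs_R1 ?Rabs_R0; lra.
have p2 : 1 <= 2 ^ size w by apply: pow_R1_Rle; lra.
case: n => [|n]; first by rewrite licR0 Rabs_R0 /=; lra.
have B m s : (size s < size (a :: w))%N -> Rabs (licR s m) <= 2 ^ size w.
  move=> hs; apply: (Rle_trans _ (2 ^ size s)).
    by apply: IH; move: hN hs => /=; lia.
  apply: Rle_pow; first lra.
  by move: hs => /=; lia.
have n0 : 0 < INR n.+1 by apply: lt_0_INR; lia.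
have n1 : 1 <= INR n.+1 by rewrite S_INR; have := pos_INR n; lra.
apply: (Rmult_le_reg_l (INR n.+1)) => //.
rewrite -{1}(Rabs_pos_eq (INR n.+1)); last lra.
rewrite -Rabs_mult licR_rec.
have h1 : Rabs (omegaR a (licR w) n.+1) <= INR n.+1 * 2 ^ size w.
  rewrite /omegaR; case: (a); first by apply: psum_bound => i; apply: B.
  have := B n.+1 w (ltnSn _); have := Rabs_pos (licR w n.+1); nra.
have h2 : Rabs (dlast (fun s => licR s n.+1 : R) (a :: w)) <= 2 ^ size w.
  by apply: dlast_abs => [|s hs]; [lra|apply: B].
have := Rabs_triang (omegaR a (licR w) n.+1) (- dlast (fun s => licR s n.+1 : R) (a :: w)).
rewrite Rabs_Ropp /Rminus [2 ^ size (a :: w)]/=.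
by move=> h3; apply: (Rle_trans _ _ _ h3); nra.
Qed.

Lemma radius_licR w t : Rabs t < 1 -> Rbar_lt (Rabs t) (CV_radius (licR w)).
Proof.
move=> t1; apply: (@Rbar_lt_le_trans _ 1) => //.
apply: (proj1 (CV_radius_bounded (licR w))).
by exists (2 ^ size w) => n; rewrite pow1 Rmult_1_r; apply: licR_bound.
Qed.

Definition Li (w : word) (t : R) : R := PSeries (licR w) t.

Lemma ex_licR w t : Rabs t < 1 -> ex_pseries (licR w) t.
Proof. by move=> t1; apply: CV_radius_inside; apply: radius_licR. Qed.

Lemma Li_nil t : Rabs t < 1 -> Li [::] t = 1.
Proof.
move=> t1; rewrite /Li PSeries_decr_1; last exact: ex_licR.
rewrite (PSeries_ext _ (fun _ => 0)) ?PSeries_const_0; first by rewrite licR_nil; lra.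
by move=> n; rewrite /PS_decr_1 licR_nil.
Qed.

Lemma dlast_PSeries w t :
  PSeries (fun n => dlast (fun s => licR s n : R) w) t = dlast (fun s => Li s t : R) w.
Proof. by case: w => [|a s] /=; rewrite ?PSeries_const_0 //; case: (last a s); rewrite ?PSeries_const_0. Qed.

Lemma ex_dlast w t : Rabs t < 1 -> ex_pseries (fun n => dlast (fun s => licR s n : R) w) t.
Proof.
move=> t1; have z : ex_pseries (fun _ : nat => 0) t.
  apply: CV_radius_inside; rewrite CV_radius_const_0 //.
case: w => [|a s] /=; first exact: z.
by case: (last a s); [exact: z|exact: ex_licR].
Qed.

Lemma theta_licR a w t : Rabs t < 1 ->
  is_pseries (fun n => INR n * licR (a :: w) n) t (t * Derive (Li (a :: w)) t).
Proof.
move=> t1; have r1 := radius_licR (a :: w) t1.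
have e : forall n, PS_incr_1 (PS_derive (licR (a :: w))) n = INR n * licR (a :: w) n.
  move=> n; case: n => [|n]; last by [].
  by rewrite Rmult_0_l.
rewrite (is_derive_unique _ _ _ (is_derive_PSeries _ _ r1)) -PSeries_incr_1.
apply: is_pseries_ext => [n|]; first by rewrite -e.
apply: PSeries_correct; apply: ex_pseries_incr_1; apply: CV_radius_inside.
by rewrite CV_radius_derive.
Qed.

Lemma is_derive_Li w t : Rabs t < 1 -> is_derive (Li w) t (Derive (Li w) t).
Proof.
move=> t1; apply: Derive_correct; eexists; apply: is_derive_PSeries; exact: radius_licR.
Qed.

Lemma PSeries_psum f t : Rabs t < 1 -> ex_pseries f t -> ex_pseries (psum f) t ->
  PSeries (psum f) t = t / (1 - t) * PSeries f t.
Proof.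
move=> t1 ef eg; have := PSeries_decr_1 _ _ eg.
rewrite (PSeries_ext (PS_decr_1 (psum f)) (PS_plus (psum f) f)) => [|n]; last by [].
rewrite PSeries_plus // [psum f 0]/= => h.
have : (1 - t) <> 0 by move: (Rabs_def2 _ _ t1); lra.
by move=> t0; field_simplify_eq => //; lra.
Qed.

(** The differential equation of polylogarithms at log t = 0; the [dlast] term is the contribution
    of the first power of log t. *)
Lemma ODE a w t : Rabs t < 1 -> t * Derive (Li (a :: w)) t =
  (if a then t / (1 - t) else 1) * Li w t - dlast (fun s => Li s t : R) (a :: w).
Proof.
move=> t1; have h := @theta_licR a w t t1.
have eo : ex_pseries (omegaR a (licR w)) t.
  apply: (ex_pseries_ext (PS_plus (fun n => INR n * licR (a :: w) n)
     (fun n => dlast (fun s => licR s n : R) (a :: w)))) => [n|].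
    change (INR n * licR (a :: w) n + dlast (fun s => licR s n : R) (a :: w) = omegaR a (licR w) n).
    by rewrite licR_rec; ring.
  by apply: ex_pseries_plus; [eexists; exact: h|exact: ex_dlast].
rewrite -(is_pseries_unique _ _ _ h).
rewrite (PSeries_ext _ (PS_minus (omegaR a (licR w)) (fun n => dlast (fun s => licR s n : R) (a :: w)))).
  rewrite PSeries_minus //; last exact: ex_dlast.
  rewrite dlast_PSeries; congr (_ - _).
  move: eo; rewrite /omegaR; case: a {h} => eo; last by rewrite Rmult_1_l.
  by rewrite PSeries_psum //; exact: ex_licR.
by move=> n; rewrite licR_rec.
Qed.

Lemma is_derive_Li_cons a w t : 0 < t < 1 -> is_derive (Li (a :: w)) t
  ((if a then / (1 - t) else / t) * Li w t - / t * dlast (fun s => Li s t : R) (a :: w)).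
Proof.
move=> [t0 t1]; have ta : Rabs t < 1 by rewrite Rabs_pos_eq; lra.
have := @is_derive_Li (a :: w) t ta; congr is_derive.
apply: (Rmult_eq_reg_l t); last lra.
rewrite ODE //; case: a; field; lra.
Qed.

(** * Real shuffle regularisation *)

(** The polylogarithm of x1 by [Li_x1], and the scale in which growth at t = 1 is measured. *)
Definition logi (t : R) : R := - ln (1 - t).
Definition near1 (t : R) : Prop := / 2 <= t < 1.

Lemma logi_ge0 t : near1 t -> 0 <= logi t.
Proof.
move=> [h1 h2]; rewrite /logi; have := ln_le (1 - t) 1 ltac:(lra) ltac:(lra).
rewrite ln_1; lra.
Qed.

Lemma exp_logi t : near1 t -> exp (logi t) = / (1 - t).
Proof. by move=> [h1 h2]; rewrite /logi exp_Ropp exp_ln //; lra. Qed.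

Lemma is_derive_logi t : near1 t -> is_derive logi t (/ (1 - t)).
Proof. by move=> [h1 h2]; rewrite /logi; auto_derive; [lra|field; lra]. Qed.

Definition tame (f : R -> R) := exists (C : R) (k : nat),
  0 <= C /\ forall t, near1 t -> Rabs (f t) <= C * (1 + logi t) ^ k.
(* [exp (- logi t / 4) = (1 - t)^(1/4)] *)
Definition small (f : R -> R) := exists (C : R) (k : nat),
  0 <= C /\ forall t, near1 t -> Rabs (f t) <= C * (1 + logi t) ^ k * exp (- logi t / 4).

Lemma powlogi_le t m n : near1 t -> (m <= n)%nat -> (1 + logi t) ^ m <= (1 + logi t) ^ n.
Proof. by move=> /logi_ge0 y0 mn; apply: Rle_pow; [lra|lia]. Qed.

Lemma powlogi_ge1 t n : near1 t -> 1 <= (1 + logi t) ^ n.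
Proof. by move=> /logi_ge0 y0; apply: pow_R1_Rle; lra. Qed.

Lemma tame_le (f g : R -> R) : tame g -> (forall t, near1 t -> Rabs (f t) <= Rabs (g t)) -> tame f.
Proof.
move=> [C [k [C0 h]]] fg; exists C, k; split=> // t Dt.
by apply: Rle_trans (fg t Dt) (h t Dt).
Qed.

Lemma small_le (f g : R -> R) : small g -> (forall t, near1 t -> Rabs (f t) <= Rabs (g t)) -> small f.
Proof.
move=> [C [k [C0 h]]] fg; exists C, k; split=> // t Dt.
by apply: Rle_trans (fg t Dt) (h t Dt).
Qed.

Lemma tame_const c : tame (fun _ => c).
Proof. exists (Rabs c), 0%nat; split; [exact: Rabs_pos|move=> t _ /=; lra]. Qed.

Lemma tame_logi : tame logi.
Proof.
exists 1, 1%nat; split=> [|t /logi_ge0 y0]; first lra.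
by rewrite Rabs_pos_eq //= ; lra.
Qed.

Lemma tame_plus f g : tame f -> tame g -> tame (fun t => f t + g t).
Proof.
move=> [C [k [C0 h]]] [C' [k' [C0' h']]]; exists (C + C'), (k + k')%nat; split=> [|t Dt]; first lra.
apply: Rle_trans (Rabs_triang _ _) _.
have := h t Dt; have := h' t Dt.
have := @powlogi_le t k (k + k') Dt ltac:(lia); have := @powlogi_le t k' (k + k') Dt ltac:(lia).
have := powlogi_ge1 k Dt; have := powlogi_ge1 k' Dt; nra.
Qed.

Lemma tame_opp f : tame f -> tame (fun t => - f t).
Proof. by move=> tf; apply: tame_le tf _ => t _; rewrite Rabs_Ropp; lra. Qed.

Lemma tame_mult f g : tame f -> tame g -> tame (fun t => f t * g t).
Proof.
move=> [C [k [C0 h]]] [C' [k' [C0' h']]]; exists (C * C'), (k + k')%nat; split=> [|t Dt]; first nra.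
rewrite Rabs_mult pow_add.
apply: Rle_trans (Rmult_le_compat _ _ _ _ (Rabs_pos _) (Rabs_pos _) (h t Dt) (h' t Dt)) _.
by apply: Req_le; ring.
Qed.

Lemma tame_pow f n : tame f -> tame (fun t => f t ^ n).
Proof.
by move=> tf; elim: n => [|n IH] /=; [exact: tame_const|exact: tame_mult].
Qed.

Lemma small_plus f g : small f -> small g -> small (fun t => f t + g t).
Proof.
move=> [C [k [C0 h]]] [C' [k' [C0' h']]]; exists (C + C'), (k + k')%nat; split=> [|t Dt]; first lra.
apply: Rle_trans (Rabs_triang _ _) _.
have := h t Dt; have := h' t Dt; have e0 := exp_pos (- logi t / 4).
have h1 := @powlogi_le t k (k + k') Dt ltac:(lia); have h2 := @powlogi_le t k' (k + k') Dt ltac:(lia).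
have : C * (1 + logi t) ^ k * exp (- logi t / 4) <= C * (1 + logi t) ^ (k + k') * exp (- logi t / 4).
  by apply: Rmult_le_compat_r; [lra|apply: Rmult_le_compat_l].
have : C' * (1 + logi t) ^ k' * exp (- logi t / 4) <= C' * (1 + logi t) ^ (k + k') * exp (- logi t / 4).
  by apply: Rmult_le_compat_r; [lra|apply: Rmult_le_compat_l].
lra.
Qed.

Lemma small_tame f g : tame f -> small g -> small (fun t => f t * g t).
Proof.
move=> [C [k [C0 h]]] [C' [k' [C0' h']]]; exists (C * C'), (k + k')%nat; split=> [|t Dt]; first nra.
rewrite Rabs_mult pow_add.
apply: Rle_trans (Rmult_le_compat _ _ _ _ (Rabs_pos _) (Rabs_pos _) (h t Dt) (h' t Dt)) _.
by apply: Req_le; ring.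
Qed.

Lemma small_0 : small (fun _ => 0).
Proof.
by exists 0, 0%nat; split=> [|t _]; rewrite ?Rabs_R0; lra.
Qed.

Lemma exp_mono x y : x <= y -> exp x <= exp y.
Proof.
move=> [h|->]; last exact: Rle_refl.
by apply: Rlt_le; apply: exp_increasing.
Qed.

Lemma exp_pow x n : exp x ^ n = exp (INR n * x).
Proof.
elim: n => [|n IH]; first by rewrite /= Rmult_0_l exp_0.
by rewrite S_INR [_ ^ _.+1]/= IH -exp_plus; congr exp; ring.
Qed.

Lemma pow_exp_bound k : exists C, 0 <= C /\ forall y, 0 <= y -> (1 + y) ^ k <= C * exp (y / 8).
Proof.
(* From 1 + y <= m exp(y/m), the k-th power has exponent k/m < 1/8, which stays below the exponents
   1/4 and 1/2 used later. *)
pose m := 8 * (INR k + 1); have k0 := pos_INR k; have m0 : 8 <= m by rewrite /m; lra.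
exists (m ^ k); split=> [|y y0]; first by apply: pow_le; lra.
have h : 1 + y <= m * exp (y / m).
  have h1 : 1 + y / m <= exp (y / m) := exp_ineq1_le _.
  have h2 : m * (1 + y / m) <= m * exp (y / m) by apply: Rmult_le_compat_l; lra.
  have h3 : m * (1 + y / m) = m + y by field; lra.
  lra.
apply: Rle_trans (pow_incr _ _ k (conj _ h)) _; first lra.
rewrite Rpow_mult_distr exp_pow; apply: Rmult_le_compat_l; first by apply: pow_le; lra.
apply: exp_mono; rewrite /Rdiv -!Rmult_assoc.
have : 0 <= y * (/ 8 - INR k * / m).
  apply: Rmult_le_pos => //.
  have -> : / 8 - INR k * / m = / m by rewrite /m; field; lra.
  by apply: Rlt_le; apply: Rinv_0_lt_compat; lra.
lra.
Qed.

Lemma tame_exp f : tame f -> exists C, 0 <= C /\ forall t, near1 t -> Rabs (f t) <= C * exp (logi t / 2).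
Proof.
move=> [C [k [C0 h]]]; have [C' [C0' h']] := pow_exp_bound k.
exists (C * C'); split=> [|t Dt]; first nra.
apply: Rle_trans (h t Dt) _; rewrite Rmult_assoc; apply: Rmult_le_compat_l => //.
apply: Rle_trans (h' _ (logi_ge0 Dt)) _; apply: Rmult_le_compat_l => //.
by apply: exp_mono; have := logi_ge0 Dt; lra.
Qed.

(** Tends to 1 with [logi] equal to n + 1, so that powers of 1 - t become geometric sequences. *)
Definition tseq (n : nat) : R := 1 - exp (- INR n.+1).

Lemma logi_tseq n : logi (tseq n) = INR n.+1.
Proof.
rewrite /logi /tseq; have -> : 1 - (1 - exp (- INR n.+1)) = exp (- INR n.+1) by ring.
by rewrite ln_exp; ring.
Qed.

Lemma near1_tseq n : near1 (tseq n).
Proof.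
rewrite /near1 /tseq; have e0 := exp_pos (- INR n.+1).
split; last lra.
have h : 2 <= exp (INR n.+1).
  have := exp_ineq1_le (INR n.+1); rewrite S_INR; have := pos_INR n; lra.
have : exp (- INR n.+1) <= / 2 by rewrite exp_Ropp; apply: Rinv_le_contravar; lra.
lra.
Qed.

Lemma lim_scal0 a u : is_lim_seq u 0 -> is_lim_seq (fun n => a * u n) 0.
Proof. by move=> /(is_lim_seq_scal_l _ a); rewrite /= Rmult_0_r. Qed.

Lemma lim_exp_neg c : 0 < c -> is_lim_seq (fun n => exp (- (c * INR n.+1))) 0.
Proof.
move=> c0; apply: (is_lim_seq_ext (fun n => exp (- c) * exp (- c) ^ n)) => [n|].
  by rewrite exp_pow -exp_plus S_INR; congr exp; ring.
apply: lim_scal0; apply: is_lim_seq_geom.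
rewrite Rabs_pos_eq; last by apply: Rlt_le; apply: exp_pos.
by rewrite -exp_0; apply: exp_increasing; lra.
Qed.

Lemma small_lim f : small f -> is_lim_seq (fun n => f (tseq n)) 0.
Proof.
move=> [C [k [C0 h]]]; have [C' [C0' h']] := pow_exp_bound k.
apply/is_lim_seq_abs_0.
apply: (is_lim_seq_le_le (fun _ => 0) _ (fun n => C * C' * exp (- (/ 8 * INR n.+1)))).
- move=> n; split; first exact: Rabs_pos.
  apply: Rle_trans (h _ (near1_tseq n)) _.
  rewrite logi_tseq Rmult_assoc Rmult_assoc; apply: Rmult_le_compat_l => //.
  have n0 := pos_INR n.+1.
  apply: Rle_trans (Rmult_le_compat_r _ _ _ (Rlt_le _ _ (exp_pos _)) (h' _ n0)) _.
  by rewrite Rmult_assoc -exp_plus; apply: Req_le; congr (_ * exp _); field.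
- exact: is_lim_seq_const.
apply: lim_scal0; apply: lim_exp_neg; lra.
Qed.

Lemma deriv_compare (f f' g g' : R -> R) (a b : R) : a <= b ->
  (forall t, a <= t <= b -> is_derive f t (f' t)) ->
  (forall t, a <= t <= b -> is_derive g t (g' t)) ->
  (forall t, a <= t <= b -> Rabs (f' t) <= g' t) ->
  Rabs (f b - f a) <= g b - g a.
Proof.
move=> ab df dg fg.
have M (h h' : R -> R) : (forall t, a <= t <= b -> is_derive h t (h' t)) ->
    (forall t, a <= t <= b -> 0 <= h' t) -> h a <= h b.
  move=> dh h0; have [] := MVT_gen h a b h'.
  - by rewrite Rmin_left // Rmax_right // => x hx; apply: dh; lra.
  - rewrite Rmin_left // Rmax_right // => x hx.
    by apply/continuity_pt_filterlim; apply: ex_derive_continuous; eexists; apply: dh.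
  rewrite Rmin_left // Rmax_right // => c [hc e].
  have := h0 c hc; nra.
have h1 := M (fun t => g t - f t) (fun t => g' t - f' t).
have h2 := M (fun t => g t + f t) (fun t => g' t + f' t).
have := h1 _ _; have := h2 _ _ => {h1 h2} h2 h1.
have H1 : g a - f a <= g b - f b.
  apply: h1 => t ht; first by apply: (is_derive_minus (V := R_NormedModule)); [exact: dg|exact: df].
  by have := fg t ht; have := Rle_abs (f' t); lra.
have H2 : g a + f a <= g b + f b.
  apply: h2 => t ht; first by apply: (is_derive_plus (V := R_NormedModule)); [exact: dg|exact: df].
  by have := fg t ht; have := Rle_abs (- f' t); rewrite Rabs_Ropp; lra.
by apply: Rabs_le; lra.
Qed.

Lemma near1_half : near1 (/ 2). Proof. by rewrite /near1; lra. Qed.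

(** A simple pole at t = 1 costs one power of log: (1 + logi)^(k+1) has derivative (k+1)(1 + logi)^k
    / (1-t). *)
Lemma tame_int (f f' : R -> R) : (forall t, near1 t -> is_derive f t (f' t)) ->
  tame (fun t => (1 - t) * f' t) -> tame f.
Proof.
move=> df [C [k [C0 h]]].
have key t : near1 t -> Rabs (f t - f (/ 2)) <= C * (1 + logi t) ^ k.+1.
  move=> Dt; apply: Rle_trans (_ : C * (1 + logi t) ^ k.+1 - C * (1 + logi (/ 2)) ^ k.+1 <= _); last first.
    have : 0 <= (1 + logi (/ 2)) ^ k.+1 by apply: pow_le; have := logi_ge0 near1_half; lra.
    by nra.
  have Ds s : / 2 <= s <= t -> near1 s by move: Dt; rewrite /near1; lra.
  apply: (@deriv_compare f f' (fun t => C * (1 + logi t) ^ k.+1)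
    (fun t => C * (INR k.+1 * / (1 - t) * (1 + logi t) ^ k)) (/ 2) t) => [|s /Ds Hs|s /Ds Hs|s /Ds Hs].
  - by case: Dt.
  - exact: df.
  - apply: is_derive_scal.
    have H : is_derive (fun t => 1 + logi t) s (/ (1 - s)).
      rewrite -(Rplus_0_l (/ (1 - s))).
      by apply: (is_derive_plus (V := R_NormedModule)); [exact: is_derive_const|exact: is_derive_logi].
    exact: (is_derive_pow _ k.+1 _ _ H).
  have s1 : 0 < 1 - s by move: Hs; rewrite /near1; lra.
  apply: (Rmult_le_reg_l (1 - s)) => //.
  rewrite -{1}(Rabs_pos_eq (1 - s)); last lra.
  rewrite -Rabs_mult; apply: Rle_trans (h s Hs) _.
  have -> : (1 - s) * (C * (INR k.+1 * / (1 - s) * (1 + logi s) ^ k)) = C * (INR k.+1 * (1 + logi s) ^ k).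
    by field; lra.
  apply: Rmult_le_compat_l => //.
  have := powlogi_ge1 k Hs; rewrite S_INR; have := pos_INR k; nra.
have tf : tame (fun t => f t - f (/ 2)) by exists C, k.+1.
apply: tame_le (tame_plus tf (tame_const (f (/ 2)))) _ => t _.
by apply: Req_le; congr Rabs; ring.
Qed.

(** A tame derivative is O((1-t)^(-1/2)), whose primitive -2 (1-t)^(1/2) bounds the remaining
    variation. *)
Lemma lim_int (f f' : R -> R) : (forall t, near1 t -> is_derive f t (f' t)) -> tame f' ->
  exists C, 0 <= C /\ forall s t, near1 s -> near1 t -> s <= t -> Rabs (f t - f s) <= C * exp (- logi s / 2).
Proof.
move=> df /tame_exp[C [C0 h]]; exists (2 * C); split=> [|s t Hs Ht stsum]; first lra.
apply: Rle_trans (_ : - (2 * C) * exp (- logi t / 2) - - (2 * C) * exp (- logi s / 2) <= _); last first.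
  by have := exp_pos (- logi t / 2); nra.
have Du u : s <= u <= t -> near1 u by move: Hs Ht; rewrite /near1; lra.
apply: (@deriv_compare f f' (fun u => - (2 * C) * exp (- logi u / 2)) (fun u => C * exp (logi u / 2)) s t) => // [u /Du Hu|u /Du Hu|u /Du Hu].
- exact: df.
- have -> : C * exp (logi u / 2) = - (2 * C) * (- (/ (1 - u) / 2) * exp (- logi u / 2)).
    rewrite -(exp_logi Hu).
    have -> : exp (logi u) = exp (logi u / 2) * exp (logi u / 2) by rewrite -exp_plus; congr exp; field.
    have : exp (logi u / 2) * exp (- logi u / 2) = 1 by rewrite -exp_plus -exp_0; congr exp; field.
    move=> e; transitivity (C * exp (logi u / 2) * (exp (logi u / 2) * exp (- logi u / 2))); last by field.
    by rewrite e Rmult_1_r.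
  apply: is_derive_scal.
  apply: (is_derive_comp (V := R_NormedModule) exp (fun u => - logi u / 2)); first exact: is_derive_exp.
  apply: (is_derive_ext (fun u => (- / 2) * logi u)) => [v|].
    by change (- / 2 * logi v = - logi v / 2); field.
  have -> : - (/ (1 - u) / 2) = (- / 2) * / (1 - u) by field; move: Hu; rewrite /near1; lra.
  by apply: is_derive_scal; apply: is_derive_logi.
exact: h.
Qed.

Lemma dlast_tame w (L : word -> R -> R) : (forall s, (size s < size w)%nat -> tame (L s)) ->
  tame (fun t => dlast (fun s => L s t : R) w).
Proof.
case: w => [|a s] h; first exact: (tame_const 0).
rewrite /=; case: (last a s); first exact: (tame_const 0).
by apply: h; rewrite size_belast.
Qed.

Lemma tame_inv : tame (fun t => / t).
Proof.
apply: tame_le (tame_const 2) _ => t [h1 h2].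
rewrite !Rabs_pos_eq; try lra; last by apply: Rlt_le; apply: Rinv_0_lt_compat; lra.
have -> : 2 = / / 2 by field.
by apply: Rinv_le_contravar; lra.
Qed.

Lemma tame_1m : tame (fun t => 1 - t).
Proof.
by apply: tame_le (tame_const 1) _ => t [h1 h2]; rewrite !Rabs_pos_eq; lra.
Qed.

Lemma tame_Li w : tame (Li w).
Proof.
have [N] := ubnP (size w); elim: N w => // N IH w hN.
case: w hN => [|a w] hN.
  apply: tame_le (tame_const 1) _ => t [h1 h2].
  by rewrite Li_nil; [lra|rewrite Rabs_pos_eq; lra].
apply: tame_int.
  by move=> t [h1 h2]; apply: is_derive_Li_cons; lra.
have td : tame (fun t => dlast (fun s => Li s t : R) (a :: w)).
  by apply: dlast_tame => s hs; apply: IH; move: hN hs => /=; lia.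
have tw : tame (Li w) by apply: IH.
have t1 : tame (fun t => (if a then 1 else (1 - t) * / t) * Li w t).
  apply: tame_mult => //; case: (a); first exact: tame_const.
  by apply: tame_mult; [exact: tame_1m|exact: tame_inv].
have t2 := tame_opp (tame_mult (tame_mult tame_1m tame_inv) td).
apply: tame_le (tame_plus t1 t2) _ => t [h1 h2].
by apply: Req_le; congr Rabs; case: (a); field; lra.
Qed.

Lemma is_deriveD (f g : R -> R) (x df dg : R) :
  is_derive f x df -> is_derive g x dg -> is_derive (fun t => f t + g t) x (df + dg).
Proof. exact: (is_derive_plus (V := R_NormedModule)). Qed.

Lemma is_deriveM (f g : R -> R) (x df dg : R) :
  is_derive f x df -> is_derive g x dg ->
  is_derive (fun t => f t * g t) x (df * g x + f x * dg).
Proof. by move=> hf hg; have := is_derive_mult _ _ _ _ _ hf hg Rmult_comm. Qed.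

Lemma is_derive_eqR (f g : R -> R) (x a b : R) :
  is_derive f x a -> (forall t, f t = g t) -> a = b -> is_derive g x b.
Proof. by move=> h e <-; apply: is_derive_ext h. Qed.

Definition logpow (k : nat) (t : R) : R := (- logi t) ^ k / INR (fact k).

(* Shuffle regularisation at t = 1: words starting with x1^j are corrected by
   [(- logi)^j / j!], so that [Lilog 0 w] has a finite limit. *)
Fixpoint Lilog (k : nat) (w : word) (t : R) : R :=
  logpow k t * Li w t + match w with true :: w' => Lilog k.+1 w' t | _ => 0 end.

(** t times the part of the derivative that is left once the 1/(1-t) terms of neighbouring summands
    have cancelled; every term of it is tame. *)
Fixpoint Lilog_der (k : nat) (w : word) (t : R) : R :=
  match w with
  | [::] => 0
  | a :: w' => - (logpow k t * dlast (fun s => Li s t : R) w)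
               + (if a then Lilog_der k.+1 w' t else logpow k t * Li w' t)
  end.

Lemma Lilog_der_cons k a w t : Lilog_der k (a :: w) t = - (logpow k t * dlast (fun s => Li s t : R) (a :: w))
  + (if a then Lilog_der k.+1 w t else logpow k t * Li w t).
Proof. by []. Qed.

Definition dlogpow (k : nat) (t : R) : R := - (if k is k'.+1 then logpow k' t else 0) * / (1 - t).

Lemma is_derive_logpow k t : near1 t -> is_derive (logpow k) t (dlogpow k t).
Proof.
move=> Dt; have Hy : is_derive (fun t => - logi t) t (- / (1 - t)).
  by apply: (is_derive_opp (V := R_NormedModule)); apply: is_derive_logi.
have H1 := is_derive_pow _ k _ _ Hy.
have H2 := is_derive_scal _ _ (/ INR (fact k)) _ H1.
have t1 : 1 - t <> 0 by move: Dt; rewrite /near1; lra.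
apply: (is_derive_ext (fun x => / INR (fact k) * (- logi x) ^ k)) => [x|].
  by rewrite /logpow /Rdiv Rmult_comm.
have -> : dlogpow k t = / INR (fact k) * (INR k * - / (1 - t) * (- logi t) ^ Init.Nat.pred k); last exact: H2.
rewrite /dlogpow; case: k {H1 H2} => [|k]; first by rewrite /=; ring.
rewrite /logpow [Init.Nat.pred _]/= fact_simpl mult_INR; field; split=> //; split.
  exact: INR_fact_neq_0.
by apply: not_0_INR.
Qed.

Lemma is_derive_Li_nil t : Rabs t < 1 -> is_derive (Li [::]) t 0.
Proof.
move=> t1; have := is_derive_PSeries _ _ (radius_licR [::] t1).
rewrite (PSeries_ext _ (fun _ => 0)) ?PSeries_const_0 // => n.
by rewrite /PS_derive licR_nil Rmult_0_r.
Qed.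

(** The derivative of (-logi)^(k+1)/(k+1)! is -(-logi)^k/k! times 1/(1-t), which cancels the x1-term
    of the preceding summand. The uncancelled [dlogpow] term vanishes for k = 0. *)
Lemma is_derive_Lilog k w t : near1 t ->
  is_derive (Lilog k w) t (dlogpow k t * Li w t + / t * Lilog_der k w t).
Proof.
move=> Dt; have [t0 t1] : 0 < t < 1 by move: Dt; rewrite /near1; lra.
elim: w k => [|a w IH] k.
  have H1 := is_derive_logpow k Dt.
  have H2 : is_derive (Li [::]) t 0 by apply: is_derive_Li_nil; rewrite Rabs_pos_eq; lra.
  apply: (is_derive_eqR (is_deriveM H1 H2)) => [x|]; first by rewrite /= Rplus_0_r.
  by rewrite /=; ring.
have H1 := is_deriveM (is_derive_logpow k Dt) (is_derive_Li_cons a w (conj t0 t1)).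
case: a H1 => H1.
  apply: (is_derive_eqR (is_deriveD H1 (IH k.+1))) => [x //|].
  by rewrite Lilog_der_cons [dlogpow k.+1 _]/dlogpow; ring.
apply: (is_derive_eqR H1) => [x|]; first by rewrite /= Rplus_0_r.
by rewrite Lilog_der_cons; ring.
Qed.

Lemma tame_logpow k : tame (logpow k).
Proof.
apply: (tame_le (tame_mult (tame_pow k (tame_opp tame_logi)) (tame_const (/ INR (fact k))))).
by move=> t _; apply: Rle_refl.
Qed.

Lemma tame_Lilog_der k w : tame (Lilog_der k w).
Proof.
elim: w k => [|a w IH] k; first exact: (tame_const 0).
apply: tame_plus.
  apply: tame_opp; apply: tame_mult; first exact: tame_logpow.
  by apply: dlast_tame => s _; apply: tame_Li.
by case: a; [exact: IH|apply: tame_mult; [exact: tame_logpow|exact: tame_Li]].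
Qed.

Definition Lireg w t := Lilog 0 w t.

Lemma Lireg_cauchy w : exists C, 0 <= C /\
  forall s t, near1 s -> near1 t -> s <= t -> Rabs (Lireg w t - Lireg w s) <= C * exp (- logi s / 2).
Proof.
apply: (lim_int (f' := fun t => / t * Lilog_der 0 w t)); last exact: tame_mult tame_inv (tame_Lilog_der 0 w).
by move=> t Dt; apply: (is_derive_eqR (is_derive_Lilog 0 w Dt)) => //; rewrite /dlogpow; ring.
Qed.

Lemma tseq_le m n : (m <= n)%nat -> tseq m <= tseq n.
Proof.
move=> mn; rewrite /tseq; have := le_INR m.+1 n.+1 ltac:(lia).
by move=> h; have := @exp_mono (- INR n.+1) (- INR m.+1) ltac:(lra); lra.
Qed.

Definition zreg w : R := real (Lim_seq (fun n => Lireg w (tseq n))).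

Lemma zreg_lim w : is_lim_seq (fun n => Lireg w (tseq n)) (zreg w).
Proof.
suff : ex_finite_lim_seq (fun n => Lireg w (tseq n)) by apply: Lim_seq_correct'.
apply/ex_lim_seq_cauchy_corr => eps; have [C [C0 h]] := Lireg_cauchy w.
have /is_lim_seq_spec /(_ eps) [N hN] : is_lim_seq (fun n => C * exp (- (/ 2 * INR n.+1))) 0.
  by apply: lim_scal0; apply: lim_exp_neg; lra.
have key m n : (N <= m)%nat -> (m <= n)%nat -> Rabs (Lireg w (tseq n) - Lireg w (tseq m)) < eps.
  move=> Nm mn; apply: Rle_lt_trans (h _ _ (near1_tseq m) (near1_tseq n) (tseq_le mn)) _.
  have := hN m ltac:(lia); rewrite logi_tseq Rminus_0_r.
  have -> : - INR m.+1 / 2 = - (/ 2 * INR m.+1) by field.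
  by apply: Rle_lt_trans; apply: Rle_abs.
exists N => n m Nn Nm; case: (leqP m n) => mn; first by apply: key => //; lia.
by rewrite Rabs_minus_sym; apply: key; lia.
Qed.

(** The rate (1-t)^(1/2) is spent in [small_diff], which splits it into two factors (1-t)^(1/4). *)
Lemma zreg_tail w : exists C, 0 <= C /\
  forall s, near1 s -> Rabs (zreg w - Lireg w s) <= C * exp (- logi s / 2).
Proof.
have [C [C0 h]] := Lireg_cauchy w; exists C; split=> // s Ds.
have H : is_lim_seq (fun n => Rabs (Lireg w (tseq n) - Lireg w s)) (Rabs (zreg w - Lireg w s)).
  apply: (is_lim_seq_abs _ (Rbar.Finite (zreg w - Lireg w s))).
  apply: is_lim_seq_minus'; [exact: zreg_lim|exact: is_lim_seq_const].
apply: (is_lim_seq_le_loc _ _ _ _ _ H (is_lim_seq_const _)).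
have [m [_ hm]] := nfloor_ex _ (logi_ge0 Ds); set M := m.+1.
have hM : logi s <= INR M by rewrite S_INR; lra.
exists M => n Mn; apply: h => //; first exact: near1_tseq.
have [s1 s2] := Ds; rewrite /tseq.
have -> : s = 1 - exp (- logi s) by rewrite /logi Ropp_involutive exp_ln; lra.
have := @exp_mono (- INR n.+1) (- logi s); have := le_INR M n.+1 ltac:(lia); lra.
Qed.

(** * The regularised values as a character of the shuffle algebra *)

Definition sumR (T : Type) (r : seq T) (f : T -> R) : R :=
  \big[@GRing.add R/@GRing.zero R]_(s <- r) f s.

Lemma sumR_nil (T : Type) (f : T -> R) : sumR [::] f = 0.
Proof. by rewrite /sumR big_nil. Qed.

Lemma sumR_cons (T : Type) x r (f : T -> R) : sumR (x :: r) f = f x + sumR r f.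
Proof. by rewrite /sumR big_cons. Qed.

Lemma lim_sumR (T : Type) (r : seq T) (f : T -> nat -> R) (l : T -> R) :
  (forall s, is_lim_seq (f s) (l s)) ->
  is_lim_seq (fun n => sumR r (f^~ n)) (sumR r l).
Proof.
move=> h; elim: r => [|x r IH].
  apply: (is_lim_seq_ext (fun _ => 0)) => [n|]; first by rewrite sumR_nil.
  by rewrite sumR_nil; exact: is_lim_seq_const.
apply: (is_lim_seq_ext (fun n => f x n + sumR r (f^~ n))) => [n|]; first by rewrite sumR_cons.
by rewrite sumR_cons; apply: is_lim_seq_plus'.
Qed.

Lemma ex_sumR (T : Type) (r : seq T) (a : T -> nat -> R) t :
  (forall s, ex_pseries (a s) t) -> ex_pseries (fun n => sumR r (a^~ n)) t.
Proof.
move=> h; elim: r => [|x r IH].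
  apply: (ex_pseries_ext (fun _ => 0)) => [n|]; first by rewrite sumR_nil.
  by apply: CV_radius_inside; rewrite CV_radius_const_0.
apply: (ex_pseries_ext (PS_plus (a x) (fun n => sumR r (a^~ n)))) => [n|].
  by rewrite sumR_cons.
exact: ex_pseries_plus.
Qed.

Lemma PSeries_sumR (T : Type) (r : seq T) (a : T -> nat -> R) t :
  (forall s, ex_pseries (a s) t) ->
  PSeries (fun n => sumR r (a^~ n)) t = sumR r (fun s => PSeries (a s) t).
Proof.
move=> h; elim: r => [|x r IH].
  by rewrite (PSeries_ext _ (fun _ => 0)) ?PSeries_const_0 ?sumR_nil // => n; rewrite sumR_nil.
rewrite sumR_cons -IH -PSeries_plus //; last exact: ex_sumR.
by apply: PSeries_ext => n; rewrite sumR_cons.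
Qed.

Lemma sh_Li u v t : Rabs t < 1 -> sh (fun s => Li s t : R) u v = Li u t * Li v t.
Proof.
move=> t1; rewrite -[LHS]/(sumR (shw u v) (fun s => PSeries (licR s) t)) -PSeries_sumR; last first.
  by move=> s; apply: ex_licR.
rewrite /Li -PSeries_mult; [|exact: radius_licR|exact: radius_licR].
apply: PSeries_ext => n; rewrite -[LHS]/(sh (fun s => @lic R s n) u v) sh_lic.
by rewrite /PS_mult sum_f_R0E big_mkord.
Qed.

Lemma all_shw (a : pred bool) u v s : s \in shw u v -> all a s = all a u && all a v.
Proof.
elim: u v s => [|x u IHu] v s; first by rewrite inE => /eqP ->.
elim: v s => [|y v IHv] s; first by rewrite inE => /eqP -> /=; rewrite andbT.
rewrite /= mem_cat => /orP[] /mapP[t ht ->] /=.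
  by rewrite (IHu _ _ ht) /= andbA.
by rewrite (IHv _ ht) /=; case: (a x); case: (a y); case: (all a u).
Qed.

Lemma sh_nseq_true (V : zmodType) (f : word -> V) i j :
  sh f (nseq i true) (nseq j true) = (f (nseq (i + j) true) *+ 'C(i + j, i))%R.
Proof.
elim: i j f => [|i IHi] j f; first by rewrite sh_nil bin0.
elim: j f => [|j IHj] f; first by rewrite sh_nilr addn0 binn.
rewrite [nseq i.+1 _]/= [nseq j.+1 _]/= sh_cons -[true :: nseq j _]/(nseq j.+1 true) IHi.
rewrite -[true :: nseq i _]/(nseq i.+1 true) IHj.
have -> : 'C(i.+1 + j.+1, i.+1) = ('C(i + j.+1, i) + 'C(i.+1 + j, i.+1))%N.
  by rewrite addSn binS addnC -addSnnS.
rewrite [RHS]mulrnDr; congr (GRing.add _ _).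
by rewrite (addnS i.+1 j).
Qed.

Lemma all_true_nseq (p : word) : all id p -> p = nseq (size p) true.
Proof. by elim: p => [|[] p IH] //= /IH {1}->. Qed.

(** The shuffle character exp(-[logi] x1); it presents the regularisation as a convolution of
    characters, see [Lireg_dec]. *)
Definition logchar t (p : word) : R := if all id p then logpow (size p) t else 0.

Lemma logpow_mult i j t : logpow i t * logpow j t = INR 'C(i + j, i) * logpow (i + j) t.
Proof.
rewrite /logpow pow_add.
have fi := INR_fact_neq_0 i; have fj := INR_fact_neq_0 j; have fij := INR_fact_neq_0 (i + j).
have e : INR 'C(i + j, i) * (INR (fact i) * INR (fact j)) = INR (fact (i + j)).
  by rewrite -!mult_INR !factE -(bin_fact (leq_addr j i)) addKn.
by rewrite -e; field; split=> //; split=> // h; apply: fij; rewrite -e h; ring.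
Qed.

Lemma sh_logchar t u v : sh (logchar t : word -> R) u v = logchar t u * logchar t v.
Proof.
case au : (all id u); last first.
  rewrite /logchar au Rmult_0_l /sh big1_seq // => s /andP[_ /(all_shw id) ->].
  by rewrite au.
case av : (all id v); last first.
  rewrite /logchar av Rmult_0_r /sh big1_seq // => s /andP[_ /(all_shw id) ->].
  by rewrite av andbF.
rewrite {1}(all_true_nseq au) {1}(all_true_nseq av) sh_nseq_true /logchar au av logpow_mult.
by rewrite all_nseq orbT size_nseq INRE RmultE mulr_natl.
Qed.

Lemma Lilog_dec k w t :
  Lilog k w t = dec (fun p q => (if all id p then logpow (k + size p) t else 0) * Li q t : R) w.
Proof.
elim: w k => [|a w IH] k; first by rewrite /= addn0 Rplus_0_r addr0.
rewrite [Lilog _ _ _]/= [dec _ _]/= addn0 -RplusE; congr (_ + _).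
case: a; last first.
  rewrite /= -[LHS](dec0 R w); apply: eq_dec => p q; by rewrite Rmult_0_l.
by rewrite IH; apply: eq_dec => p q /=; rewrite addnS.
Qed.

Lemma Lireg_dec w t : Lireg w t = dec (fun p q => logchar t p * Li q t : R) w.
Proof. exact: Lilog_dec. Qed.

Lemma dec_mull (c : R) (F : word -> word -> R) w :
  dec (fun p q => c * F p q : R) w = c * dec F w.
Proof.
elim: w F => [|a w IH] F /=; first by rewrite !addr0.
by rewrite (IH (fun p q => F (a :: p) q)) !RmultE mulrDr.
Qed.

Lemma dec_mulr (c : R) (F : word -> word -> R) w :
  dec (fun p q => F p q * c : R) w = dec F w * c.
Proof.
by rewrite Rmult_comm -dec_mull; apply: eq_dec => p q; rewrite Rmult_comm.
Qed.

Lemma sh_mulc (c : R) (f : word -> R) u v : sh (fun s => c * f s : R) u v = c * sh f u v.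
Proof. by rewrite /sh -mulr_sumr. Qed.

Lemma sh_cmul (c : R) (f : word -> R) u v : sh (fun s => f s * c : R) u v = sh f u v * c.
Proof. by rewrite /sh -mulr_suml. Qed.

(** A convolution of two characters of a commutative bialgebra is a character. *)
Lemma sh_Lireg u v t : Rabs t < 1 -> sh (fun s => Lireg s t : R) u v = Lireg u t * Lireg v t.
Proof.
move=> t1; rewrite (eq_sh _ _ (fun s => Lireg_dec s t)) sh_dec !Lireg_dec -dec_mulr.
apply: eq_dec => u1 u2; rewrite -dec_mull; apply: eq_dec => v1 v2.
rewrite (eq_sh _ _ (fun p => sh_mulc (logchar t p) (fun q => Li q t) u2 v2)) sh_cmul sh_logchar.
by rewrite sh_Li // !RmultE mulrACA.
Qed.

Lemma near1_abs t : near1 t -> Rabs t < 1.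
Proof. by move=> [h1 h2]; rewrite Rabs_pos_eq; lra. Qed.

Lemma lim_uniq (f : nat -> R) (a b : R) : is_lim_seq f a -> is_lim_seq f b -> a = b.
Proof. by move=> /is_lim_seq_unique ha /is_lim_seq_unique; rewrite ha => -[]. Qed.

Lemma sh_zreg u v : sh (zreg : word -> R) u v = zreg u * zreg v.
Proof.
apply: (@lim_uniq (fun n => sumR (shw u v) (fun s => Lireg s (tseq n)))).
  exact: (@lim_sumR _ (shw u v) (fun s n => Lireg s (tseq n)) _ zreg_lim).
apply: (is_lim_seq_ext (fun n => Lireg u (tseq n) * Lireg v (tseq n))) => [n|].
  by rewrite -sh_Lireg //; apply: near1_abs; apply: near1_tseq.
by apply: is_lim_seq_mult'; apply: zreg_lim.
Qed.

Lemma zreg_x0 : zreg [:: false] = 0.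
Proof.
apply: (lim_uniq (@zreg_lim [:: false])); apply: (is_lim_seq_ext (fun _ => 0)) => [n|]; last exact: is_lim_seq_const.
have -> : Lireg [:: false] (tseq n) = logpow 0 (tseq n) * Li [:: false] (tseq n) by rewrite /Lireg /= Rplus_0_r.
rewrite /Li (PSeries_ext _ (fun _ => 0)) ?PSeries_const_0; first by rewrite Rmult_0_r.
case=> [|m]; first by rewrite licR0.
have n0 : INR m.+1 <> 0 by apply: not_0_INR.
apply: (Rmult_eq_reg_l (INR m.+1)) => //.
by rewrite licR_rec /= licR_nil Rmult_0_r; apply: Rminus_diag_eq.
Qed.

Lemma Li_x1 t : 0 <= t < 1 -> Li [:: true] t = logi t.
Proof.
move=> [t0 t1].
have d s : 0 <= s <= t -> is_derive (Li [:: true]) s (/ (1 - s)).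
  move=> hs; have s1 : Rabs s < 1 by rewrite Rabs_pos_eq; lra.
  have := is_derive_PSeries _ _ (radius_licR [:: true] s1).
  suff -> : PSeries (PS_derive (licR [:: true])) s = / (1 - s) by [].
  rewrite -(Series_geom s s1) /PSeries; apply: Series_ext => n.
  rewrite /PS_derive licR_rec.
  have -> : omegaR true (licR [::]) n.+1 = 1.
    rewrite /omegaR; elim: n => [|n IH]; first by rewrite /= licR_nil; ring.
    by change (psum (licR [::]) n.+1 + licR [::] n.+1 = 1); rewrite IH licR_nil; ring.
  by rewrite /= (_ : GRing.zero = 0) //; ring.
have dY s : 0 <= s <= t -> is_derive logi s (/ (1 - s)).
  by move=> hs; rewrite /logi; auto_derive; [lra|field; lra].
have := @deriv_compare (fun s => Li [:: true] s + - logi s) (fun _ => 0) (fun _ => 0) (fun _ => 0) 0 t t0.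
have e0 : Li [:: true] 0 + - logi 0 = 0.
  have -> : Li [:: true] 0 = 0 by rewrite /Li PSeries_0.
  by rewrite /logi Rminus_0_r ln_1; ring.
rewrite e0 !Rminus_0_r => h.
suff : Rabs (Li [:: true] t + - logi t) <= 0.
  by have := Rabs_pos (Li [:: true] t + - logi t); split_Rabs; lra.
apply: h => s hs; last by rewrite Rabs_R0; lra.
- have H : is_derive (fun x => - logi x) s (- / (1 - s)).
    by apply: (is_derive_opp (V := R_NormedModule)); apply: dY.
  by apply: (is_derive_eqR (is_deriveD (d s hs) H)) => //; apply: Rplus_opp_r.
- exact: is_derive_const.
Qed.

Lemma zreg_x1 : zreg [:: true] = 0.
Proof.
apply: (lim_uniq (@zreg_lim [:: true])); apply: (is_lim_seq_ext (fun _ => 0)) => [n|]; last exact: is_lim_seq_const.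
have Dn := near1_tseq n; have [t0 t1] := Dn.
rewrite /Lireg /= Li_nil; last exact: near1_abs.
rewrite Li_x1; last lra.
by rewrite /logpow /=; field.
Qed.

(** * Regularised double shuffle *)

Definition hsumR (ks : seq nat) (m : nat) : R := @hsum R ks m.

Lemma hsumRE ks m : hsumR ks m = psum (licR (iw ks)) m.+1.
Proof. by rewrite psumE. Qed.

Lemma licR_iw k ks n : licR (iw (k.+1 :: ks)) n.+1 = (/ INR n.+1) ^ k.+1 * hsumR ks n.
Proof. by rewrite RpowE RinvE INRE -[LHS]/(@lic R _ _) lic_iw. Qed.

Lemma hsumRS k ks m : hsumR (k.+1 :: ks) m.+1 = hsumR (k.+1 :: ks) m + (/ INR m.+1) ^ k.+1 * hsumR ks m.
Proof. by rewrite RpowE RinvE INRE /hsumR hsumS. Qed.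

Lemma hsumR0 k ks : hsumR (k.+1 :: ks) 0 = 0.
Proof. exact: hsum0. Qed.

Lemma hsumR_nil m : hsumR [::] m = 1.
Proof. exact: hsum_nil. Qed.

Lemma psumS f n : psum f n.+1 = psum f n + f n.
Proof. by []. Qed.

Lemma psum_ge0 f n : (forall i, 0 <= f i) -> 0 <= psum f n.
Proof. by move=> h; elim: n => [|n IH] /=; [lra|have := h n; lra]. Qed.

Lemma licR_ge0 ks n : all (ltn 0%N) ks -> 0 <= licR (iw ks) n.
Proof.
elim: ks n => [|[|k] ks IH] n //= h.
  by rewrite licR_nil; case: n => [|n]; lra.
case: n => [|n].
  by rewrite iw_cons; case: k h => [|k] h; rewrite licR0; lra.
rewrite licR_iw; apply: Rmult_le_pos; last by rewrite hsumRE; apply: psum_ge0 => i; exact: IH.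
by apply: pow_le; apply: Rlt_le; apply: Rinv_0_lt_compat; apply: lt_0_INR; lia.
Qed.

Lemma hsumR_ge0 ks m : all (ltn 0%N) ks -> 0 <= hsumR ks m.
Proof. by move=> h; rewrite hsumRE; apply: psum_ge0 => i; apply: licR_ge0. Qed.

Lemma hsumR_incr ks m : all (ltn 0%N) ks -> hsumR ks m <= hsumR ks m.+1.
Proof. by move=> h; rewrite !hsumRE (psumS _ m.+1); have := licR_ge0 m.+1 h; lra. Qed.

Lemma ex_psum w t : Rabs t < 1 -> ex_pseries (psum (licR w)) t.
Proof.
move=> t1.
apply: (ex_pseries_ext (PS_plus (fun n => INR n * licR (true :: w) n)
     (fun n => dlast (fun s => licR s n : R) (true :: w)))) => [n|].
  change (INR n * licR (true :: w) n + dlast (fun s => licR s n : R) (true :: w) = omegaR true (licR w) n).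
  by rewrite licR_rec; ring.
by apply: ex_pseries_plus; [eexists; exact: theta_licR|exact: ex_dlast].
Qed.

Lemma ex_hsumR ks t : 0 < t < 1 -> ex_pseries (hsumR ks) t.
Proof.
move=> [t0 t1]; apply: (ex_pseries_ext (PS_decr_1 (psum (licR (iw ks))))) => [n|].
  by rewrite hsumRE.
apply: ex_pseries_decr_1; last by apply: ex_psum; rewrite Rabs_pos_eq; lra.
by right; exists (/ t); apply: Rinv_l; lra.
Qed.

(** Passing to partial sums is division by 1 - t. *)
Lemma Li_hsumR ks t : 0 < t < 1 -> Li (iw ks) t = (1 - t) * PSeries (hsumR ks) t.
Proof.
move=> [t0 t1]; have ta : Rabs t < 1 by rewrite Rabs_pos_eq; lra.
have h1 := PSeries_psum ta (ex_licR (iw ks) ta) (ex_psum (iw ks) ta).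
have h2 := PSeries_decr_1 _ _ (ex_psum (iw ks) ta).
rewrite (PSeries_ext (PS_decr_1 (psum (licR (iw ks)))) (hsumR ks)) in h2; last by move=> n; rewrite hsumRE.
move: h1; rewrite {}h2 [psum _ 0]/= -/(Li _ _) Rplus_0_l => h1.
apply: (Rmult_eq_reg_l (t / (1 - t))); first by rewrite -h1; field; lra.
by apply: Rgt_not_eq; apply: Rdiv_lt_0_compat; lra.
Qed.

Lemma PSeries_mono a b s t : (forall n, 0 <= a n <= b n) -> 0 <= s <= t -> ex_pseries b t ->
  PSeries a s <= PSeries b t.
Proof.
move=> ab stsum /ex_pseries_R eb; apply: Series_le => // n.
have [a0 abn] := ab n; have s0 : 0 <= s ^ n by apply: pow_le; lra.
have : s ^ n <= t ^ n by apply: pow_incr.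
by nra.
Qed.

Lemma PSeries_psum_le a t m : (forall n, 0 <= a n) -> 0 <= t <= 1 -> ex_pseries a t ->
  psum a m.+1 * t ^ m <= PSeries a t.
Proof.
move=> a0 t01 ea.
have h n : sum_n (fun n => a n * t ^ n) n = psum (fun n => a n * t ^ n) n.+1.
  elim: n => [|n IH]; first by rewrite sum_O /=; ring.
  by rewrite sum_Sn IH.
have tp n : 0 <= t ^ n by apply: pow_le; lra.
apply: Rle_trans (_ : psum (fun n => a n * t ^ n) m.+1 <= _).
  have g k : (k <= m.+1)%nat -> psum a k * t ^ m <= psum (fun n => a n * t ^ n) k.
    elim: k => [|k IH] km; first by rewrite /=; lra.
    have := IH ltac:(lia); rewrite /= Rmult_plus_distr_r.
    have : t ^ m <= t ^ k.
      have -> : m = (k + (m - k))%nat by lia.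
      rewrite pow_add; have : t ^ (m - k) <= 1 by rewrite -(pow1 (m - k)); apply: pow_incr.
      have := tp k; nra.
    have := a0 k; nra.
  exact: g.
rewrite -h; apply: (is_lim_seq_incr_compare (sum_n (fun n => a n * t ^ n))).
  by apply: Series_correct; apply/ex_pseries_R.
by move=> n; rewrite !h (psumS _ n.+1); have := a0 n.+1; have := tp n.+1; nra.
Qed.

Lemma PSeries_cst c t : Rabs t < 1 -> is_pseries (fun _ => c) t (c / (1 - t)).
Proof.
move=> t1; apply/is_pseries_R; apply: is_series_scal_l.
exact: is_series_geom.
Qed.

Lemma PS_minusE (a b : nat -> R) n : PS_minus a b n = a n - b n. Proof. by []. Qed.
Lemma PS_plusE (a b : nat -> R) n : PS_plus a b n = a n + b n. Proof. by []. Qed.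
Lemma PS_scalE c (a : nat -> R) n : PS_scal c a n = c * a n. Proof. by []. Qed.

(** The default 2 makes the empty index admissible. *)
Definition adm (ks : seq nat) := (1 < head 2 ks)%nat && all (ltn 0%N) ks.

Lemma adm_pos ks : adm ks -> all (ltn 0%N) ks. Proof. by case/andP. Qed.

Lemma Lireg_adm ks t : adm ks -> Lireg (iw ks) t = Li (iw ks) t.
Proof.
have l0 : logpow 0 t = 1 by rewrite /logpow /=; field.
case: ks => [|[|[|k]] ks] // _; first by rewrite /Lireg /= l0 Rmult_1_l Rplus_0_r.
by rewrite iw_cons /Lireg [Lilog _ _ _]/= l0 Rmult_1_l Rplus_0_r.
Qed.

Lemma near1_01 t : near1 t -> 0 < t < 1. Proof. by move=> [? ?]; lra. Qed.

Lemma tseq_ge t : t < 1 -> exists N, forall n, (N <= n)%nat -> t <= tseq n.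
Proof.
move=> t1; have [t0|t0] := Rle_or_lt t (/ 2).
  by exists 0%nat => n _; have [] := near1_tseq n; lra.
have Dt : near1 t by split; lra.
have [m [_ hm]] := nfloor_ex _ (logi_ge0 Dt); exists m => n mn; rewrite /tseq.
have -> : t = 1 - exp (- logi t) by rewrite /logi Ropp_involutive exp_ln; lra.
have := @exp_mono (- INR n.+1) (- logi t); have := le_INR m n ltac:(lia).
by rewrite S_INR; lra.
Qed.

Lemma lim_tseq m : is_lim_seq (fun n => tseq n ^ m) 1.
Proof.
have h : is_lim_seq tseq 1.
  rewrite -(Rminus_0_r 1); apply: is_lim_seq_minus'; first exact: is_lim_seq_const.
  apply: (is_lim_seq_ext (fun n => exp (- (1 * INR n.+1)))) => [n|]; first by rewrite Rmult_1_l.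
  by apply: lim_exp_neg; lra.
elim: m => [|m IH]; first exact: is_lim_seq_const.
by rewrite -(Rmult_1_l 1); apply: is_lim_seq_mult'.
Qed.

Lemma ge0_bound_Li ks t : all (ltn 0%N) ks -> near1 t -> 0 <= Li (iw ks) t.
Proof.
move=> hk Dt; have t01 := near1_01 Dt.
have := @PSeries_psum_le (licR (iw ks)) t 0 (fun n => licR_ge0 n hk) ltac:(lra) (ex_licR _ (near1_abs Dt)).
by rewrite -hsumRE /Li; have := hsumR_ge0 0 hk; rewrite /=; lra.
Qed.

Lemma Li_le_zreg ks t : adm ks -> near1 t -> Li (iw ks) t <= zreg (iw ks).
Proof.
move=> ha Dt; have hk := adm_pos ha; have [_ t1] := Dt; have t01 := near1_01 Dt.
have [N hN] := tseq_ge t1.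
apply: (is_lim_seq_le_loc (fun _ => Li (iw ks) t) _ _ _ _ (is_lim_seq_const _) (@zreg_lim (iw ks))).
exists N => n Nn; rewrite Lireg_adm //; apply: PSeries_mono; last by apply: ex_licR; apply: near1_abs; apply: near1_tseq.
  by move=> m; have := licR_ge0 m hk; lra.
by have := hN n ltac:(lia); lra.
Qed.

Lemma hsumR_le_zreg ks m : adm ks -> hsumR ks m <= zreg (iw ks).
Proof.
move=> ha; have hk := adm_pos ha.
have H : is_lim_seq (fun n => hsumR ks m * tseq n ^ m) (hsumR ks m).
  rewrite -{2}(Rmult_1_r (hsumR ks m)); apply: is_lim_seq_mult'; [exact: is_lim_seq_const|exact: lim_tseq].
apply: (is_lim_seq_le _ _ _ _ _ H (@zreg_lim (iw ks))) => n; rewrite Lireg_adm // hsumRE.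
have [h1 h2] := near1_01 (near1_tseq n).
apply: PSeries_psum_le; [by move=> i; apply: licR_ge0|lra|].
by apply: ex_licR; rewrite Rabs_pos_eq; lra.
Qed.

(** By positivity the increasing partial sums and the values at t < 1 bound each other, so the two
    limits agree. *)
Lemma hsumR_lim ks : adm ks -> is_lim_seq (hsumR ks) (zreg (iw ks)).
Proof.
move=> ha; have hk := adm_pos ha.
have [l hl] : ex_finite_lim_seq (hsumR ks).
  apply: (ex_finite_lim_seq_incr _ (zreg (iw ks))) => n; [exact: hsumR_incr|exact: hsumR_le_zreg].
suff -> : zreg (iw ks) = l by [].
have lP : l <= zreg (iw ks).
  by apply: (is_lim_seq_le (hsumR ks) (fun _ => zreg (iw ks)) _ _ _ hl (is_lim_seq_const _)) => n; apply: hsumR_le_zreg.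
have Hl n : hsumR ks n <= l by apply: (is_lim_seq_incr_compare _ _ hl) => m; apply: hsumR_incr.
suff : zreg (iw ks) <= l by lra.
apply: (is_lim_seq_le _ (fun _ => l) _ _ _ (@zreg_lim (iw ks)) (is_lim_seq_const _)) => n.
have Dn := near1_tseq n; have t01 := near1_01 Dn.
rewrite Lireg_adm // Li_hsumR //.
have e := @PSeries_cst l _ (near1_abs Dn).
have : PSeries (hsumR ks) (tseq n) <= PSeries (fun _ => l) (tseq n).
  by apply: PSeries_mono; [move=> m; split; [exact: hsumR_ge0|exact: Hl]|lra|eexists; exact: e].
rewrite (is_pseries_unique _ _ _ e) => h.
have -> : l = (1 - tseq n) * (l / (1 - tseq n)) by field; lra.
by apply: Rmult_le_compat_l; lra.
Qed.

Lemma small_exp : small (fun t => exp (- logi t / 4)).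
Proof.
exists 1, 0%nat; split=> [|t _]; first lra.
by rewrite Rabs_pos_eq; [rewrite /=; lra|apply: Rlt_le; apply: exp_pos].
Qed.

Lemma tame_sumR (T : Type) (r : seq T) (f : T -> R -> R) :
  (forall s, tame (f s)) -> tame (fun t => sumR r (f^~ t)).
Proof.
move=> h; elim: r => [|x r IH].
  by apply: tame_le (tame_const 0) _ => t _; rewrite sumR_nil; lra.
by apply: tame_le (tame_plus (h x) IH) _ => t _; rewrite sumR_cons; lra.
Qed.

Lemma ex_pseries_scalR c a t : ex_pseries a t -> ex_pseries (fun n => c * a n) t.
Proof. by apply: ex_pseries_scal; apply: Rmult_comm. Qed.

Lemma stw_hsumR ks ls m : all (ltn 0%N) ks -> all (ltn 0%N) ls ->
  sumR (stw ks ls) (hsumR^~ m) = hsumR ks m * hsumR ls m.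
Proof. by move=> hk hl; rewrite -[LHS]/(stsum (fun s => @hsum R s m) ks ls) stsum_hsum. Qed.

Lemma ex_hsumR_mul ks ls t : all (ltn 0%N) ks -> all (ltn 0%N) ls -> 0 < t < 1 ->
  ex_pseries (fun m => hsumR ks m * hsumR ls m) t.
Proof.
move=> hk hl t01; apply: (ex_pseries_ext (fun m => sumR (stw ks ls) (hsumR^~ m))) => [m|].
  exact: stw_hsumR.
by apply: ex_sumR => s; apply: ex_hsumR.
Qed.

Lemma sum_Li_stw ks ls t : all (ltn 0%N) ks -> all (ltn 0%N) ls -> 0 < t < 1 ->
  sumR (stw ks ls) (fun s => Li (iw s) t) = (1 - t) * PSeries (fun m => hsumR ks m * hsumR ls m) t.
Proof.
move=> hk hl t01.
rewrite (PSeries_ext _ (fun m => sumR (stw ks ls) (hsumR^~ m))); last by move=> m; rewrite stw_hsumR.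
rewrite PSeries_sumR; last by move=> s; apply: ex_hsumR.
elim: (stw ks ls) => [|s r IH]; first by rewrite !sumR_nil; ring.
by rewrite !sumR_cons IH Li_hsumR //; ring.
Qed.

(** Stuffling multiplies harmonic sums termwise. With z the limit for [ks], the difference is (1-t)
    times the series of (z - H_ks) H_ls, minus (z - Li_ks) Li_ls; both terms contain the tail of the
    admissible index. *)
Lemma small_diff ks ls : adm ks -> all (ltn 0%N) ls ->
  small (fun t => Li (iw ks) t * Li (iw ls) t - sumR (stw ks ls) (fun s => Li (iw s) t)).
Proof.
move=> ha hl; have hk := adm_pos ha.
set z := zreg (iw ks); have [C [C0 hC]] := zreg_tail (iw ks).
pose e t := exp (- logi t / 4).
have tC : tame (fun _ => C) := tame_const C.
have tll : tame (fun t => sumR (stw ls ls) (fun s => Li (iw s) t)).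
  by apply: (tame_sumR (stw ls ls)) => s; apply: tame_Li.
have tl : tame (fun t => C * Li (iw ls) t) by apply: tame_mult => //; apply: tame_Li.
have S1 := small_tame tC small_exp.
have S2 := small_tame (tame_mult (tame_const z) tll) small_exp.
have S3 := small_tame tl small_exp.
apply: small_le (small_plus (small_plus S1 S2) S3) _ => t Dt.
have t01 := near1_01 Dt; have ta := near1_abs Dt.
have e0 : 0 < e t := exp_pos _.
have e1 : e t <= 1.
  by rewrite /e -exp_0; apply: exp_mono; have := logi_ge0 Dt; lra.
have ee : exp (- logi t / 2) = e t * e t by rewrite /e -exp_plus; congr exp; field.
have rho0 : 0 <= z - Li (iw ks) t by have := Li_le_zreg ha Dt; rewrite -/z; lra.
have rho1 : z - Li (iw ks) t <= C * (e t * e t).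
  by have := hC t Dt; rewrite Lireg_adm // -/z ee Rabs_pos_eq.
have Hz m : 0 <= z - hsumR ks m by have := hsumR_le_zreg m ha; rewrite -/z; lra.
have Hl m : 0 <= hsumR ls m by apply: hsumR_ge0.
have z0 : 0 <= z by have := Hz 0%nat; have := hsumR_ge0 0 hk; lra.
set P := PSeries (fun m => (z - hsumR ks m) * hsumR ls m) t.
have exP : ex_pseries (fun m => (z - hsumR ks m) * hsumR ls m) t.
  apply: (ex_pseries_ext (PS_minus (fun m => z * hsumR ls m) (fun m => hsumR ks m * hsumR ls m))) => [m|].
    by rewrite PS_minusE; apply: esym; apply: Rmult_minus_distr_r.
  by apply: ex_pseries_minus; [apply: ex_pseries_scalR; exact: ex_hsumR|exact: ex_hsumR_mul].
have eP : P = z * PSeries (hsumR ls) t - PSeries (fun m => hsumR ks m * hsumR ls m) t.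
  rewrite /P -PSeries_scal -PSeries_minus; last exact: ex_hsumR_mul; last by apply: ex_pseries_scalR; exact: ex_hsumR.
  by apply: PSeries_ext => m; apply: Rmult_minus_distr_r.
have eD : Li (iw ks) t * Li (iw ls) t - sumR (stw ks ls) (fun s => Li (iw s) t)
   = (1 - t) * P - (z - Li (iw ks) t) * Li (iw ls) t.
  by rewrite sum_Li_stw // eP (Li_hsumR ls t01); ring.
have L0 := ge0_bound_Li hl Dt.
have P0 : 0 <= P.
  have h0 : PSeries (fun _ => 0) t = 0 by rewrite PSeries_const_0.
  rewrite -h0; apply: PSeries_mono => //; last by lra.
  by move=> m; have := Hz m; have := Hl m; nra.
have exz : ex_pseries (fun m => z - hsumR ks m) t.
  apply: (ex_pseries_ext (PS_minus (fun=> z) (hsumR ks))) => [m|].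
    by [].
  by apply: ex_pseries_minus; [eexists; exact: PSeries_cst|exact: ex_hsumR].
have ez : (1 - t) * PSeries (fun m => z - hsumR ks m) t = z - Li (iw ks) t.
  rewrite (PSeries_ext _ (PS_minus (fun=> z) (hsumR ks))); last first.
    by [].
  rewrite PSeries_minus; [|by eexists; exact: PSeries_cst|exact: ex_hsumR].
  by rewrite (is_pseries_unique _ _ _ (@PSeries_cst z _ ta)) (Li_hsumR ks t01); field; lra.
(* [h <= A + h^2 / A] with [A = exp (logi / 4)] balances the two error terms. *)
have PP : P <= / e t * PSeries (fun m => z - hsumR ks m) t
              + z * e t * PSeries (fun m => hsumR ls m * hsumR ls m) t.
  rewrite -!PSeries_scal -PSeries_plus; last first.
  - by apply: ex_pseries_scalR; exact: ex_hsumR_mul.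
  - exact: ex_pseries_scalR.
  apply: PSeries_mono; [|lra|]; last first.
    by apply: ex_pseries_plus; apply: ex_pseries_scalR => //; exact: ex_hsumR_mul.
  move=> m; split; first by have := Hz m; have := Hl m; nra.
  rewrite PS_plusE !PS_scalE.
  set h := hsumR ls m; set r := z - hsumR ks m.
  have h0 : 0 <= h := Hl m; have r0 : 0 <= r := Hz m.
  have rz : r <= z by rewrite /r; have := hsumR_ge0 m hk; lra.
  have i0 : 0 < / e t := Rinv_0_lt_compat _ e0.
  have ie : / e t * e t = 1 by field; lra.
  have hh : h <= / e t + e t * (h * h).
    have : 0 <= (h * e t - 1) * (h * e t - 1) + h * e t by have := Rle_0_sqr (h * e t - 1); rewrite /Rsqr; nra.
    move=> q; apply: (Rmult_le_reg_l (e t)) => //.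
    rewrite Rmult_plus_distr_l (Rmult_comm _ (/ e t)) ie; nra.
  have q1 : 0 <= r * (/ e t + e t * (h * h) - h) by nra.
  have q2 : 0 <= (z - r) * (e t * (h * h)) by apply: Rmult_le_pos; [lra|nra].
  have q3 : / e t * r + z * e t * (h * h) - r * h = r * (/ e t + e t * (h * h) - h) + (z - r) * (e t * (h * h)) by ring.
  lra.
have S := sum_Li_stw hl hl t01.
have B1 : (1 - t) * P <= C * e t + z * sumR (stw ls ls) (fun s => Li (iw s) t) * e t.
  have : (1 - t) * P <= / e t * ((1 - t) * PSeries (fun m => z - hsumR ks m) t)
       + z * e t * ((1 - t) * PSeries (fun m => hsumR ls m * hsumR ls m) t).
    have -> : / e t * ((1 - t) * PSeries (fun m => z - hsumR ks m) t)
       + z * e t * ((1 - t) * PSeries (fun m => hsumR ls m * hsumR ls m) t) =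
       (1 - t) * (/ e t * PSeries (fun m => z - hsumR ks m) t
              + z * e t * PSeries (fun m => hsumR ls m * hsumR ls m) t) by ring.
    by apply: Rmult_le_compat_l; lra.
  rewrite ez -S.
  have : / e t * (z - Li (iw ks) t) <= C * e t.
    have -> : C * e t = / e t * (C * (e t * e t)) by field; lra.
    by apply: Rmult_le_compat_l => //; apply: Rlt_le; apply: Rinv_0_lt_compat.
  by lra.
have B2 : (z - Li (iw ks) t) * Li (iw ls) t <= C * Li (iw ls) t * e t.
  have : (z - Li (iw ks) t) * Li (iw ls) t <= C * (e t * e t) * Li (iw ls) t by apply: Rmult_le_compat_r.
  have : 0 <= C * Li (iw ls) t * e t * (1 - e t) by do !apply: Rmult_le_pos => //; lra.
  nra.
have Q1 : 0 <= (1 - t) * P by apply: Rmult_le_pos; lra.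
have Q2 : 0 <= (z - Li (iw ks) t) * Li (iw ls) t by apply: Rmult_le_pos.
rewrite eD -/(e t).
apply: Rle_trans (_ : C * e t + z * sumR (stw ls ls) (fun s => Li (iw s) t) * e t + C * Li (iw ls) t * e t <= _).
  by apply: Rabs_le; lra.
exact: Rle_abs.
Qed.

Lemma sumR_add (T : Type) r (f g : T -> R) : sumR r (fun x => f x + g x) = sumR r f + sumR r g.
Proof. exact: big_split. Qed.

Lemma sumR_scal (T : Type) c r (f : T -> R) : sumR r (fun x => c * f x) = c * sumR r f.
Proof. by rewrite /sumR -mulr_sumr. Qed.

Lemma eq_sumR (T : Type) r (f g : T -> R) : f =1 g -> sumR r f = sumR r g.
Proof. by move=> e; apply: eq_bigr => x _. Qed.

Definition Lilog_tail k (s : seq nat) t : R := if s is 1%nat :: s' then Lilog k.+1 (iw s') t else 0.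

Lemma Lilog_iw k j s t : Lilog k (iw (j.+1 :: s)) t = logpow k t * Li (iw (j.+1 :: s)) t + Lilog_tail k (j.+1 :: s) t.
Proof. by rewrite iw_cons; case: j. Qed.

Lemma Lilog_Li k ks t : adm ks -> near1 t -> Lilog k (iw ks) t = logpow k t * Li (iw ks) t.
Proof.
case: ks => [|[|[|i]] ks] // _ Dt; first by rewrite /= Rplus_0_r.
by rewrite Lilog_iw /= Rplus_0_r.
Qed.

Lemma sumR_stw_cons (f : seq nat -> R) i ks j ls : sumR (stw (i.+1 :: ks) (j :: ls)) f =
  sumR (stw ks (j :: ls)) (fun s => f (i.+1 :: s)) + sumR (stw (i.+1 :: ks) ls) (fun s => f (j :: s))
  + sumR (stw ks ls) (fun s => f ((i + j).+1 :: s)).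
Proof. exact: (@stsum_cons R f i.+1 ks j ls). Qed.

(** As [ks] starts with an entry at least 2, a stuffle term can begin with x1 only through a leading
    1 of the second index. *)
Lemma sum_Lilog_stw k ks j ls t : adm ks -> ks != [::] -> near1 t ->
  sumR (stw ks (j.+1 :: ls)) (fun s => Lilog k (iw s) t)
  = logpow k t * sumR (stw ks (j.+1 :: ls)) (fun s => Li (iw s) t)
    + (if j is 0%nat then sumR (stw ks ls) (fun s => Lilog k.+1 (iw s) t) else 0).
Proof.
case: ks => [|[|[|i]] ks] // _ _ Dt.
rewrite !sumR_stw_cons.
rewrite (eq_sumR _ (fun s => Lilog_iw k i.+1 s t)) sumR_add sumR_scal.
rewrite (eq_sumR _ (fun s => Lilog_iw k j s t)) sumR_add sumR_scal.
rewrite (eq_sumR _ (fun s => Lilog_iw k (i.+1 + j.+1) s t)) sumR_add sumR_scal.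
have z r : sumR r (fun _ : seq nat => 0) = 0 by rewrite /sumR big1.
have z1 : sumR (stw ks (j.+1 :: ls)) (fun s => Lilog_tail k (i.+2 :: s) t) = 0 := z _.
have z2 : sumR (stw ks ls) (fun s => Lilog_tail k ((i.+1 + j.+1).+1 :: s) t) = 0.
  by rewrite -[RHS](z (stw ks ls)); apply: eq_sumR => s; rewrite addSn.
rewrite z1 z2; case: j {z1 z2} => [|j].
  by rewrite /Lilog_tail; ring.
have -> : sumR (stw (i.+2 :: ks) ls) (fun s => Lilog_tail k (j.+2 :: s) t) = 0 := z _.
by ring.
Qed.

(** Regularisation strips the leading entries 1 of [ls] one by one, and at each stage [small_diff]
    applies to what is left. *)
Lemma small_Lilog k ks ls : adm ks -> all (ltn 0%N) ls ->
  small (fun t => Li (iw ks) t * Lilog k (iw ls) t - sumR (stw ks ls) (fun s => Lilog k (iw s) t)).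
Proof.
move=> ha; case: (ks =P [::]) => [->|/eqP k0] hl.
  apply: small_le small_0 _ => t Dt.
  have e := Li_nil (near1_abs Dt); have -> : stw [::] ls = [:: ls] by [].
  rewrite -[iw [::]]/([::] : word) e sumR_cons sumR_nil.
  by rewrite (_ : _ - _ = 0); [lra|ring].
elim: ls k hl => [|[//|j] ls IH] k hl.
  apply: small_le small_0 _ => t Dt.
  have -> : stw ks [::] = [:: ks] by case: (ks).
  have e := Li_nil (near1_abs Dt).
  have -> : Lilog k (iw [::]) t = logpow k t * 1 + 0 by rewrite -e.
  by rewrite sumR_cons sumR_nil Lilog_Li // (_ : _ - _ = 0); [lra|ring].
have S1 := small_tame (tame_logpow k) (small_diff ha hl).
case: j hl S1 => [|j] hl S1.
  apply: small_le (small_plus S1 (IH k.+1 hl)) _ => t Dt.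
  rewrite sum_Lilog_stw // Lilog_iw /Lilog_tail; apply: Req_le; congr Rabs; ring.
apply: small_le S1 _ => t Dt.
by rewrite sum_Lilog_stw // Lilog_iw /Lilog_tail; apply: Req_le; congr Rabs; ring.
Qed.

(** The two sides, taken at t instead of 1, differ by a small function by [small_Lilog], hence agree
    in the limit. *)
Lemma stw_zreg ks ls : adm ks -> all (ltn 0%N) ls ->
  sumR (stw ks ls) (fun s => zreg (iw s)) = zreg (iw ks) * zreg (iw ls).
Proof.
move=> ha hl.
apply: (@lim_uniq (fun n => sumR (stw ks ls) (fun s => Lireg (iw s) (tseq n)))).
  exact: (@lim_sumR _ (stw ks ls) (fun s n => Lireg (iw s) (tseq n)) _ (fun s => @zreg_lim (iw s))).
have h1 : is_lim_seq (fun n => Lireg (iw ks) (tseq n) * Lireg (iw ls) (tseq n)) (zreg (iw ks) * zreg (iw ls)).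
  by apply: is_lim_seq_mult'; apply: zreg_lim.
have h2 := small_lim (small_Lilog 0 ha hl).
have := is_lim_seq_minus' _ _ _ _ h1 h2; rewrite Rminus_0_r.
by apply: is_lim_seq_ext => n; rewrite (Lireg_adm _ ha) /Lireg; ring.
Qed.

(** * Evaluation at regularised real values kills R *)

Lemma iw_iotainv c w : last false w = true -> iw (iinv_aux c w) = nseq c false ++ w.
Proof.
elim: w c => [|[] w IH] c //=.
  case: w IH => [|b w] IH h; first by rewrite iw_cons.
  by rewrite iw_cons IH.
by move=> h; rewrite IH //=; elim: (c) => //= c' ->.
Qed.

Lemma pos_iinv c w : all (ltn 0%N) (iinv_aux c w).
Proof. by elim: w c => [|[] w IH] c /=. Qed.

Lemma iotainvK w : condV w -> iw (iotainv w) = w.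
Proof. by case/orP => [/eqP ->|/eqP h] //; rewrite /iotainv iw_iotainv. Qed.

Lemma condU_condV w : condU w -> condV w.
Proof. by rewrite /condU /condV; case/orP => [->//|/andP[_ ->]]; rewrite orbT. Qed.

Lemma adm_iotainv w : condU w -> adm (iotainv w).
Proof.
case: w => [|[] w] //= h; rewrite /adm pos_iinv andbT /iotainv /=.
suff H c : (1 < head 2%nat (iinv_aux c.+1 w))%nat by apply: H.
by elim: w c {h} => [|[] w IH] c //=; apply: IH.
Qed.

(** A separate name for the reals, to carry the action of [rat] through [ratr] that [evalp]
    requires. *)
Definition Rq : Type := R.
HB.instance Definition _ := GRing.Field.on Rq.
Definition scaleRq (c : rat) (x : Rq) : Rq := (GRing.mul (ratr c) x).
Fact scaleRqA a b x : scaleRq a (scaleRq b x) = scaleRq (GRing.mul a b) x.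
Proof. by rewrite /scaleRq rmorphM mulrA. Qed.
Fact scale1Rq : left_id (GRing.one _) scaleRq.
Proof. by move=> x; rewrite /scaleRq rmorph1 mul1r. Qed.
Fact scaleRqDr : right_distributive scaleRq +%R.
Proof. by move=> c x y; rewrite /scaleRq mulrDr. Qed.
Fact scaleRqDl x : {morph scaleRq^~ x : a b / GRing.add a b}.
Proof. by move=> a b; rewrite /scaleRq rmorphD mulrDl. Qed.
HB.instance Definition _ :=
  GRing.Zmodule_isLmodule.Build rat Rq scaleRqA scale1Rq scaleRqDr scaleRqDl.

Definition zregQ (w : word) : Rq := zreg w.
Definition evalzreg (p : fpoly) : R := evalp zregQ p.

Lemma evalp_psh_mul (p q : fpoly) : evalzreg (psh p q) = evalzreg p * evalzreg q.
Proof.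
rewrite /evalzreg evalp_psh RmultE /evalp mulr_suml; apply: eq_bigr => a _.
rewrite mulr_sumr; apply: eq_bigr => b _.
have -> : sh zregQ a.2 b.2 = GRing.mul (zregQ a.2) (zregQ b.2) := sh_zreg a.2 b.2.
rewrite /GRing.scale /= /scaleRq rmorphM.
exact: mulrACA.
Qed.

Lemma evalp_pst (p q : fpoly) : evalzreg (pst p q) =
  \big[@GRing.add R/@GRing.zero R]_(a <- p) \big[@GRing.add R/@GRing.zero R]_(b <- q)
    (scaleRq (GRing.mul a.1 b.1) (sumR (stw (iotainv a.2) (iotainv b.2)) (fun s => zreg (iw s)))).
Proof.
rewrite /evalzreg /evalp /pst big_flatten big_map; apply: eq_bigr => a _.
rewrite big_flatten big_map; apply: eq_bigr => b _.
by rewrite big_map -scaler_sumr.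
Qed.

Lemma evalzreg_stuffle (u v : fpoly) : all (fun t => condU t.2) u -> all (fun t => condV t.2) v ->
  evalzreg (pst u v) = evalzreg u * evalzreg v.
Proof.
move=> hu horner2; rewrite -evalp_psh_mul evalp_pst /evalzreg evalp_psh.
rewrite big_seq [RHS]big_seq; apply: eq_bigr => a au.
rewrite big_seq [RHS]big_seq; apply: eq_bigr => b bv.
have cu := allP hu a au; have cv := allP horner2 b bv.
rewrite stw_zreg; [|exact: adm_iotainv|exact: pos_iinv].
rewrite (iotainvK (condU_condV cu)) (iotainvK cv).
by have -> : sh zregQ a.2 b.2 = GRing.mul (zregQ a.2) (zregQ b.2) := sh_zreg a.2 b.2.
Qed.

Theorem inR_zreg p : inR p -> evalzreg p = 0.
Proof.
move=> [gs [hg e]]; rewrite /evalzreg (peq_evalp _ e) evalp_flatten big_map big1_seq // => x /andP[_ xg].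
rewrite -[LHS]/(evalzreg _) evalp_psh_mul; suff -> : evalzreg x.1 = 0 by rewrite Rmult_0_l.
case: (hg x xg) => [->|[->|[u [v [hu [horner2 ->]]]]]].
- by rewrite /evalzreg evalp_pword; exact: zreg_x0.
- by rewrite /evalzreg evalp_pword; exact: zreg_x1.
rewrite /evalzreg evalp_sub; apply/eqP; rewrite subr_eq0; apply/eqP.
by rewrite -[LHS]/(evalzreg _) -[RHS]/(evalzreg _) evalzreg_stuffle // evalp_psh_mul.
Qed.

(** * Cosine integrals *)

Definition hpi : R := PI / 2.
Definition wint (f : R -> R) : R := RInt f 0 hpi.

Lemma hpi_gt0 : 0 < hpi. Proof. by rewrite /hpi; have := PI_RGT_0; lra. Qed.
Lemma hpi_le2 : hpi <= 2. Proof. by rewrite /hpi; have := PI_4; lra. Qed.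

Definition cont (f : R -> R) := forall x, 0 <= x <= hpi -> continuous f x.

Lemma cont_ex f : cont f -> ex_RInt f 0 hpi.
Proof.
move=> h; apply: (ex_RInt_continuous (V := R_CompleteNormedModule)) => x.
by rewrite Rmin_left ?Rmax_right; [apply: h| |]; have := hpi_gt0; lra.
Qed.

Lemma derive_cont (f df : R -> R) : (forall x, is_derive f x (df x)) -> cont f.
Proof.
by move=> h x _; apply: (ex_derive_continuous (V := R_NormedModule)); exists (df x).
Qed.

Lemma cont_mult f g : cont f -> cont g -> cont (fun x => f x * g x).
Proof.
move=> hf hg x hx; apply: (continuous_mult (K := R_AbsRing)); [exact: hf|exact: hg].
Qed.

Lemma cont_plus f g : cont f -> cont g -> cont (fun x => f x + g x).
Proof.
move=> hf hg x hx; apply: (continuous_plus (V := R_NormedModule)); [exact: hf|exact: hg].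
Qed.

Lemma cont_const c : cont (fun _ => c).
Proof. move=> x _; exact: continuous_const. Qed.

Lemma cont_ext f g : (forall x, f x = g x) -> cont f -> cont g.
Proof. by move=> e h x hx; apply: continuous_ext (h x hx). Qed.

Lemma wint_ext f g : (forall x, 0 < x < hpi -> f x = g x) -> wint f = wint g.
Proof.
by move=> h; apply: RInt_ext => x; rewrite Rmin_left ?Rmax_right; [exact: h| |]; have := hpi_gt0; lra.
Qed.

Lemma wint_plus f g : cont f -> cont g -> wint (fun x => f x + g x) = wint f + wint g.
Proof.
by move=> hf hg; apply: (RInt_plus (V := R_CompleteNormedModule)); apply: cont_ex.
Qed.

Lemma wint_scal c f : cont f -> wint (fun x => c * f x) = c * wint f.
Proof. by move=> hf; apply: (RInt_scal (V := R_CompleteNormedModule)); apply: cont_ex. Qed.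

Lemma wint_le f g : cont f -> cont g -> (forall x, 0 < x < hpi -> f x <= g x) -> wint f <= wint g.
Proof.
by move=> hf hg h; apply: RInt_le => //; [have := hpi_gt0; lra|exact: cont_ex|exact: cont_ex].
Qed.

Lemma wint_FTC (f df : R -> R) : (forall x, 0 <= x <= hpi -> is_derive f x (df x)) -> cont df ->
  wint df = f hpi - f 0.
Proof.
move=> h c; apply: is_RInt_unique; apply: (is_RInt_derive (V := R_CompleteNormedModule)) => x;
  rewrite Rmin_left ?Rmax_right; try (have := hpi_gt0; lra); [exact: h|exact: c].
Qed.

Lemma cos_hpi : cos hpi = 0. Proof. exact: cos_PI2. Qed.
Lemma is_derive_cosX n x : is_derive (fun x => cos x ^ n.+1) x (- INR n.+1 * cos x ^ n * sin x).
Proof.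
apply: (is_derive_eqR (is_derive_pow _ n.+1 _ _ (is_derive_cos x))) => //.
by rewrite [Init.Nat.pred _]/=; ring.
Qed.

Lemma cont_cosX n : cont (fun x => cos x ^ n).
Proof.
case: n => [|n]; first exact: cont_const.
exact: (derive_cont (is_derive_cosX n)).
Qed.

Lemma cont_sin : cont sin.
Proof. exact: (derive_cont is_derive_sin). Qed.

(** 4^k / C(2k, k), which normalises the integral of cos^(2k) over [0, pi/2] to pi/2 for every k,
    see [wcos_one]. *)
Fixpoint wallis (k : nat) : R := if k is k'.+1 then wallis k' * (INR (2 * k').+2 / INR (2 * k').+1) else 1.

Lemma wallisS k : wallis k.+1 = wallis k * (INR (2 * k).+2 / INR (2 * k).+1). Proof. by []. Qed.

Lemma wallis_gt0 k : 0 < wallis k.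
Proof.
elim: k => [|k IH]; first by rewrite /=; lra.
by rewrite wallisS; apply: Rmult_lt_0_compat => //; apply: Rdiv_lt_0_compat; apply: lt_0_INR; lia.
Qed.

Definition wcos (k : nat) (f : R -> R) : R := wallis k * wint (fun x => f x * cos x ^ (2 * k)).

(** Integrate f'' cos^(2k+2) by parts twice; the boundary terms vanish by cos(pi/2) = 0, sin 0 = 0
    and f'(0) = 0. *)
Lemma wcos_rec (f f1 f2 : R -> R) k :
  (forall x, is_derive f x (f1 x)) -> (forall x, is_derive f1 x (f2 x)) -> cont f2 -> f1 0 = 0 ->
  wcos k f - wcos k.+1 f = wcos k.+1 f2 / (4 * INR k.+1 ^ 2).
Proof.
move=> d1 d2 c2 f10; have cf := derive_cont d1; have cf1 := derive_cont d2.
pose K := INR (2 * k).+2.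
have eK : K = 2 * INR k.+1 by rewrite /K (_ : (2 * k).+2 = 2 * k.+1)%nat ?mult_INR //; lia.
have k0 : 0 < INR k.+1 by apply: lt_0_INR; lia.
have D1 (x : R) : is_derive (fun x => f1 x * cos x ^ (2 * k).+2) x
   (f2 x * cos x ^ (2 * k).+2 + f1 x * (- K * cos x ^ (2 * k).+1 * sin x)).
  by apply: is_deriveM; [exact: d2|exact: is_derive_cosX].
have D2 (x : R) : is_derive (fun x => f x * (K * (cos x ^ (2 * k).+1 * sin x))) x
   (f1 x * (K * (cos x ^ (2 * k).+1 * sin x)) +
    f x * (K * (K * cos x ^ (2 * k).+2 - (K - 1) * cos x ^ (2 * k)))).
  apply: is_deriveM; first exact: d1.
  have H := is_derive_scal _ _ K _ (is_deriveM (is_derive_cosX (2 * k) x) (is_derive_sin x)).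
  apply: (is_derive_eqR H) => //.
  have -> : INR (2 * k).+1 = K - 1 by rewrite /K (S_INR (2 * k).+1); ring.
  have s2 : sin x * sin x = 1 - cos x * cos x by have := sin2_cos2 x; rewrite /Rsqr; lra.
  rewrite -!tech_pow_Rmult.
  transitivity (K * (- (K - 1) * cos x ^ (2 * k) * (sin x * sin x) + cos x * cos x ^ (2 * k) * cos x)); first by rewrite /=; ring.
  by rewrite s2; ring.
have ccos n : cont (fun x => cos x ^ n) by apply: cont_cosX.
have C1 : cont (fun x => f2 x * cos x ^ (2 * k).+2) by apply: cont_mult.
have C2 : cont (fun x => f x * cos x ^ (2 * k).+2) by apply: cont_mult.
have C3 : cont (fun x => f x * cos x ^ (2 * k)) by apply: cont_mult.
have C4 : cont (fun x => K * K * (f x * cos x ^ (2 * k).+2)) by apply: cont_mult => //; apply: cont_const.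
have C5 : cont (fun x => - (K * (K - 1)) * (f x * cos x ^ (2 * k))) by apply: cont_mult => //; apply: cont_const.
have C45 := cont_plus C4 C5.
have I0 : wint (fun x => f2 x * cos x ^ (2 * k).+2 +
   (K * K * (f x * cos x ^ (2 * k).+2) + - (K * (K - 1)) * (f x * cos x ^ (2 * k)))) = 0.
  rewrite (@wint_FTC (fun x => f1 x * cos x ^ (2 * k).+2 + f x * (K * (cos x ^ (2 * k).+1 * sin x)))).
  - by rewrite cos_hpi f10 sin_0 /=; ring.
  - by move=> x _; apply: (is_derive_eqR (is_deriveD (D1 x) (D2 x))) => //; ring.
  - exact: (cont_plus C1 C45).
rewrite (wint_plus C1 C45) (wint_plus C4 C5) !wint_scal // in I0.
rewrite /wcos mulnS -[(2 + 2 * k)%nat]/((2 * k).+2) wallisS -/K.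
have -> : INR (2 * k).+1 = K - 1 by rewrite /K (S_INR (2 * k).+1); ring.
have K1 : 1 < K by rewrite eK S_INR; have := pos_INR k; lra.
have -> : INR k.+1 = K / 2 by rewrite eK; field.
have -> : wint (fun x => f2 x * cos x ^ (2 * k).+2) =
  K * (K - 1) * wint (fun x => f x * cos x ^ (2 * k)) - K * K * wint (fun x => f x * cos x ^ (2 * k).+2) by lra.
by field; lra.
Qed.

Definition dpow (p : nat) (x : R) : R := (2 * x) ^ p / INR (fact p).

Lemma dpow0 x : dpow 0 x = 1. Proof. by rewrite /dpow /=; field. Qed.
Lemma dpow_at0 p : dpow p.+1 0 = 0. Proof. by rewrite /dpow Rmult_0_r /= Rmult_0_l /Rdiv Rmult_0_l. Qed.

Lemma is_derive_dpow p x : is_derive (dpow p.+1) x (2 * dpow p x).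
Proof.
have d : is_derive (fun x => 2 * x) x 2 by auto_derive; [|ring].
have H := is_derive_scal _ _ (/ INR (fact p.+1)) _ (is_derive_pow _ p.+1 _ _ d).
apply: (is_derive_eqR H) => [t|]; first by rewrite /dpow /Rdiv Rmult_comm.
rewrite /dpow [Init.Nat.pred _]/= fact_simpl mult_INR; field; split; first exact: INR_fact_neq_0.
by apply: not_0_INR.
Qed.

Lemma cont_dpow p : cont (dpow p).
Proof.
case: p => [|p]; last exact: (derive_cont (is_derive_dpow p)).
by apply: (@cont_ext (fun _ => 1)) => [x|]; [rewrite dpow0|exact: cont_const].
Qed.

Lemma wcos_dpow k a : wcos k (dpow a.+2) - wcos k.+1 (dpow a.+2) = / INR k.+1 ^ 2 * wcos k.+1 (dpow a).
Proof.
rewrite (@wcos_rec _ (fun x => 2 * dpow a.+1 x) (fun x => 4 * dpow a x)).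
- have -> : wcos k.+1 (fun x => 4 * dpow a x) = 4 * wcos k.+1 (dpow a).
    rewrite /wcos (wint_ext (g := fun x => 4 * (dpow a x * cos x ^ (2 * k.+1)))) => [|x _]; last ring.
    by rewrite wint_scal; [ring|apply: cont_mult; [exact: cont_dpow|exact: cont_cosX]].
  by field; apply: not_0_INR.
- exact: is_derive_dpow.
- move=> x; have H := is_derive_scal _ _ 2 _ (is_derive_dpow a x).
  by apply: (is_derive_eqR H) => //; ring.
- by apply: cont_mult; [exact: cont_const|exact: cont_dpow].
- by rewrite dpow_at0 Rmult_0_r.
Qed.

(** A crude Jordan inequality: cos >= 1/2 up to pi/3, and sin >= 1/2 beyond. *)
Lemma sin_ge x : 0 <= x <= hpi -> x <= 4 * sin x.
Proof.
move=> [x0 x1]; have PI0 := PI_RGT_0; have PI4 := PI_4; rewrite /hpi in x1.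
have [h|h] := Rle_or_lt x (PI / 3).
  suff : x / 2 - 0 / 2 <= sin x - sin 0 by rewrite sin_0; lra.
  have := @deriv_compare (fun x => x / 2) (fun _ => / 2) sin cos 0 x x0.
  move=> H; apply: Rle_trans (Rle_abs _) _; apply: H => t ht.
  - by auto_derive; [|field].
  - exact: is_derive_sin.
  rewrite Rabs_pos_eq; last lra.
  have -> : / 2 = cos (PI / 3) by rewrite cos_PI3; field.
  by apply: cos_decr_1; lra.
have s3 : / 2 <= sin (PI / 3).
  rewrite (_ : / 2 = sin (PI / 6)); last by rewrite sin_PI6; field.
  by apply: sin_incr_1; lra.
have : sin (PI / 3) <= sin x by apply: sin_incr_1; lra.
lra.
Qed.

Lemma cos_ge0_hpi x : 0 <= x <= hpi -> 0 <= cos x.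
Proof. by move=> [x0 x1]; apply: cos_ge_0; move: x1; rewrite /hpi; have := PI_RGT_0; lra. Qed.

Lemma cos_gt0_hpi x : 0 <= x < hpi -> 0 < cos x.
Proof. by move=> [x0 x1]; apply: cos_gt_0; move: x1; rewrite /hpi; have := PI_RGT_0; lra. Qed.

Lemma sin_ge0_hpi x : 0 <= x <= hpi -> 0 <= sin x.
Proof. by move=> hx; have := sin_ge hx; lra. Qed.

Lemma wint_ge0 f : cont f -> (forall x, 0 < x < hpi -> 0 <= f x) -> 0 <= wint f.
Proof.
move=> cf h; have -> : 0 = wint (fun _ => 0).
  by rewrite /wint RInt_const /scal /= /mult /=; ring.
by apply: wint_le => //; exact: cont_const.
Qed.

Lemma dpow_ge0 p x : 0 <= x -> 0 <= dpow p x.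
Proof.
move=> x0; apply: Rmult_le_pos; first by apply: pow_le; lra.
by apply: Rlt_le; apply: Rinv_0_lt_compat; apply: INR_fact_lt_0.
Qed.

Lemma wcos_one k : wcos k (dpow 0) = hpi.
Proof.
have c0 : cont (fun _ : R => 0) := @cont_const 0.
elim: k => [|k IH].
  rewrite /wcos /= Rmult_1_l (wint_ext (g := fun _ => 1)) => [|x _]; last by rewrite dpow0; ring.
  by rewrite /wint RInt_const /scal /= /mult /=; ring.
have := @wcos_rec (dpow 0) (fun _ => 0) (fun _ => 0) k.
have -> : wcos k.+1 (fun _ => 0) = 0.
  rewrite /wcos (wint_ext (g := fun x => 0 * 1)) => [|x _]; last by ring.
  by rewrite wint_scal; [ring|exact: cont_const].
rewrite IH => h; suff : hpi - wcos k.+1 (dpow 0) = 0 / (4 * INR k.+1 ^ 2) by rewrite /Rdiv Rmult_0_l; lra.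
apply: h => // [x|x]; last exact: is_derive_const.
by apply: (is_derive_ext (fun _ => 1)) => [t|]; [rewrite dpow0|exact: is_derive_const].
Qed.

Lemma wcos_ge0 k f : cont f -> (forall x, 0 < x < hpi -> 0 <= f x) -> 0 <= wcos k f.
Proof.
move=> cf h; apply: Rmult_le_pos; first by apply: Rlt_le; apply: wallis_gt0.
apply: wint_ge0; first by apply: cont_mult => //; apply: cont_cosX.
by move=> x hx; apply: Rmult_le_pos; [exact: h|apply: pow_le; apply: cos_ge0_hpi; lra].
Qed.

Lemma wcos_le k f g : cont f -> cont g -> (forall x, 0 < x < hpi -> f x <= g x) -> wcos k f <= wcos k g.
Proof.
move=> cf cg h; apply: Rmult_le_compat_l; first by apply: Rlt_le; apply: wallis_gt0.
apply: wint_le; try by apply: cont_mult => //; apply: cont_cosX.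
by move=> x hx; apply: Rmult_le_compat_r; [apply: pow_le; apply: cos_ge0_hpi; lra|exact: h].
Qed.

Lemma wint_cos k : wint (fun x => cos x ^ (2 * k)) = hpi / wallis k.
Proof.
have c0 := wallis_gt0 k; rewrite -(wcos_one k) /wcos.
rewrite (wint_ext (g := fun x => cos x ^ (2 * k))) => [|x _]; last by rewrite dpow0; ring.
by field; lra.
Qed.

Lemma wcos_sin2 c k : wcos k (fun x => c * (sin x * sin x)) = c * (hpi / (INR (2 * k).+2)).
Proof.
have K0 : 0 < INR (2 * k).+1 by apply: lt_0_INR; lia.
have K1 : 0 < INR (2 * k).+2 by apply: lt_0_INR; lia.
have c0 := wallis_gt0 k.
rewrite /wcos (wint_ext (g := fun x => c * (cos x ^ (2 * k) + - 1 * cos x ^ (2 * k.+1)))) => [|x _]; last first.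
  have -> : sin x * sin x = 1 - cos x * cos x by have := sin2_cos2 x; rewrite /Rsqr; lra.
  rewrite (_ : (2 * k.+1 = (2 * k).+2)%nat); last lia.
  by rewrite -!tech_pow_Rmult; ring.
have C1 : cont (fun x => cos x ^ (2 * k)) by apply: cont_cosX.
have C2 : cont (fun x => cos x ^ (2 * k.+1)) by apply: cont_cosX.
have C3 : cont (fun x => - 1 * cos x ^ (2 * k.+1)) by apply: cont_mult => //; apply: cont_const.
rewrite wint_scal; last exact: cont_plus.
rewrite wint_plus // wint_scal // !wint_cos wallisS.
have -> : INR (2 * k).+1 = INR (2 * k).+2 - 1 by rewrite (S_INR (2 * k).+1); ring.
have h1 : INR (2 * k).+2 - 1 <> 0 by move: K0; rewrite (S_INR (2 * k).+1); lra.
by field; lra.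
Qed.

Lemma lim_invS (c : R) : is_lim_seq (fun k => c * (hpi / INR (2 * k).+2)) 0.
Proof.
apply: lim_scal0.
apply: (is_lim_seq_le_le (fun _ => 0) _ (fun k => hpi * / INR k.+1)) => [k||]; last first.
- apply: lim_scal0; apply: (proj1 (is_lim_seq_incr_1 (fun k => / INR k) 0)).
  by apply: (is_lim_seq_inv _ _ is_lim_seq_INR).
- exact: is_lim_seq_const.
have h0 := hpi_gt0; have k1 : 0 < INR k.+1 by apply: lt_0_INR; lia.
split; first by apply: Rlt_le; apply: Rdiv_lt_0_compat => //; apply: lt_0_INR; lia.
apply: Rmult_le_compat_l; first lra.
by apply: Rinv_le_contravar => //; apply: le_INR; lia.
Qed.

(** The mass of cos^(2k) concentrates at 0, where the integrand has a double zero; it is dominated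
    by sin^2, whose normalised integral is O(1/k). *)
Lemma wcos_lim0 a : is_lim_seq (fun k => wcos k (dpow a.+2)) 0.
Proof.
(* 64 = 4 * 16 from (2x)^2 and x <= 4 sin x; 4^a bounds (2x)^a because x <= 2. *)
pose c := 64 * (4 ^ a / INR (fact a.+2)).
apply: (is_lim_seq_le_le (fun _ => 0) _ (fun k => c * (hpi / INR (2 * k).+2))) => [k||]; last exact: lim_invS.
- split; first by apply: wcos_ge0 => [|x hx]; [exact: cont_dpow|apply: dpow_ge0; lra].
  rewrite -wcos_sin2; apply: wcos_le; first exact: cont_dpow.
    apply: cont_mult; first exact: cont_const.
    by apply: cont_mult; exact: cont_sin.
  move=> x [x0 x1]; have h2 := hpi_le2.
  rewrite /dpow /c /Rdiv; have f0 : 0 < / INR (fact a.+2) by apply: Rinv_0_lt_compat; apply: INR_fact_lt_0.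
  have s1 : x <= 4 * sin x by apply: sin_ge; lra.
  have p1 : (2 * x) ^ a <= 4 ^ a by apply: pow_incr; lra.
  have p0 : 0 <= (2 * x) ^ a by apply: pow_le; lra.
  have -> : 64 * (4 ^ a * / INR (fact a.+2)) * (sin x * sin x) = (64 * (sin x * sin x) * 4 ^ a) * / INR (fact a.+2) by ring.
  apply: Rmult_le_compat_r; first lra.
  rewrite -!tech_pow_Rmult; have : x * x <= 16 * (sin x * sin x) by nra.
  move=> h; have -> : 2 * x * (2 * x * (2 * x) ^ a) = 4 * (x * x) * (2 * x) ^ a by ring.
  by apply: Rmult_le_compat => //; nra.
exact: is_lim_seq_const.
Qed.

Definition wcos_sum ks f m : R := psum (fun k => licR (iw ks) k * wcos k f) m.+1.

(** Abel summation: by [wcos_dpow], 1/n^2 times a normalised integral is a difference, so a leading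
    2 is traded for two powers of 2x. *)
Lemma wcos_sum_step ks a m : wcos_sum (2%nat :: ks) (dpow a) m = wcos_sum ks (dpow a.+2) m - hsumR ks m * wcos m (dpow a.+2).
Proof.
elim: m => [|m IH].
  rewrite /wcos_sum hsumRE /= [licR (iw (2%nat :: ks)) 0]licR0; ring.
rewrite {1}/wcos_sum psumS -/(wcos_sum _ _ m) IH licR_iw.
rewrite {2}/wcos_sum psumS -/(wcos_sum _ _ m).
have e : hsumR ks m.+1 = hsumR ks m + licR (iw ks) m.+1 by rewrite !hsumRE.
rewrite e; have := wcos_dpow m a.
have -> : (/ INR m.+1) ^ 2 = / INR m.+1 ^ 2 by rewrite pow_inv.
move=> h.
have -> : / INR m.+1 ^ 2 * hsumR ks m * wcos m.+1 (dpow a) = hsumR ks m * (wcos m (dpow a.+2) - wcos m.+1 (dpow a.+2)) by rewrite h; ring.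
ring.
Qed.

Lemma adm_2 n : adm (nseq n 2%nat).
Proof. by rewrite /adm all_nseq orbT andbT; case: n. Qed.

Lemma hsumR_wcos_lim ks a : adm ks -> is_lim_seq (fun m => hsumR ks m * wcos m (dpow a.+2)) 0.
Proof.
move=> ha; rewrite -(Rmult_0_r (zreg (iw ks))).
by apply: is_lim_seq_mult'; [exact: hsumR_lim|exact: wcos_lim0].
Qed.

Lemma wcos_sum_lim_step ks a (l : R) : adm ks ->
  is_lim_seq (wcos_sum (2%nat :: ks) (dpow a)) l -> is_lim_seq (wcos_sum ks (dpow a.+2)) l.
Proof.
move=> ha h; have := is_lim_seq_plus' _ _ _ _ h (@hsumR_wcos_lim ks a ha); rewrite Rplus_0_r.
by apply: is_lim_seq_ext => m; rewrite wcos_sum_step; ring.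
Qed.

Lemma wcos_sum_lim_steps ks n a (l : R) : adm ks ->
  is_lim_seq (wcos_sum (nseq n 2%nat ++ ks) (dpow a)) l -> is_lim_seq (wcos_sum ks (dpow (2 * n + a))) l.
Proof.
move=> ha; elim: n a => [|n IH] a h; first by rewrite muln0.
have -> : (2 * n.+1 + a = 2 * n + a.+2)%nat by lia.
apply: IH; apply: wcos_sum_lim_step h; case: n => [|n] //.
by move: ha; rewrite /adm /= all_cat all_nseq orbT => /andP[].
Qed.

Lemma wcos_sum_start ks : adm ks -> is_lim_seq (wcos_sum ks (dpow 0)) (zreg (iw ks) * hpi).
Proof.
move=> ha; apply: (is_lim_seq_ext (fun m => hsumR ks m * hpi)) => [m|]; last first.
  by apply: is_lim_seq_mult'; [exact: hsumR_lim|exact: is_lim_seq_const].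
rewrite /wcos_sum hsumRE; elim: m.+1 => [|k IH]; first by rewrite /= Rmult_0_l.
by rewrite !psumS wcos_one -IH; ring.
Qed.

(** Trading all the entries 2 leaves the single integral of (2x)^(2n)/(2n)!. *)
Lemma zreg_wtwos n : zreg (wtwos n) = PI ^ (2 * n) / INR (fact (2 * n).+1).
Proof.
have h := wcos_sum_start (adm_2 n); have := @wcos_sum_lim_steps [::] n 0 (zreg (wtwos n) * hpi) isT.
rewrite cats0 addn0 => /(_ h) h1.
have h2 : is_lim_seq (wcos_sum [::] (dpow (2 * n))) (wcos 0 (dpow (2 * n))).
  apply: (is_lim_seq_ext (fun _ => wcos 0 (dpow (2 * n)))) => [m|]; last exact: is_lim_seq_const.
  rewrite /wcos_sum; elim: m => [|m IH]; first by rewrite /= licR_nil; ring.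
  by rewrite psumS -IH [iw _]/= licR_nil; ring.
have := lim_uniq h1 h2.
have -> : wcos 0 (dpow (2 * n)) = dpow (2 * n).+1 hpi / 2.
  rewrite /wcos /= Rmult_1_l (wint_ext (g := dpow (2 * n))) => [|x _]; last by rewrite /=; ring.
  rewrite (@wint_FTC (fun x => / 2 * dpow (2 * n).+1 x)); first by rewrite dpow_at0; field.
    move=> x _; have H := is_derive_scal _ _ (/ 2) _ (is_derive_dpow (2 * n) x).
    by apply: (is_derive_eqR H) => //; field.
  exact: cont_dpow.
have h0 := hpi_gt0; rewrite /dpow.
have -> : 2 * hpi = PI by rewrite /hpi; field.
have f0 := INR_fact_neq_0 (2 * n).+1.
move=> e; apply: (Rmult_eq_reg_r hpi); last lra.
by rewrite e -tech_pow_Rmult /hpi; field.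
Qed.

Lemma is_deriveN (f : R -> R) (x df : R) : is_derive f x df -> is_derive (fun t => - f t) x (- df).
Proof. exact: (is_derive_opp (V := R_NormedModule)). Qed.

(** * Expansion of powers of pi - 2x in even powers of cos *)

Definition cospow (k : nat) (x : R) : R := wallis k * cos x ^ (2 * k).
Definition cossum ks m x : R := psum (fun k => licR (iw ks) k * cospow k x) m.+1.

Definition dcospow (k : nat) (x : R) : R :=
  if k is k'.+1 then wallis k * (- INR (2 * k').+2 * cos x ^ (2 * k').+1 * sin x) else 0.

Lemma doubleS_mul k : (2 * k.+1 = (2 * k).+2)%nat. Proof. by lia. Qed.

Lemma is_derive_cospow k x : is_derive (cospow k) x (dcospow k x).
Proof.
case: k => [|k].
  apply: (is_derive_ext (fun _ => 1)) => [t|]; last exact: is_derive_const.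
  by rewrite /cospow muln0 /= Rmult_1_r.
apply: (is_derive_ext (fun x => wallis k.+1 * cos x ^ (2 * k).+2)) => [t|]; first by rewrite /cospow doubleS_mul.
by apply: is_derive_scal; apply: is_derive_cosX.
Qed.

Lemma is_derive_dcospow k x : is_derive (dcospow k.+1) x (4 * INR k.+1 ^ 2 * (cospow k x - cospow k.+1 x)).
Proof.
pose K := INR (2 * k).+2.
have eK : K = 2 * INR k.+1 by rewrite /K -doubleS_mul mult_INR.
have k1 : INR (2 * k).+1 = K - 1 by rewrite /K (S_INR (2 * k).+1); ring.
have H := is_derive_scal _ _ (- wallis k.+1 * K) _ (is_deriveM (is_derive_cosX (2 * k) x) (is_derive_sin x)).
apply: (is_derive_eqR H) => [t|]; first by rewrite /dcospow -/K; ring.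
rewrite /cospow doubleS_mul wallisS -/K k1 -!tech_pow_Rmult.
have s2 : sin x * sin x = 1 - cos x * cos x by have := sin2_cos2 x; rewrite /Rsqr; lra.
have K1 : 1 < K by rewrite eK S_INR; have := pos_INR k; lra.
have -> : INR k.+1 = K / 2 by rewrite eK; field.
transitivity (- (wallis k * (K / (K - 1))) * K * (- (K - 1) * cos x ^ (2 * k) * (sin x * sin x) + cos x * cos x ^ (2 * k) * cos x)).
  by rewrite /=; ring.
by rewrite s2; field; lra.
Qed.

Definition dcossum ks m x : R := psum (fun k => licR (iw ks) k * dcospow k x) m.+1.

Lemma is_derive_cossum ks m x : is_derive (cossum ks m) x (dcossum ks m x).
Proof.
rewrite /cossum /dcossum; elim: m.+1 => [|k IH]; first exact: is_derive_const.
apply: is_deriveD; first exact: IH.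
by apply: is_derive_scal; apply: is_derive_cospow.
Qed.

(** Two derivatives remove a leading 2, up to the boundary term of the telescoping sum. *)
Lemma is_derive_dcossum ks m x :
  is_derive (dcossum (2%nat :: ks) m) x (4 * (cossum ks m x - hsumR ks m * cospow m x)).
Proof.
elim: m => [|m IH].
  apply: (is_derive_ext (fun _ => 0)) => [t|]; first by rewrite /dcossum /= Rmult_0_r; ring.
  have -> : 4 * (cossum ks 0 x - hsumR ks 0 * cospow 0 x) = 0 by rewrite /cossum hsumRE /=; ring.
  exact: is_derive_const.
have H := is_deriveD IH (is_derive_scal _ _ (licR (iw (2%nat :: ks)) m.+1) _ (is_derive_dcospow m x)).
apply: (is_derive_eqR H) => //.
have -> : hsumR ks m.+1 = hsumR ks m + licR (iw ks) m.+1 by rewrite !hsumRE.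
have -> : cossum ks m.+1 x = cossum ks m x + licR (iw ks) m.+1 * cospow m.+1 x by [].
rewrite licR_iw pow_inv; field.
by apply: not_0_INR.
Qed.

Definition rpow (q : nat) (x : R) : R := dpow q (hpi - x).

Lemma is_derive_rpow q x : is_derive (rpow q.+1) x (- 2 * rpow q x).
Proof.
have d : is_derive (fun x => hpi - x) x (- 1) by auto_derive; [|ring].
have H := is_derive_comp _ _ _ _ _ (is_derive_dpow q (hpi - x)) d.
by apply: (is_derive_eqR H) => //; rewrite /scal /= /mult /= /rpow; ring.
Qed.

Lemma cont_rpow q : cont (rpow q).
Proof.
case: q => [|q]; last exact: (derive_cont (is_derive_rpow q)).
by apply: (@cont_ext (fun _ => 1)) => [x|]; [rewrite /rpow dpow0|exact: cont_const].
Qed.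

(* [rpow (2 * n)] has an expansion in even powers of cos whose coefficients are
   those of the polylogarithm of {2}^n; [cosrem] is its truncation error. *)
Definition cosrem n m x : R := rpow (2 * n) x - cossum (nseq n 2%nat) m x.
Definition dcosrem n m x : R := - 2 * rpow (2 * n).+1 x - dcossum (nseq n.+1 2%nat) m x.

Lemma is_derive_cosrem n m x : is_derive (cosrem n.+1 m) x (dcosrem n m x).
Proof.
have H := is_deriveD (is_derive_rpow (2 * n).+1 x)
  (is_deriveN (is_derive_cossum (nseq n.+1 2%nat) m x)).
by apply: (is_derive_eqR H) => // t; rewrite /cosrem doubleS_mul.
Qed.

Lemma is_derive_dcosrem n m x :
  is_derive (dcosrem n m) x (4 * (cosrem n m x + hsumR (nseq n 2%nat) m * cospow m x)).
Proof.
have H := is_deriveD (is_derive_scal _ _ (- 2) _ (is_derive_rpow (2 * n) x))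
  (is_deriveN (is_derive_dcossum (nseq n 2%nat) m x)).
apply: (is_derive_eqR H) => //.
by rewrite /cosrem; ring.
Qed.

Lemma cos_hpiX k : cos hpi ^ k.+1 = 0.
Proof. by rewrite cos_hpi /= Rmult_0_l. Qed.

Lemma cosrem_hpi n m : cosrem n.+1 m hpi = 0.
Proof.
rewrite /cosrem /rpow doubleS_mul Rminus_diag dpow_at0.
suff -> : cossum (nseq n.+1 2%nat) m hpi = 0 by ring.
rewrite /cossum; elim: m.+1 => [|k IH] //; rewrite psumS IH.
case: k {IH} => [|k]; first by rewrite (licR0 false); ring.
by rewrite /cospow doubleS_mul cos_hpiX; ring.
Qed.

Lemma dcosrem_hpi n m : dcosrem n m hpi = 0.
Proof.
rewrite /dcosrem /rpow Rminus_diag dpow_at0.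
suff -> : dcossum (nseq n.+1 2%nat) m hpi = 0 by ring.
rewrite /dcossum; elim: m.+1 => [|k IH] //; rewrite psumS IH.
case: k {IH} => [|k]; first by rewrite /=; ring.
by rewrite /dcospow cos_hpiX; ring.
Qed.

Lemma cont_cossum ks m : cont (cossum ks m).
Proof. exact: (derive_cont (is_derive_cossum ks m)). Qed.

Lemma cont_cosrem n m : cont (cosrem n m).
Proof.
apply: (@cont_ext (fun x => rpow (2 * n) x + - 1 * cossum (nseq n 2%nat) m x)) => [x|].
  by rewrite /cosrem; ring.
apply: cont_plus; first exact: cont_rpow.
by apply: cont_mult; [exact: cont_const|exact: cont_cossum].
Qed.

Lemma cont_cospow k : cont (cospow k).
Proof. exact: (derive_cont (is_derive_cospow k)). Qed.

Lemma taylor2 (f f1 g : R -> R) x : 0 <= x <= hpi ->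
  (forall t, is_derive f t (f1 t)) -> (forall t, is_derive f1 t (g t)) -> cont g ->
  f hpi = 0 -> f1 hpi = 0 -> is_RInt (fun t => (t - x) * g t) x hpi (f x).
Proof.
move=> [x0 x1] d1 d2 cg fh f1h.
have -> : f x = ((hpi - x) * f1 hpi - f hpi) - ((x - x) * f1 x - f x) by rewrite fh f1h; ring.
apply: (is_RInt_derive (fun t => (t - x) * f1 t - f t)) => t; rewrite Rmin_left // Rmax_right // => ht.
  have dx : is_derive (fun t => t - x) t 1 by auto_derive; [|ring].
  have H := is_deriveD (is_deriveM dx (d2 t)) (is_deriveN (d1 t)).
  by apply: (is_derive_eqR H) => //; ring.
apply: (continuous_mult (K := R_AbsRing) (fun t => t - x)); last by apply: cg; lra.
apply: (ex_derive_continuous (V := R_NormedModule)); exists 1; auto_derive; [|ring]; done.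
Qed.

(** The integral of [cospow m] times sin over [0, pi/2]; it is O(m^(-1/2)) by [wallis_sqr]. *)
Definition delta m : R := wallis m / INR (2 * m).+1.

Lemma wallis_sqr m : wallis m * wallis m <= 4 * INR m + 1.
Proof.
elim: m => [|m IH]; first by rewrite /=; lra.
have m0 := pos_INR m.
rewrite wallisS !S_INR mult_INR [INR 2]/=; set u := INR m in m0 IH *.
have c0 := wallis_gt0 m.
have -> : wallis m * ((2 * u + 1 + 1) / (2 * u + 1)) * (wallis m * ((2 * u + 1 + 1) / (2 * u + 1)))
  = (wallis m * wallis m) * ((2 * u + 2) * (2 * u + 2)) / ((2 * u + 1) * (2 * u + 1)) by field; lra.
apply: (Rmult_le_reg_r ((2 * u + 1) * (2 * u + 1))); first by nra.
have -> : wallis m * wallis m * ((2 * u + 2) * (2 * u + 2)) / ((2 * u + 1) * (2 * u + 1)) * ((2 * u + 1) * (2 * u + 1))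
  = wallis m * wallis m * ((2 * u + 2) * (2 * u + 2)) by field; lra.
apply: Rle_trans (_ : (4 * u + 1) * ((2 * u + 2) * (2 * u + 2)) <= _); last by nra.
by apply: Rmult_le_compat_r => //; nra.
Qed.

Lemma delta_ge0 m : 0 <= delta m.
Proof.
by apply: Rlt_le; apply: Rdiv_lt_0_compat; [exact: wallis_gt0|apply: lt_0_INR; lia].
Qed.

Lemma delta_lim : is_lim_seq delta 0.
Proof.
have h : is_lim_seq (fun m => delta m * delta m) 0.
  apply: (is_lim_seq_le_le (fun _ => 0) _ (fun k => (4 / hpi) * (hpi / INR (2 * k).+2))) => [m||]; last exact: lim_invS.
    split; first by have := delta_ge0 m; nra.
    have m0 := pos_INR m; have h0 := hpi_gt0; have c := wallis_sqr m.
    rewrite /delta !S_INR mult_INR [INR 2]/=; set u := INR m in m0 c *.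
    have -> : 4 / hpi * (hpi / (2 * u + 1 + 1)) = 4 / (2 * u + 2) by field; lra.
    have -> : wallis m / (2 * u + 1) * (wallis m / (2 * u + 1)) = (wallis m * wallis m) / ((2 * u + 1) * (2 * u + 1)) by field; lra.
    apply: Rle_trans (_ : (4 * u + 1) / ((2 * u + 1) * (2 * u + 1)) <= _).
      by apply: Rmult_le_compat_r => //; apply: Rlt_le; apply: Rinv_0_lt_compat; nra.
    apply: (Rmult_le_reg_r ((2 * u + 1) * (2 * u + 1) * (2 * u + 2))); first by nra.
    have -> : (4 * u + 1) / ((2 * u + 1) * (2 * u + 1)) * ((2 * u + 1) * (2 * u + 1) * (2 * u + 2))
      = (4 * u + 1) * (2 * u + 2) by field; lra.
    have -> : 4 / (2 * u + 2) * ((2 * u + 1) * (2 * u + 1) * (2 * u + 2)) = 4 * ((2 * u + 1) * (2 * u + 1)) by field; lra.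
    nra.
  exact: is_lim_seq_const.
have := is_lim_seq_continuous sqrt _ 0 (continuity_pt_sqrt 0 (Rle_refl 0)) h; rewrite sqrt_0.
by apply: is_lim_seq_ext => m; rewrite sqrt_square //; exact: delta_ge0.
Qed.

Lemma cospow_ge0 k x : 0 <= x <= hpi -> 0 <= cospow k x.
Proof.
move=> hx; apply: Rmult_le_pos; first by apply: Rlt_le; apply: wallis_gt0.
by apply: pow_le; apply: cos_ge0_hpi.
Qed.

(** Integrating the nonnegative second derivative twice from pi/2 keeps the remainder nonnegative.
    Replacing the kernel t - x by 4 sin t makes the upper bound explicit, and its factor cos x
    allows the later division by cos. *)
Lemma cosrem_bound n : exists e : nat -> R, is_lim_seq e 0 /\
  forall m x, 0 <= x <= hpi -> 0 <= cosrem n m x <= e m * cos x.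
Proof.
elim: n => [|n [e [le he]]].
  exists (fun _ => 0); split; first exact: is_lim_seq_const.
  move=> m x _; rewrite Rmult_0_l.
  suff -> : cosrem 0 m x = 0 by split; lra.
  rewrite /cosrem /rpow muln0 dpow0 [nseq 0 _]/=.
  suff -> : cossum [::] m x = 1 by ring.
  rewrite /cossum; elim: m => [|m IH]; first by rewrite /= licR_nil /cospow muln0 /=; ring.
  by rewrite psumS IH licR_nil; ring.
pose T := zreg (iw (nseq n 2%nat)).
have HT m : 0 <= hsumR (nseq n 2%nat) m <= T.
  by split; [apply: hsumR_ge0; case/andP: (adm_2 n)|apply: hsumR_le_zreg; exact: adm_2].
exists (fun m => 8 * e m + 16 * T * delta m); split.
  rewrite -(Rplus_0_r 0); apply: is_lim_seq_plus'; first exact: lim_scal0.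
  by apply: lim_scal0; exact: delta_lim.
move=> m x hx; have [x0 x1] := hx.
pose g t := 4 * (cosrem n m t + hsumR (nseq n 2%nat) m * cospow m t).
have cg : cont g.
  apply: cont_mult; first exact: cont_const.
  by apply: cont_plus; [exact: cont_cosrem|apply: cont_mult; [exact: cont_const|exact: cont_cospow]].
have I := taylor2 hx (is_derive_cosrem n m) (is_derive_dcosrem n m) cg (cosrem_hpi n m) (dcosrem_hpi n m).
have g0 t : 0 <= t <= hpi -> 0 <= g t.
  move=> ht; have := proj1 (he m t ht); have := HT m; have := cospow_ge0 m ht.
  by move=> a [b _] c; rewrite /g; apply: Rmult_le_pos; [lra|have := Rmult_le_pos _ _ b a; lra].
split.
  apply: (is_RInt_ge_0 _ _ _ _ x1 I) => t ht.
  by apply: Rmult_le_pos; [lra|apply: g0; lra].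
(* A primitive of the majorant [dG]: 16 is 4 from the second derivative times 4 from t <= 4 sin t,
   and 8 comes from integrating sin cos. *)
pose G t := - (8 * e m * (cos t ^ 2) + 16 * T * (wallis m * (cos t ^ (2 * m).+1 / INR (2 * m).+1))).
pose dG t := 16 * sin t * (e m * cos t + T * cospow m t).
have K0 : 0 < INR (2 * m).+1 by apply: lt_0_INR; lia.
have dG' t : is_derive G t (dG t).
  have H1 := is_derive_scal _ _ (8 * e m) _ (is_derive_cosX 1 t).
  have H2 := is_derive_scal _ _ (- (16 * T * wallis m / INR (2 * m).+1)) _ (is_derive_cosX (2 * m) t).
  have H := is_deriveD (is_deriveN H1) H2.
  apply: (is_derive_eqR H) => [u|]; first by rewrite /G; field; lra.
  by rewrite /dG /cospow pow_1 [INR 2]/=; field; lra.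
have cdG : cont dG.
  apply: cont_mult; first by apply: cont_mult; [exact: cont_const|exact: cont_sin].
  apply: cont_plus; apply: cont_mult; try exact: cont_const; last exact: cont_cospow.
  by apply: (@cont_ext (fun x => cos x ^ 1)) => [u|]; [rewrite /=; ring|exact: cont_cosX].
have I2 : is_RInt dG x hpi (G hpi - G x).
  apply: (is_RInt_derive G dG) => t; rewrite Rmin_left // Rmax_right // => ht.
  by apply: cdG; lra.
have : cosrem n.+1 m x <= G hpi - G x.
  apply: (is_RInt_le _ _ _ _ _ _ x1 I I2) => t ht.
  have t01 : 0 <= t <= hpi by lra.
  have s1 := sin_ge t01; have gt := g0 t t01; have [E0 E1] := he m t t01; have [h0 h1] := HT m.
  have d0 := cospow_ge0 m t01.
  apply: Rle_trans (_ : 4 * sin t * g t <= _); first by apply: (Rmult_le_compat_r (g t)); lra.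
  rewrite /dG /g; have s0 : 0 <= sin t by lra.
  have q : hsumR (nseq n 2%nat) m * cospow m t <= T * cospow m t by apply: Rmult_le_compat_r.
  have -> : 4 * sin t * (4 * (cosrem n m t + hsumR (nseq n 2%nat) m * cospow m t))
    = 16 * sin t * (cosrem n m t + hsumR (nseq n 2%nat) m * cospow m t) by ring.
  by apply: Rmult_le_compat_l; lra.
have c0 := cos_ge0_hpi hx; have c1 := COS_bound x.
have e0 : 0 <= e m * cos x by have := he m x hx; lra.
have -> : G hpi = 0 by rewrite /G !cos_hpiX; field; lra.
rewrite /G Rminus_0_l Ropp_involutive => h; apply: Rle_trans h _.
have p1 : cos x ^ 2 = cos x * cos x by rewrite /=; ring.
have p2 : cos x ^ (2 * m).+1 <= cos x.
  rewrite -tech_pow_Rmult -{3}(Rmult_1_r (cos x)); apply: Rmult_le_compat_l => //.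
  by rewrite -(pow1 (2 * m)); apply: pow_incr; lra.
have T0 : 0 <= T by have := HT m; lra.
have q1 : 8 * e m * cos x ^ 2 <= 8 * e m * cos x by rewrite p1; nra.
have q2 : 16 * T * (wallis m * (cos x ^ (2 * m).+1 / INR (2 * m).+1)) <= 16 * T * delta m * cos x.
  have -> : 16 * T * (wallis m * (cos x ^ (2 * m).+1 / INR (2 * m).+1)) = 16 * T * delta m * cos x ^ (2 * m).+1.
    by rewrite /delta; field; lra.
  by apply: Rmult_le_compat_l => //; apply: Rmult_le_pos; [lra|exact: delta_ge0].
lra.
Qed.

(** * Reduction to the tangent integral *)

Definition cossum_div ks m x : R := psum (fun k => licR (iw (2%nat :: ks)) k * (wallis k * cos x ^ (2 * k).-1)) m.+1.

(** Integration by parts produces a factor k+1, which lowers a leading 3 to 2 and creates the sin /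
    cos of the tangent. *)
Lemma wcos_div k a : wcos k.+1 (dpow a) = INR k.+1 * (wallis k.+1 * wint (fun x => dpow a.+1 x * sin x * cos x ^ (2 * k).+1)).
Proof.
have C1 : cont (fun x => dpow a x * cos x ^ (2 * k).+2).
  by apply: cont_mult; [exact: cont_dpow|exact: cont_cosX].
have C2 : cont (fun x => dpow a.+1 x * sin x * cos x ^ (2 * k).+1).
  by apply: cont_mult; [apply: cont_mult; [exact: cont_dpow|exact: cont_sin]|exact: cont_cosX].
have I0 : wint (fun x => 2 * (dpow a x * cos x ^ (2 * k).+2)
    + - INR (2 * k).+2 * (dpow a.+1 x * sin x * cos x ^ (2 * k).+1)) = 0.
  rewrite (@wint_FTC (fun x => dpow a.+1 x * cos x ^ (2 * k).+2)).
  - by rewrite cos_hpiX dpow_at0; ring.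
  - move=> x _; have H := is_deriveM (is_derive_dpow a x) (is_derive_cosX (2 * k).+1 x).
    by apply: (is_derive_eqR H) => //; ring.
  - by apply: cont_plus; apply: cont_mult => //; exact: cont_const.
rewrite wint_plus ?wint_scal // in I0; try (by apply: cont_mult => //; exact: cont_const).
rewrite /wcos doubleS_mul; have e : INR (2 * k).+2 = 2 * INR k.+1 by rewrite -doubleS_mul mult_INR.
rewrite e in I0.
have -> : wint (fun x => dpow a x * cos x ^ (2 * k).+2) = INR k.+1 * wint (fun x => dpow a.+1 x * sin x * cos x ^ (2 * k).+1) by lra.
ring.
Qed.

Lemma cont_cossum_div ks m : cont (cossum_div ks m).
Proof.
rewrite /cossum_div; elim: m.+1 => [|k IH]; first exact: cont_const.
apply: cont_plus; first exact: IH.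
by do 2 (apply: cont_mult; first exact: cont_const); exact: cont_cosX.
Qed.

Lemma wcos_sum3 ks a m : wcos_sum (3%nat :: ks) (dpow a) m = wint (fun x => dpow a.+1 x * sin x * cossum_div ks m x).
Proof.
have cms : cont (fun x => dpow a.+1 x * sin x) by apply: cont_mult; [exact: cont_dpow|exact: cont_sin].
elim: m => [|m IH].
  rewrite (wint_ext (g := fun x => 0 * 1)) => [|x _]; last by rewrite /cossum_div /= (licR0 false); ring.
  by rewrite wint_scal /wcos_sum /= ?(licR0 false); [ring|exact: cont_const].
have -> : wcos_sum (3%nat :: ks) (dpow a) m.+1 = wcos_sum (3%nat :: ks) (dpow a) m + licR (iw (3%nat :: ks)) m.+1 * wcos m.+1 (dpow a) by [].
have C : cont (fun x => dpow a.+1 x * sin x * cos x ^ (2 * m).+1) by apply: cont_mult => //; exact: cont_cosX.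
rewrite IH wcos_div [RHS](wint_ext (g := fun x => dpow a.+1 x * sin x * cossum_div ks m x +
   licR (iw (2%nat :: ks)) m.+1 * wallis m.+1 * (dpow a.+1 x * sin x * cos x ^ (2 * m).+1))) => [|x _].
  rewrite wint_plus ?wint_scal //; first last.
  - by apply: cont_mult => //; exact: cont_const.
  - by apply: cont_mult => //; exact: cont_cossum_div.
  rewrite !licR_iw; have m0 : INR m.+1 <> 0 by apply: not_0_INR.
  by rewrite !pow_inv; field.
have -> : cossum_div ks m.+1 x = cossum_div ks m x + licR (iw (2%nat :: ks)) m.+1 * (wallis m.+1 * cos x ^ (2 * m.+1).-1) by [].
by rewrite doubleS_mul [(2 * m).+2.-1]/=; ring.
Qed.

(** At k = 0 the exponent is truncated to 0, but there the coefficient of a nonempty word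
    vanishes. *)
Lemma cossum_div_cos ks m x : cos x * cossum_div ks m x = cossum (2%nat :: ks) m x.
Proof.
rewrite /cossum_div /cossum; elim: m.+1 => [|k IH]; first by rewrite /=; ring.
rewrite !psumS Rmult_plus_distr_l IH; congr (_ + _).
case: k {IH} => [|k]; first by rewrite (licR0 false); ring.
by rewrite /cospow doubleS_mul [(2 * k).+2.-1]/= -(tech_pow_Rmult _ (2 * k).+1); ring.
Qed.

(** A zero of order at least two in the numerator makes this continuous at pi/2, where the totalised
    division gives the correct value 0. *)
Definition rpow_div q x : R := rpow q.+2 x / cos x.

Lemma cos_hpi_sub x : cos x = sin (hpi - x).
Proof. by rewrite /hpi sin_shift. Qed.

Lemma fact_ge1 n : 1 <= INR (fact n).
Proof. by have := lt_O_fact n; move=> h; rewrite -[1]/(INR 1); apply: le_INR; lia. Qed.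

Lemma rpow_le q x : 0 <= x <= hpi -> 0 <= rpow q.+1 x <= 4 ^ q * (2 * (hpi - x)).
Proof.
move=> [x0 x1]; have h2 := hpi_le2; have f1 := fact_ge1 q.+1; split; first by apply: dpow_ge0; lra.
rewrite /rpow /dpow; set y := 2 * (hpi - x); have y0 : 0 <= y <= 4 by rewrite /y; lra.
have p0 : 0 <= y ^ q.+1 by apply: pow_le; lra.
apply: Rle_trans (_ : y ^ q.+1 <= _).
  rewrite /Rdiv -{2}(Rmult_1_r (y ^ q.+1)); apply: Rmult_le_compat_l => //.
  by rewrite -Rinv_1; apply: Rinv_le_contravar; lra.
rewrite -tech_pow_Rmult Rmult_comm; apply: Rmult_le_compat_r; first lra.
by apply: pow_incr; lra.
Qed.

Lemma cos_low x : 0 <= x <= hpi -> (hpi - x) <= 4 * cos x.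
Proof. by move=> hx; rewrite cos_hpi_sub; apply: sin_ge; lra. Qed.

Lemma is_derive_rpow_div q x : 0 <= x < hpi -> is_derive (rpow_div q) x
  (- 2 * (rpow q.+1 x / cos x) + rpow q.+2 x / cos x / cos x * sin x).
Proof.
move=> hx; have c0 := cos_gt0_hpi hx.
have H := is_derive_div _ _ _ _ _ (is_derive_rpow q.+1 x) (is_derive_cos x) (Rgt_not_eq _ _ c0).
apply: (is_derive_eqR H) => //; field; lra.
Qed.

Lemma rpow_abs q x : Rabs (hpi - x) <= 2 ->
  Rabs (rpow q.+2 x) <= 4 ^ q * (4 * (Rabs (hpi - x) * Rabs (hpi - x))).
Proof.
move=> hx; have f1 := fact_ge1 q.+2.
rewrite /rpow /dpow Rabs_div; last lra.
rewrite (Rabs_pos_eq (INR _)); last lra.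
rewrite -RPow_abs Rabs_mult (Rabs_pos_eq 2); last lra.
have -> : 4 * (Rabs (hpi - x) * Rabs (hpi - x)) = 2 * Rabs (hpi - x) * (2 * Rabs (hpi - x)) by ring.
set y := 2 * Rabs (hpi - x); have y0 : 0 <= y <= 4 by rewrite /y; have := Rabs_pos (hpi - x); lra.
have p0 : 0 <= y ^ q.+2 by apply: pow_le; lra.
apply: Rle_trans (_ : y ^ q.+2 <= _).
  rewrite /Rdiv -{2}(Rmult_1_r (y ^ q.+2)); apply: Rmult_le_compat_l => //.
  by rewrite -Rinv_1; apply: Rinv_le_contravar; lra.
rewrite -!tech_pow_Rmult -Rmult_assoc Rmult_comm; apply: Rmult_le_compat_r; first by nra.
by apply: pow_incr; lra.
Qed.

Lemma rpow_div_hpi q : rpow_div q hpi = 0.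
Proof. by rewrite /rpow_div /rpow Rminus_diag dpow_at0 /Rdiv Rmult_0_l. Qed.

Lemma rpow_div_abs q x : Rabs (hpi - x) <= hpi -> Rabs (rpow_div q x) <= 16 * 4 ^ q * Rabs (hpi - x).
Proof.
move=> hx; have h2 := hpi_le2; have h0 := hpi_gt0.
have [e|e] := Req_dec (hpi - x) 0.
  have -> : x = hpi by lra.
  by rewrite rpow_div_hpi Rminus_diag !Rabs_R0; lra.
have ay : 0 < Rabs (hpi - x) by apply: Rabs_pos_lt.
have s : Rabs (hpi - x) <= 4 * Rabs (cos x).
  rewrite cos_hpi_sub; move: hx; rewrite /Rabs; case: (Rcase_abs (hpi - x)) => y hx; last first.
    by have := @sin_ge (hpi - x) ltac:(lra); case: Rcase_abs; lra.
  have := @sin_ge (- (hpi - x)) ltac:(lra); rewrite sin_neg; case: Rcase_abs; lra.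
have c0 : 0 < Rabs (cos x) by lra.
have P := @rpow_abs q x ltac:(lra).
rewrite /rpow_div Rabs_div; last by move=> e'; move: c0; rewrite e' Rabs_R0; lra.
apply: (Rmult_le_reg_r (Rabs (cos x))) => //.
have -> : Rabs (rpow q.+2 x) / Rabs (cos x) * Rabs (cos x) = Rabs (rpow q.+2 x) by field; lra.
apply: Rle_trans P _.
have p4 : 0 < 4 ^ q by apply: pow_lt; lra.
set y := Rabs (hpi - x) in ay s *; set c := Rabs (cos x) in s c0 *.
have : y * y <= y * (4 * c) by apply: Rmult_le_compat_l; lra.
move=> h; have := Rmult_le_compat_l (4 ^ q * 4) _ _ ltac:(lra) h; lra.
Qed.

Lemma cont_rpow_div q : cont (rpow_div q).
Proof.
move=> x [x0 x1]; have [e|e] := Req_dec x hpi; last first.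
  apply: (ex_derive_continuous (V := R_NormedModule)); eexists; apply: is_derive_rpow_div; lra.
subst x; have h0 := hpi_gt0; apply/continuity_pt_filterlim => eps e0.
have p4 : 0 < 4 ^ q by apply: pow_lt; lra.
exists (Rmin hpi (eps / (16 * 4 ^ q))); split.
  by apply: Rmin_pos; [lra|apply: Rdiv_lt_0_compat; lra].
move=> x [_]; rewrite /= /Rdist rpow_div_hpi Rminus_0_r Rabs_minus_sym => hx.
have h1 : Rabs (hpi - x) < hpi by apply: Rlt_le_trans hx (Rmin_l _ _).
have h2 : Rabs (hpi - x) < eps / (16 * 4 ^ q) by apply: Rlt_le_trans hx (Rmin_r _ _).
apply: Rle_lt_trans (@rpow_div_abs q x ltac:(lra)) _.
have := Rmult_lt_compat_l (16 * 4 ^ q) _ _ ltac:(lra) h2.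
have -> : 16 * 4 ^ q * (eps / (16 * 4 ^ q)) = eps by field; lra.
by [].
Qed.

Lemma dpow_le p x : 0 <= x <= hpi -> dpow p x <= 4 ^ p.
Proof.
move=> hx; have h2 := hpi_le2; have f1 := fact_ge1 p; rewrite /dpow.
have p0 : 0 <= (2 * x) ^ p by apply: pow_le; lra.
apply: Rle_trans (_ : (2 * x) ^ p <= _).
  rewrite /Rdiv -{2}(Rmult_1_r ((2 * x) ^ p)); apply: Rmult_le_compat_l => //.
  by rewrite -Rinv_1; apply: Rinv_le_contravar; lra.
by apply: pow_incr; lra.
Qed.

Definition tanint a q : R := wint (fun x => dpow a x * sin x * rpow_div q x).

Lemma cont_dpow_sin a : cont (fun x => dpow a x * sin x).
Proof. by apply: cont_mult; [exact: cont_dpow|exact: cont_sin]. Qed.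

Lemma wint_const c : wint (fun _ => c) = hpi * c.
Proof. by rewrite /wint RInt_const /scal /= /mult /=; ring. Qed.

(** Divided by cos, the bound of [cosrem_bound] is uniform in x, which justifies the limit under the
    integral. *)
Lemma wcos_sum3_lim a b : is_lim_seq (wcos_sum (3%nat :: nseq b 2%nat) (dpow a)) (tanint a.+1 (2 * b)).
Proof.
have [e [le he]] := cosrem_bound b.+1; set ks := nseq b 2%nat.
have p4 : 0 < 4 ^ a.+1 by apply: pow_lt; lra.
have C1 : cont (fun x => dpow a.+1 x * sin x * rpow_div (2 * b) x).
  by apply: cont_mult; [exact: cont_dpow_sin|exact: cont_rpow_div].
have C2 m : cont (fun x => - 1 * (dpow a.+1 x * sin x * cossum_div ks m x)).
  by apply: cont_mult; [exact: cont_const|apply: cont_mult; [exact: cont_dpow_sin|exact: cont_cossum_div]].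
have eq m : tanint a.+1 (2 * b) - wcos_sum (3%nat :: ks) (dpow a) m =
   wint (fun x => dpow a.+1 x * sin x * rpow_div (2 * b) x + - 1 * (dpow a.+1 x * sin x * cossum_div ks m x)).
  rewrite wint_plus // wint_scal; last by apply: cont_mult; [exact: cont_dpow_sin|exact: cont_cossum_div].
  by rewrite -wcos_sum3 /tanint; ring.
have B m : 0 <= tanint a.+1 (2 * b) - wcos_sum (3%nat :: ks) (dpow a) m <= hpi * 4 ^ a.+1 * e m.
  rewrite eq.
  have pw x : 0 < x < hpi -> 0 <= dpow a.+1 x * sin x * rpow_div (2 * b) x + - 1 * (dpow a.+1 x * sin x * cossum_div ks m x) <= 4 ^ a.+1 * e m.
    move=> hx; have hx' : 0 <= x <= hpi by lra.
    have c0 := @cos_gt0_hpi x ltac:(lra); have [E0 E1] := he m x hx'.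
    have s0 := sin_ge0_hpi hx'; have s1 := SIN_bound x.
    have m0 := @dpow_ge0 a.+1 x ltac:(lra); have m1 := dpow_le a.+1 hx'.
    have -> : dpow a.+1 x * sin x * rpow_div (2 * b) x + - 1 * (dpow a.+1 x * sin x * cossum_div ks m x)
       = dpow a.+1 x * sin x * (cosrem b.+1 m x / cos x).
      rewrite /cosrem /rpow_div doubleS_mul -[nseq b.+1 _]/(2%nat :: ks) -cossum_div_cos; field; lra.
    have E2 : 0 <= cosrem b.+1 m x / cos x by apply: Rmult_le_pos => //; apply: Rlt_le; apply: Rinv_0_lt_compat.
    have E3 : cosrem b.+1 m x / cos x <= e m.
      apply: (Rmult_le_reg_r (cos x)) => //.
      by have -> : cosrem b.+1 m x / cos x * cos x = cosrem b.+1 m x by field; lra.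
    have ms : 0 <= dpow a.+1 x * sin x <= 4 ^ a.+1 by split; [apply: Rmult_le_pos|]; nra.
    split; first by apply: Rmult_le_pos; lra.
    by apply: Rmult_le_compat; lra.
  split; first by apply: wint_ge0; [exact: cont_plus|move=> x /pw[]].
  rewrite Rmult_assoc -wint_const; apply: wint_le; [exact: cont_plus|exact: cont_const|by move=> x /pw[]].
have L : is_lim_seq (fun m => tanint a.+1 (2 * b) - wcos_sum (3%nat :: ks) (dpow a) m) 0.
  apply: (is_lim_seq_le_le (fun _ => 0) _ _ _ B); first exact: is_lim_seq_const.
  exact: lim_scal0.
have := is_lim_seq_minus' _ _ _ _ (is_lim_seq_const (tanint a.+1 (2 * b))) L; rewrite Rminus_0_r.
by apply: is_lim_seq_ext => m; ring.
Qed.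

Lemma adm_3 b : adm (3%nat :: nseq b 2%nat).
Proof. by rewrite /adm /= all_nseq orbT. Qed.

Lemma adm_232 a b : adm (nseq a 2%nat ++ 3%nat :: nseq b 2%nat).
Proof. by case: a => [|a]; rewrite /adm /= ?all_cat /= !all_nseq !orbT. Qed.

(** The first a entries are traded for (2x)^(2a), the 3 gives the tangent, and the last b entries
    are summed inside the integral. *)
Lemma zreg_tanint a b : zreg (wthree a b.+1) * hpi = tanint (2 * a).+1 (2 * b).
Proof.
have e : wthree a b.+1 = iw (nseq a 2%nat ++ 3%nat :: nseq b 2%nat) by rewrite /iw map_cat flatten_cat.
have h := wcos_sum_start (adm_232 a b); rewrite -e in h.
have h1 := wcos_sum_lim_steps (adm_3 b) h; rewrite addn0 in h1.
exact: (@lim_uniq _ _ _ h1 (@wcos_sum3_lim (2 * a) b)).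
Qed.

(** * Riemann-Lebesgue and the Fourier series of tan *)

Definition prod_div a q x : R := dpow a x * rpow_div q x.
Definition drpow_div q x : R := - 2 * (rpow q.+1 x / cos x) + rpow q.+2 x / cos x / cos x * sin x.
Definition dprod_div a q x : R := 2 * dpow a x * rpow_div q x + dpow a.+1 x * drpow_div q x.

Lemma is_derive_prod_div a q x : 0 <= x < hpi -> is_derive (prod_div a.+1 q) x (dprod_div a q x).
Proof. by move=> hx; apply: is_deriveM; [exact: is_derive_dpow|exact: is_derive_rpow_div]. Qed.

Lemma cont_prod_div a q : cont (prod_div a q).
Proof. by apply: cont_mult; [exact: cont_dpow|exact: cont_rpow_div]. Qed.

Lemma continuous_invcos x : 0 <= x < hpi -> continuous (fun x => / cos x) x.
Proof.
move=> hx; have c0 := cos_gt0_hpi hx.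
apply: (ex_derive_continuous (V := R_NormedModule)); auto_derive; lra.
Qed.

Lemma continuous_dprod_div a q x : 0 <= x < hpi -> continuous (dprod_div a q) x.
Proof.
move=> hx; have hx' : 0 <= x <= hpi by lra.
have Cm (f g : R -> R) : continuous f x -> continuous g x -> continuous (fun x => f x * g x) x.
  by move=> *; apply: (continuous_mult (K := R_AbsRing)).
have Cp (f g : R -> R) : continuous f x -> continuous g x -> continuous (fun x => f x + g x) x.
  by move=> *; apply: (continuous_plus (V := R_NormedModule)).
have ic := continuous_invcos hx.
apply: (Cp _ _); apply: (Cm _ _); try (by apply: cont_dpow); try (by apply: cont_rpow_div).
  by apply: (Cm _ _); [exact: continuous_const|apply: cont_dpow].
apply: (Cp _ _).
  by apply: (Cm _ _); [exact: continuous_const|apply: (Cm _ _) => //; apply: cont_rpow].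
by apply: (Cm _ _); [apply: (Cm _ _) => //; apply: (Cm _ _) => //; apply: cont_rpow|apply: cont_sin].
Qed.

Lemma rpow_div_bound q x : 0 <= x < hpi -> 0 <= rpow_div q x <= 32 * 4 ^ q.
Proof.
move=> hx; have h2 := hpi_le2; have c0 := cos_gt0_hpi hx; have hx' : 0 <= x <= hpi by lra.
have p4 : 0 < 4 ^ q by apply: pow_lt; lra.
have [p0 _] := rpow_le q.+1 hx'.
have T0 : 0 <= rpow_div q x by apply: Rmult_le_pos => //; apply: Rlt_le; apply: Rinv_0_lt_compat.
split=> //; have a : Rabs (hpi - x) = hpi - x by rewrite Rabs_pos_eq; lra.
have := @rpow_div_abs q x ltac:(lra); rewrite a Rabs_pos_eq // => h; apply: Rle_trans h _.
have h3 : 0 <= 4 ^ q * (2 - (hpi - x)) by apply: Rmult_le_pos; lra.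
lra.
Qed.

(** 80 = 2 * 8 + 64, from the two terms of the quotient rule. *)
Lemma drpow_div_bound q x : 0 <= x < hpi -> Rabs (drpow_div q x) <= 80 * 4 ^ q.
Proof.
move=> hx; have h2 := hpi_le2; have c0 := cos_gt0_hpi hx; have hx' : 0 <= x <= hpi by lra.
have p4 : 0 < 4 ^ q by apply: pow_lt; lra.
have cl := cos_low hx'; have s0 := sin_ge0_hpi hx'; have s1 := SIN_bound x.
have [p0 p1] := rpow_le q hx'.
have B1 : 0 <= rpow q.+1 x / cos x <= 8 * 4 ^ q.
  split; first by apply: Rmult_le_pos => //; apply: Rlt_le; apply: Rinv_0_lt_compat.
  apply: (Rmult_le_reg_r (cos x)) => //.
  have -> : rpow q.+1 x / cos x * cos x = rpow q.+1 x by field; lra.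
  apply: Rle_trans p1 _.
  have := Rmult_le_compat_l (2 * 4 ^ q) _ _ ltac:(lra) cl; lra.
have a : Rabs (hpi - x) = hpi - x by rewrite Rabs_pos_eq; lra.
have := @rpow_abs q x ltac:(lra); rewrite a => P.
have B2 : Rabs (rpow q.+2 x / cos x / cos x * sin x) <= 64 * 4 ^ q.
  rewrite Rabs_mult (Rabs_pos_eq (sin x)) // (Rabs_div (_ / _)) ?(Rabs_div (rpow q.+2 x)) ?(Rabs_pos_eq (cos x)); try lra.
  have : Rabs (rpow q.+2 x) / cos x / cos x <= 64 * 4 ^ q.
    apply: (Rmult_le_reg_r (cos x * cos x)); first by nra.
    have -> : Rabs (rpow q.+2 x) / cos x / cos x * (cos x * cos x) = Rabs (rpow q.+2 x) by field; lra.
    apply: Rle_trans P _.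
    have q1 : (hpi - x) * (hpi - x) <= 4 * cos x * (4 * cos x) by apply: Rmult_le_compat; lra.
    have := Rmult_le_compat_l (4 ^ q * 4) _ _ ltac:(lra) q1; lra.
  have z : 0 <= Rabs (rpow q.+2 x) / cos x / cos x.
    by do 2 (apply: Rmult_le_pos; last by apply: Rlt_le; apply: Rinv_0_lt_compat); apply: Rabs_pos.
  by move=> u; rewrite -(Rmult_1_r (64 * 4 ^ q)); apply: Rmult_le_compat => //; lra.
apply: Rle_trans (Rabs_triang _ _) _.
rewrite Rabs_mult (Rabs_pos_eq (rpow q.+1 x / cos x)); last lra.
rewrite (_ : Rabs (-2) = 2); first lra.
by rewrite Rabs_left; lra.
Qed.

Lemma dprod_div_bound a q : exists C, 0 <= C /\ forall x, 0 <= x < hpi ->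
  Rabs (prod_div a.+1 q x) <= C /\ Rabs (dprod_div a q x) <= C.
Proof.
set A := 4 ^ a.+1; set B := 80 * 4 ^ q.
have A0 : 0 < A by apply: pow_lt; lra.
have B0 : 0 < B by apply: Rmult_lt_0_compat; [lra|apply: pow_lt; lra].
exists (3 * A * B); split; first by nra.
move=> x hx; have hx' : 0 <= x <= hpi by lra.
have [t0 t1] := rpow_div_bound q hx; have d := drpow_div_bound q hx.
have p4 : 0 < 4 ^ q by apply: pow_lt; lra.
have t2 : rpow_div q x <= B by rewrite /B; lra.
have m0 := dpow_ge0 a.+1 (proj1 hx); have m1 := dpow_le a.+1 hx'.
have n0 := dpow_ge0 a (proj1 hx).
have n1 : dpow a x <= A.
  apply: Rle_trans (dpow_le a hx') _; rewrite /A -tech_pow_Rmult.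
  by have := pow_lt 4 a ltac:(lra); lra.
rewrite -/A in m1; rewrite -/B in d.
have mt : 0 <= dpow a.+1 x * rpow_div q x <= A * B by split; [apply: Rmult_le_pos|apply: Rmult_le_compat].
have nt : 0 <= dpow a x * rpow_div q x <= A * B by split; [apply: Rmult_le_pos|apply: Rmult_le_compat].
have AB : 0 < A * B by apply: Rmult_lt_0_compat.
split; first by rewrite /prod_div Rabs_pos_eq; lra.
apply: Rle_trans (Rabs_triang _ _) _.
rewrite (Rabs_pos_eq (2 * dpow a x * rpow_div q x)); last by lra.
rewrite Rabs_mult (Rabs_pos_eq (dpow a.+1 x)) //.
have : dpow a.+1 x * Rabs (drpow_div q x) <= A * B by apply: Rmult_le_compat => //; apply: Rabs_pos.
lra.
Qed.

Lemma cont_sin_scal c : cont (fun x => sin (c * x)).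
Proof.
move=> x _; apply: (ex_derive_continuous (V := R_NormedModule)); auto_derive; done.
Qed.

(* Integration by parts on [0, hpi - d], uniformly in d. *)
Lemma riemann_lebesgue a q : exists C, forall n : nat,
  Rabs (wint (fun x => prod_div a.+1 q x * sin (INR n.+1 * x))) <= C / INR n.+1.
Proof.
have [C [C0 hC]] := dprod_div_bound a q; exists (4 * C) => n.
set k := INR n.+1; have k0 : 0 < k by apply: lt_0_INR; lia.
pose f x := prod_div a.+1 q x * sin (k * x).
have cf : cont f by apply: cont_mult; [exact: cont_prod_div|exact: cont_sin_scal].
have h0 := hpi_gt0; have h2 := hpi_le2.
(* The derivative of the quotient is controlled only where cos > 0, so a strip of width d at pi/2 is
   estimated trivially. *)
have key d : 0 < d < hpi -> Rabs (wint f) <= 4 * C / k + d * C.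
  move=> hd; set e := hpi - d.
  have sub x : 0 <= x <= e -> 0 <= x < hpi by rewrite /e; lra.
  pose Hf x := prod_div a.+1 q x * (- cos (k * x) / k).
  pose g x := dprod_div a q x * (- cos (k * x) / k).
  have dH x : 0 <= x <= e -> is_derive Hf x (g x + f x).
    move=> /sub hx; apply: is_deriveM; first exact: is_derive_prod_div.
    by auto_derive => //; field; lra.
  have cg x : 0 <= x <= e -> continuous (fun x => g x + f x) x.
    move=> he; have hx := sub x he; apply: (continuous_plus (V := R_NormedModule)); last by apply: cf; lra.
    apply: (continuous_mult (K := R_AbsRing)); first exact: continuous_dprod_div.
    by apply: (ex_derive_continuous (V := R_NormedModule)); auto_derive; lra.
  have e0 : 0 <= e by rewrite /e; lra.
  have I1 : is_RInt (fun x => g x + f x) 0 e (Hf e - Hf 0).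
    by apply: (is_RInt_derive Hf) => x; rewrite Rmin_left // Rmax_right //; [exact: dH|exact: cg].
  have ef : ex_RInt f 0 e.
    apply: (ex_RInt_continuous (V := R_CompleteNormedModule)) => x.
    by rewrite Rmin_left // Rmax_right // => hx; apply: cf; have := sub x hx; lra.
  have I2 := RInt_correct _ _ _ ef.
  have I3 : is_RInt g 0 e ((Hf e - Hf 0) - RInt f 0 e).
    apply: (is_RInt_ext (fun x => minus (g x + f x) (f x))) => [x _|].
      by change (g x + f x - f x = g x); ring.
    exact: (is_RInt_minus (V := R_NormedModule) _ _ _ _ _ _ I1 I2).
  have cb x : Rabs (- cos (k * x) / k) <= / k.
    rewrite Rabs_div; last lra.
    rewrite Rabs_Ropp (Rabs_pos_eq k); last lra.
    rewrite -(Rmult_1_l (/ k)); apply: Rmult_le_compat_r; first by apply: Rlt_le; apply: Rinv_0_lt_compat.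
    by apply: Rabs_le; have := COS_bound (k * x); lra.
  have kp : 0 < / k by apply: Rinv_0_lt_compat.
  have B1 : Rabs ((Hf e - Hf 0) - RInt f 0 e) <= (e - 0) * (C * / k).
    apply: (norm_RInt_le_const (V := R_NormedModule) _ _ _ _ _ e0 _ I3) => x hx.
    have [_ d1] := hC x (sub x hx).
    change (Rabs (dprod_div a q x * (- cos (k * x) / k)) <= C * / k).
    by rewrite Rabs_mult; apply: Rmult_le_compat => //; apply: Rabs_pos.
  have B2 x : 0 <= x <= e -> Rabs (Hf x) <= C * / k.
    move=> hx; have [r1 _] := hC x (sub x hx).
    by rewrite /Hf Rabs_mult; apply: Rmult_le_compat => //; apply: Rabs_pos.
  have Be := B2 e ltac:(lra); have B0 := B2 0 ltac:(lra).
  have ef2 : ex_RInt f e hpi.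
    apply: (ex_RInt_continuous (V := R_CompleteNormedModule)) => x.
    by rewrite Rmin_left ?Rmax_right; rewrite /e; [move=> hx; apply: cf; lra|lra|lra].
  have B3 : Rabs (RInt f e hpi) <= (hpi - e) * C.
    apply: (norm_RInt_le_const (V := R_NormedModule) f _ _ _ _ _ _ (RInt_correct _ _ _ ef2)); first by rewrite /e; lra.
    move=> x hx; change (Rabs (f x) <= C); rewrite /f Rabs_mult.
    have s1 : Rabs (sin (k * x)) <= 1 by apply: Rabs_le; have := SIN_bound (k * x); lra.
    have r1 : Rabs (prod_div a.+1 q x) <= C.
      have [l|l] := Rle_lt_or_eq_dec x hpi (proj2 hx).
        by apply: (proj1 (hC x _)); rewrite /e in hx; lra.
      by rewrite l /prod_div rpow_div_hpi Rmult_0_r Rabs_R0.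
    rewrite -(Rmult_1_r C); apply: Rmult_le_compat => //; exact: Rabs_pos.
  have ch : wint f = RInt f 0 e + RInt f e hpi.
    by rewrite /wint; symmetry; apply: (RInt_Chasles (V := R_CompleteNormedModule)).
  have E1 : (e - 0) * (C * / k) <= 2 * (C * / k).
    by apply: Rmult_le_compat_r; [nra|rewrite /e; lra].
  have -> : 4 * C / k = 4 * (C * / k) by rewrite /Rdiv; ring.
  have ed : hpi - e = d by rewrite /e; ring.
  rewrite ed in B3; rewrite ch.
  move: B1 B3 Be B0; set r1 := RInt f 0 e; set r2 := RInt f e hpi.
  move=> B1 B3 Be B0; have := Rabs_triang r1 r2 => T.
  have : Rabs r1 <= 4 * (C * / k) by move: B1 Be B0; split_Rabs; lra.
  lra.
apply: le_epsilon => eps e0.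
have C1 : 0 < C + 1 by lra.
pose d := Rmin (hpi / 2) (eps / (C + 1)).
have d1 : d <= hpi / 2 := Rmin_l _ _; have d2 : d <= eps / (C + 1) := Rmin_r _ _.
have d0 : 0 < d by apply: Rmin_pos; [lra|apply: Rdiv_lt_0_compat; lra].
have K1 := key d ltac:(lra); change (Rabs (wint f) <= 4 * C / k + eps).
suff : d * C <= eps by lra.
apply: Rle_trans (_ : d * (C + 1) <= _); first by nra.
have := Rmult_le_compat_r (C + 1) _ _ ltac:(lra) d2.
have -> : eps / (C + 1) * (C + 1) = eps by field; lra.
by [].
Qed.

Definition sinsum K x : R := psum (fun k => 2 * (-1) ^ k * sin (2 * INR k.+1 * x)) K.

(** The products 2 cos x sin(2kx) = sin((2k+1)x) + sin((2k-1)x) telescope with alternating signs. *)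
Lemma dirichlet K x : cos x * sinsum K x = sin x - (-1) ^ K * sin (INR (2 * K).+1 * x).
Proof.
elim: K => [|K IH]; first by rewrite /sinsum /= !Rmult_1_l; ring.
rewrite /sinsum psumS Rmult_plus_distr_l -/(sinsum K x) IH doubleS_mul !S_INR mult_INR [INR 2]/= -tech_pow_Rmult.
set n := INR K; set s := (-1) ^ K.
have -> : ((1 + 1) * n + 1 + 1 + 1) * x = 2 * (n + 1) * x + x by ring.
have -> : ((1 + 1) * n + 1) * x = 2 * (n + 1) * x - x by ring.
by rewrite sin_plus sin_minus; ring.
Qed.

Lemma cont_sinsum K : cont (sinsum K).
Proof.
rewrite /sinsum; elim: K => [|K IH]; first exact: cont_const.
apply: cont_plus; first exact: IH.
by apply: cont_mult; [exact: cont_const|exact: cont_sin_scal].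
Qed.

(** By [dirichlet] the error of a partial sum is sin((2K+1)x)/cos x up to sign. The polynomial
    factor absorbs 1/cos x, and the oscillation makes the integral tend to 0. *)
Lemma tanint_lim a q : is_lim_seq (fun K => wint (fun x => dpow a.+1 x * rpow q.+2 x * sinsum K x)) (tanint a.+1 q).
Proof.
have [C hC] := riemann_lebesgue a q.
pose r K := wint (fun x => prod_div a.+1 q x * sin (INR (2 * K).+1 * x)).
have C1 K : cont (fun x => dpow a.+1 x * rpow q.+2 x * sinsum K x).
  by apply: cont_mult; [apply: cont_mult; [exact: cont_dpow|exact: cont_rpow]|exact: cont_sinsum].
have C2 K : cont (fun x => (-1) ^ K * (prod_div a.+1 q x * sin (INR (2 * K).+1 * x))).
  by apply: cont_mult; [exact: cont_const|apply: cont_mult; [exact: cont_prod_div|exact: cont_sin_scal]].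
have e K : wint (fun x => dpow a.+1 x * rpow q.+2 x * sinsum K x) = tanint a.+1 q - (-1) ^ K * r K.
  rewrite /tanint (wint_ext (f := fun x => dpow a.+1 x * sin x * rpow_div q x) (g := fun x => dpow a.+1 x * rpow q.+2 x * sinsum K x
     + (-1) ^ K * (prod_div a.+1 q x * sin (INR (2 * K).+1 * x)))) => [|x hx].
    rewrite wint_plus // wint_scal; first by rewrite /r; ring.
    by apply: cont_mult; [exact: cont_prod_div|exact: cont_sin_scal].
  have c0 : 0 < cos x by apply: cos_gt0_hpi; lra.
  have s : sin x = cos x * sinsum K x + (-1) ^ K * sin (INR (2 * K).+1 * x) by rewrite dirichlet; ring.
  by rewrite {1}s /prod_div /rpow_div; field; lra.
have L : is_lim_seq (fun K => (-1) ^ K * r K) 0.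
  apply/is_lim_seq_abs_0.
  apply: (is_lim_seq_le_le (fun _ => 0) _ (fun K => C * / INR K.+1)) => [K||].
  - split; first exact: Rabs_pos.
    rewrite Rabs_mult -RPow_abs Rabs_Ropp Rabs_R1 pow1 Rmult_1_l.
    have C0 : 0 <= C.
      by have := Rle_trans _ _ _ (Rabs_pos _) (hC 0%nat); rewrite /= Rdiv_1_r.
    apply: Rle_trans (hC (2 * K)%nat) _; apply: Rmult_le_compat_l => //.
    by apply: Rinv_le_contravar; [apply: lt_0_INR; lia|apply: le_INR; lia].
  - exact: is_lim_seq_const.
  apply: lim_scal0; apply: (proj1 (is_lim_seq_incr_1 (fun k => / INR k) 0)).
  by apply: (is_lim_seq_inv _ _ is_lim_seq_INR).
have := is_lim_seq_minus' _ _ _ _ (is_lim_seq_const (tanint a.+1 q)) L; rewrite Rminus_0_r.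
by apply: is_lim_seq_ext => K; rewrite e.
Qed.

(** * Fourier evaluation *)

Definition horner2 (p : {poly R}) (x : R) : R := horner p (Rmult 2 x).

Lemma is_derive_horner (p : {poly R}) (x : R) : is_derive (horner p) x (horner (deriv p) x).
Proof.
elim/poly_ind: p => [|p c IH].
  rewrite deriv0 horner0.
  by apply: (is_derive_ext (fun _ => 0)) => [t|]; [rewrite horner0|exact: is_derive_const].
apply: (is_derive_ext (fun t => horner p t * t + c)) => [t|].
  by rewrite hornerMXaddC.
apply: (is_derive_eqR (is_deriveD (is_deriveM IH (is_derive_id x)) (is_derive_const c x))) => //.
rewrite derivMXaddC hornerD hornerMX -[Hierarchy.one]/(1 : R) -[zero]/(0 : R).
by rewrite -!RmultE -RplusE; ring.
Qed.

Lemma is_derive_horner2 p x : is_derive (horner2 p) x (2 * horner2 (deriv p) x).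
Proof.
have d : is_derive (fun x => 2 * x) x 2 by auto_derive; [|ring].
apply: (is_derive_eqR (is_derive_comp _ _ _ _ _ (is_derive_horner p (Rmult 2 x)) d)) => //.
Qed.

Lemma cont_horner2 p : cont (horner2 p).
Proof. exact: (derive_cont (is_derive_horner2 p)). Qed.

Definition sincoef p n : R := wint (fun x => horner2 p x * sin (2 * INR n.+1 * x)).

Lemma cos_nPI n : cos (INR n * PI) = (-1) ^ n /\ sin (INR n * PI) = 0.
Proof.
elim: n => [|n [IH1 IH2]]; first by rewrite /= Rmult_0_l cos_0 sin_0.
rewrite S_INR Rmult_plus_distr_r Rmult_1_l neg_cos neg_sin IH1 IH2 -tech_pow_Rmult; split; ring.
Qed.

Lemma sincoef_step p n : sincoef p n =
  (horner p (IZR 0) - (-1) ^ n.+1 * horner p PI) / (2 * INR n.+1) - sincoef (derivn 2 p) n / INR n.+1 ^ 2.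
Proof.
set k := INR n.+1; have k0 : 0 < k by apply: lt_0_INR; lia.
pose f x := - / (2 * k) * (horner2 p x * cos (2 * k * x)) + / (2 * k ^ 2) * (horner2 (deriv p) x * sin (2 * k * x)).
pose g x := horner2 p x * sin (2 * k * x) + / k ^ 2 * (horner2 (derivn 2 p) x * sin (2 * k * x)).
have ds x : is_derive (fun x => sin (2 * k * x)) x (2 * k * cos (2 * k * x)) by auto_derive; [|ring].
have dc x : is_derive (fun x => cos (2 * k * x)) x (- (2 * k) * sin (2 * k * x)) by auto_derive; [|ring].
have cs p' : cont (fun x => horner2 p' x * sin (2 * k * x)) by apply: cont_mult; [exact: cont_horner2|exact: cont_sin_scal].
have dF x : is_derive f x (g x).
  have H1 := is_derive_scal _ _ (- / (2 * k)) _ (is_deriveM (is_derive_horner2 p x) (dc x)).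
  have H2 := is_derive_scal _ _ (/ (2 * k ^ 2)) _ (is_deriveM (is_derive_horner2 (deriv p) x) (ds x)).
  apply: (is_derive_eqR (is_deriveD H1 H2)) => //.
  by rewrite /g derivnS derivn1; field; lra.
have H : wint g = f hpi - f 0.
  by apply: wint_FTC => [x _|] //; apply: cont_plus => //; apply: cont_mult; [exact: cont_const|].
have e : wint g = sincoef p n + / k ^ 2 * sincoef (derivn 2 p) n.
  rewrite wint_plus ?wint_scal //; by apply: cont_mult; [exact: cont_const|].
have [c s] := cos_nPI n.+1.
have ak : 2 * k * hpi = INR n.+1 * PI by rewrite /k /hpi; field.
have a2 : 2 * hpi = PI by rewrite /hpi; field.
have fh : f hpi = - / (2 * k) * (horner p PI * (-1) ^ n.+1).
  by rewrite /f /horner2 ak a2 c s; ring.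
have f0 : f 0 = - / (2 * k) * horner p (IZR 0) by rewrite /f /horner2 !Rmult_0_r cos_0 sin_0; ring.
have -> : sincoef p n = wint g - / k ^ 2 * sincoef (derivn 2 p) n by rewrite e; ring.
by rewrite H fh f0; field; lra.
Qed.

Lemma sincoef_iter p n N : sincoef p n =
  psum (fun j => (-1) ^ j * (horner (derivn (2 * j) p) (IZR 0) - (-1) ^ n.+1 * horner (derivn (2 * j) p) PI)
     / (2 * INR n.+1 ^ (2 * j).+1)) N
  + (-1) ^ N * sincoef (derivn (2 * N) p) n / INR n.+1 ^ (2 * N).
Proof.
have k0 : 0 < INR n.+1 by apply: lt_0_INR; lia.
elim: N => [|N IH]; first by rewrite muln0 derivn0 /=; field.
rewrite psumS IH sincoef_step doubleS_mul (_ : derivn 2 (derivn (2 * N) p) = derivn (2 * N).+2 p) //.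
rewrite -!tech_pow_Rmult !pow_O.
have kp := pow_nonzero (INR n.+1) (2 * N) ltac:(lra); field; split=> //; lra.
Qed.

(** Repeated integration by parts stops once the derivative of the polynomial is 0. *)
Lemma sincoef_finite (p : {poly R}) n N : (size p <= 2 * N)%nat -> sincoef p n =
  psum (fun j => (-1) ^ j * (horner (derivn (2 * j) p) (IZR 0) - (-1) ^ n.+1 * horner (derivn (2 * j) p) PI)
     / (2 * INR n.+1 ^ (2 * j).+1)) N.
Proof.
move=> h; rewrite (sincoef_iter p n N).
have -> : sincoef (derivn (2 * N) p) n = 0.
  rewrite derivn_poly0 // /sincoef (wint_ext (g := fun _ => 0)) => [|x _]; first by rewrite wint_const; ring.
  by rewrite /horner2 horner0; change (0 * sin (2 * INR n.+1 * x) = 0); ring.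
by rewrite /Rdiv Rmult_0_r Rmult_0_l Rplus_0_r.
Qed.

Lemma dpow_rpow_horner2 a q x : dpow a x * rpow q x = horner2 (bpoly (PI : R) a q) x.
Proof.
rewrite /horner2 /bpoly hornerZ hornerM hornerXn horner_exp hornerD hornerN hornerC hornerX.
rewrite /rpow /dpow -!RpowE -!RmultE -!RinvE -RplusE -RoppE -!INRE.
rewrite -!factE.
have -> : 2 * (hpi - x) = PI + - (2 * x) by rewrite /hpi; field.
by rewrite /Rdiv; ring.
Qed.

Lemma eq_psum f g n : (forall i, (i < n)%nat -> f i = g i) -> psum f n = psum g n.
Proof.
elim: n => [|n IH] h //; rewrite !psumS h // IH // => i hi; apply: h; lia.
Qed.

Lemma psum_add f g n : psum (fun i => f i + g i) n = psum f n + psum g n.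
Proof. by elim: n => [|n IH]; rewrite ?psumS ?IH /=; ring. Qed.

Lemma psum_scal c f n : psum (fun i => c * f i) n = c * psum f n.
Proof. by elim: n => [|n IH]; rewrite ?psumS ?IH /=; ring. Qed.

Lemma psum_exchange (f : nat -> nat -> R) m n :
  psum (fun i => psum (f i) n) m = psum (fun j => psum (f^~ j) m) n.
Proof.
elim: m => [|m IH]; first by elim: n => [|n IH] //; rewrite psumS -IH /=; ring.
by rewrite psumS IH -psum_add.
Qed.

Lemma lim_psum (u : nat -> nat -> R) (l : nat -> R) n : (forall j, (j < n)%nat -> is_lim_seq (u j) (l j)) ->
  is_lim_seq (fun M => psum (u^~ M) n) (psum l n).
Proof.
elim: n => [|n IH] h; first exact: is_lim_seq_const.
have hn := h n ltac:(lia).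
have IH' : is_lim_seq (fun M => psum (u^~ M) n) (psum l n) by apply: (IH _) => j hj; apply: (h _ _); lia.
exact: (is_lim_seq_plus' _ _ _ _ IH' hn).
Qed.

Lemma wint_sinsum p K : wint (fun x => horner2 p x * sinsum K x) = psum (fun k => 2 * (-1) ^ k * sincoef p k) K.
Proof.
elim: K => [|K IH].
  by rewrite (wint_ext (g := fun _ => 0)) => [|x _]; [rewrite wint_const /=; ring|rewrite /sinsum /=; ring].
pose f x := horner2 p x * sinsum K x; pose g x := 2 * (-1) ^ K * (horner2 p x * sin (2 * INR K.+1 * x)).
have cg : cont (fun x => horner2 p x * sin (2 * INR K.+1 * x)).
  by apply: cont_mult; [exact: cont_horner2|exact: cont_sin_scal].
rewrite (wint_ext (g := fun x => f x + g x)) => [|x _]; last by rewrite /f /g /sinsum psumS; ring.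
rewrite wint_plus; first by rewrite psumS -IH wint_scal.
  by apply: cont_mult; [exact: cont_horner2|exact: cont_sinsum].
by apply: cont_mult; [exact: cont_const|].
Qed.

Lemma hsumR1E s K : hsumR [:: s.+1] K = psum (fun k => (/ INR k.+1) ^ s.+1) K.
Proof. by elim: K => [|K IH]; rewrite ?hsumR0 // hsumRS IH hsumR_nil psumS Rmult_1_r. Qed.

Definition eta s K : R := psum (fun k => (-1) ^ k * (/ INR k.+1) ^ s) K.

(** The even denominators enter with a minus sign, and those up to 2M are the doubles of 1, ..., M;
    hence the even truncation. *)
Lemma eta_dbl s M : eta s.+1 (2 * M) = hsumR [:: s.+1] (2 * M) - 2 * (/ 2) ^ s.+1 * hsumR [:: s.+1] M.
Proof.
rewrite !hsumR1E; elim: M => [|M IH]; first by rewrite /eta muln0 /psum; ring.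
rewrite doubleS_mul /eta !psumS -/(eta s.+1 (2 * M)) IH.
have -> : INR (2 * M).+2 = 2 * INR M.+1 by rewrite -doubleS_mul mult_INR.
have e1 : (-1) ^ (2 * M) = 1 by rewrite pow_1_even.
rewrite -(tech_pow_Rmult (-1)) e1 Rinv_mult Rpow_mult_distr; ring.
Qed.

Lemma eta_lim s : is_lim_seq (fun M => eta s.+2 (2 * M)) ((1 - (/ 2) ^ s.+1) * zreg (iw [:: s.+2])).
Proof.
have L : is_lim_seq (hsumR [:: s.+2]) (zreg (iw [:: s.+2])) by apply: hsumR_lim.
have L2 : is_lim_seq (fun M => hsumR [:: s.+2] (2 * M)) (zreg (iw [:: s.+2])).
  apply: (is_lim_seq_subseq _ _ (fun M => (2 * M)%nat)) L.
  by apply: eventually_subseq => n; lia.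
have := is_lim_seq_minus' _ _ _ _ L2 (is_lim_seq_scal_l _ (2 * (/ 2) ^ s.+2) _ L).
have -> : zreg (iw [:: s.+2]) - 2 * (/ 2) ^ s.+2 * zreg (iw [:: s.+2]) = (1 - (/ 2) ^ s.+1) * zreg (iw [:: s.+2]).
  by rewrite -(tech_pow_Rmult (/ 2) s.+1); field.
by apply: is_lim_seq_ext => M; rewrite eta_dbl.
Qed.

(** The sign (-1)^k survives at the endpoint 0, giving an alternating zeta value and its factor 1 -
    2^(-2j), and cancels against cos((k+1) pi) at pi/2. The conditions at j = 0 remove the divergent
    harmonic series. *)
Lemma fourier_lim (p : {poly R}) N (h0 := fun j => horner (derivn (2 * j) p) (IZR 0))
  (h1 := fun j => horner (derivn (2 * j) p) PI) :
  (size p <= 2 * N.+1)%nat -> h0 0%nat = 0 -> h1 0%nat = 0 ->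
  is_lim_seq (fun M => wint (fun x => horner2 p x * sinsum (2 * M) x))
    (psum (fun j => if j is j'.+1 then (-1) ^ j * zreg (wodd j) * ((1 - (/ 2) ^ (2 * j)) * h0 j + h1 j)
       else 0) N.+1).
Proof.
move=> sp z0 z1.
pose u j M := (-1) ^ j * (h0 j * eta (2 * j).+1 (2 * M) + h1 j * hsumR [:: (2 * j).+1] (2 * M)).
apply: (is_lim_seq_ext (fun M => psum (u^~ M) N.+1)) => [M|].
  symmetry; rewrite wint_sinsum.
  rewrite (eq_psum (g := fun k => psum (fun j => (-1) ^ j * (h0 j * ((-1) ^ k * (/ INR k.+1) ^ (2 * j).+1)
     + h1 j * (/ INR k.+1) ^ (2 * j).+1)) N.+1)) => [|k _].
    rewrite psum_exchange; apply: eq_psum => j _.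
    by rewrite psum_scal psum_add !psum_scal /u hsumR1E.
  rewrite (sincoef_finite k sp) -psum_scal; apply: eq_psum => j _; rewrite -/(h0 j) -/(h1 j).
  have k0 : INR k.+1 <> 0 by apply: not_0_INR.
  have kp := pow_nonzero _ (2 * j).+1 k0.
  have s2 : (-1) ^ k * (-1) ^ k = 1 by rewrite -Rpow_mult_distr (_ : -1 * -1 = 1) ?pow1; [|ring].
  rewrite pow_inv -(tech_pow_Rmult (-1) k).
  transitivity ((-1) ^ j * (h0 j * (-1) ^ k + ((-1) ^ k * (-1) ^ k) * h1 j) / INR k.+1 ^ (2 * j).+1).
    by field.
  by rewrite s2; field.
apply: lim_psum => -[|j] _.
  apply: (is_lim_seq_ext (fun _ => 0)) => [M|]; last exact: is_lim_seq_const.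
  by rewrite /u z0 z1; ring.
have -> : (-1) ^ j.+1 * zreg (wodd j.+1) * ((1 - (/ 2) ^ (2 * j.+1)) * h0 j.+1 + h1 j.+1) =
  (-1) ^ j.+1 * (h0 j.+1 * ((1 - (/ 2) ^ (2 * j.+1)) * zreg (wodd j.+1)) + h1 j.+1 * zreg (wodd j.+1)) by ring.
have eU : wodd j.+1 = iw [:: (2 * j).+3] by rewrite /wodd doubleS_mul /iw /= cats0 -cats1.
rewrite /u doubleS_mul eU.
apply: (is_lim_seq_scal_l _ _ (Rbar.Finite _)); apply: is_lim_seq_plus'.
  by apply: (is_lim_seq_scal_l _ _ (Rbar.Finite _)); exact: eta_lim.
apply: (is_lim_seq_scal_l _ _ (Rbar.Finite _)).
have L : is_lim_seq (hsumR [:: (2 * j).+3]) (zreg (iw [:: (2 * j).+3])) by apply: hsumR_lim.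
apply: (is_lim_seq_subseq _ _ (fun M => (2 * M)%nat)) L.
by apply: eventually_subseq => n; lia.
Qed.

Local Ltac eqR := match goal with |- @eq _ ?x ?y => change (@eq R x y) end.

Lemma psum_recl f n : psum f n.+1 = f 0%nat + psum (fun j => f j.+1) n.
Proof. by elim: n => [|n IH]; [rewrite /=; ring|rewrite psumS IH psumS; ring]. Qed.

(** * The identity for real multiple zeta values *)

Section ZagierR.
Variables a b : nat.
Let n := (a + b + 1)%nat.
Let P : {poly R} := bpoly (PI : R) (2 * a).+1 (2 * b).+2.

(** Odd divided powers of pi are pi times values at {2}^m, which is how the second factors of the
    identity arise. *)
Lemma zreg_wtwos_coef j : (j <= n)%nat ->
  PI ^ ((2 * a).+1 + (2 * b).+2 - 2 * j) / INR (fact ((2 * a).+1 + (2 * b).+2 - 2 * j)) = PI * zreg (wtwos (n - j)).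
Proof.
move=> jn; rewrite zreg_wtwos.
have -> : ((2 * a).+1 + (2 * b).+2 - 2 * j = (2 * (n - j)).+1)%nat by rewrite /n; lia.
by rewrite -tech_pow_Rmult /Rdiv; ring.
Qed.

Lemma bpoly_PI_at0 j : (j <= n)%nat -> horner (derivn (2 * j) P) (IZR 0) =
  - INR ('C(2 * j, (2 * a).+1)) * (PI * zreg (wtwos (n - j))).
Proof.
move=> jn; rewrite -zreg_wtwos_coef //.
have h := @bpoly_at0 _ (PI : R) (2 * a).+1 (2 * b).+2 (2 * j) ltac:(rewrite /n in jn; lia).
rewrite -[LHS]/(horner (derivn (2 * j) P) 0%R) h.
rewrite -!RpowE -!INRE -!factE -!RinvE -!RmultE (_ : @GRing.opp R (@GRing.one R) = -1) //.
case: (leqP (2 * a).+1 (2 * j)) => l.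
  have -> : (2 * j - (2 * a).+1 = (2 * (j - a.+1)).+1)%nat by lia.
  by rewrite -tech_pow_Rmult pow_1_even /Rdiv; eqR; ring.
by rewrite bin_small //= /Rdiv; eqR; ring.
Qed.

(** Reflection exchanges the exponents of the beta polynomial and reduces this to a derivative at
    0. *)
Lemma bpoly_PI_atPI j : (j <= n)%nat -> horner (derivn (2 * j) P) PI =
  INR ('C(2 * j, (2 * b).+2)) * (PI * zreg (wtwos (n - j))).
Proof.
move=> jn; rewrite -zreg_wtwos_coef //.
rewrite /P bpoly_at_c.
have h := @bpoly_at0 _ (PI : R) (2 * b).+2 (2 * a).+1 (2 * j) ltac:(rewrite /n in jn; lia).
rewrite h addnC.
rewrite -!RpowE -!INRE -!factE -!RinvE -!RmultE (_ : @GRing.opp R (@GRing.one R) = -1) //.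
case: (leqP (2 * b).+2 (2 * j)) => l.
  have -> : (2 * j - (2 * b).+2 = (2 * (j - b.+1)))%nat by lia.
  by rewrite !pow_1_even /Rdiv; eqR; ring.
by rewrite bin_small //= /Rdiv; eqR; ring.
Qed.

Lemma zreg_zagier : zreg (wthree a b.+1) = psum (fun j => 2 * (-1) ^ j.+1 *
   (INR 'C(2 * j.+1, (2 * b).+2) - (1 - (/ 2) ^ (2 * j.+1)) * INR 'C(2 * j.+1, (2 * a).+1)) *
   (zreg (wodd j.+1) * zreg (wtwos (n - j.+1)))) n.
Proof.
have sp : (size P <= 2 * n.+1)%nat by apply: leq_trans (size_bpoly _ _ _) _; rewrite /n; lia.
have z0 : horner (derivn (2 * 0) P) (IZR 0) = 0.
  by rewrite bpoly_PI_at0 // bin_small // /=; ring.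
have z1 : horner (derivn (2 * 0) P) PI = 0.
  by rewrite bpoly_PI_atPI // bin_small // /=; ring.
have L1 := fourier_lim sp z0 z1.
have L2 : is_lim_seq (fun M => wint (fun x => horner2 P x * sinsum (2 * M) x)) (tanint (2 * a).+1 (2 * b)).
  have L := @tanint_lim (2 * a)%nat (2 * b)%nat.
  have := is_lim_seq_subseq _ _ (fun M => (2 * M)%nat) _ L.
  move=> H; apply: is_lim_seq_ext (H _) => [M|].
    by apply: wint_ext => x _; rewrite -dpow_rpow_horner2.
  by apply: eventually_subseq => k; lia.
have E := @lim_uniq _ _ _ L2 L1; rewrite -zreg_tanint in E.
have PI0 := PI_RGT_0.
apply: (Rmult_eq_reg_r hpi); last by have := hpi_gt0; lra.
rewrite E psum_recl Rplus_0_l [RHS]Rmult_comm -psum_scal; apply: eq_psum => j hj.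
rewrite bpoly_PI_at0 ?bpoly_PI_atPI; try lia.
have -> : hpi = PI / 2 by [].
by field.
Qed.
End ZagierR.

Local Open Scope ring_scope.

(** * From the real identity to the formal one *)

Lemma ratr_cab a b r : (ratr (cab a b r) : R) =
 2 * (-1) ^+ r * ('C(2 * r, (2 * b).+2)%:R - (1 - (2^-1) ^+ (2 * r)) * 'C(2 * r, (2 * a).+1)%:R).
Proof.
rewrite /cab !rmorphM rmorphXn rmorphN1 rmorphB rmorphM rmorphB fmorphV rmorphXn !rmorph_nat rmorph1.
by rewrite addn2 addn1 exprVn.
Qed.

Lemma evalzreg_identity a b : evalzreg (psub (lhs a b) (rhs a b)) = 0.
Proof.
rewrite /evalzreg evalp_sub lhsE evalp_pword evalp_rhs.
apply/eqP; rewrite subr_eq0; apply/eqP.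
rewrite -[LHS]/(zreg _) zreg_zagier psumE -[iota _ _]/(iota (1 + 0) _) iotaDl big_map.
have -> : iota 0 (a + b + 1) = index_iota 0 (a + b + 1) by rewrite /index_iota subn0.
rewrite big_mkord.
apply: eq_bigr => j _.
rewrite -[sh _ _ _]/(sh (zreg : word -> R) _ _) sh_zreg.
rewrite -[RHS]/(ratr _ * _)%R ratr_cab.
by rewrite !RmultE !RpowE !INRE -!add1n; congr (_ * _).
Qed.

(** The sum truncated at 1 is already 1. *)
Lemma zreg_wodd_gt0 r : (0 < r)%N -> Rlt 0 (zreg (wodd r)).
Proof.
move=> r0; have -> : wodd r = iw [:: (2 * r).-1.+2].
  have -> : (2 * r).-1.+2 = (2 * r).+1 by lia.
  by rewrite /wodd /iw /= cats0 -cats1.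
apply: Rlt_le_trans (@hsumR_le_zreg [:: (2 * r).-1.+2] 1 isT).
by rewrite hsumRS hsumR0 hsumR_nil [INR 1]/= Rinv_1 pow1; lra.
Qed.

Theorem zagier_identity : KernelConjecture -> forall a b, zeq (lhs a b) (rhs a b).
Proof.
move=> KC a b; have [m] := ubnP (a + b); elim: m a b => // m IH a b; rewrite ltnS => abm.
have N2 : (1 < (2 * (a + b + 1)).+1)%N by lia.
have [c h] : exists c, zeq (psub (lhs a b) (rhs a b)) (pscale c (zeta [:: (2 * (a + b + 1)).+1])).
  apply: (proj1 (KC _ N2 _ (hom_identity a b))) => r r1 rN; rewrite addn1; apply: Dvanish_identity => //; last by lia.
  by move=> a' b' lt; apply: IH; lia.
have u0 := @zreg_wodd_gt0 (a + b + 1) ltac:(lia).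
(* [inR_zreg] and the real identity together leave c times a positive number equal to 0. *)
have c0 : c = 0.
  have := inR_zreg h; rewrite /evalzreg evalp_sub -[evalp _ (psub _ _)]/(evalzreg _) evalzreg_identity evalp_scale.
  rewrite -addn1 zeta_oddE evalp_pword sub0r => /eqP; rewrite oppr_eq0 -[_ *: _]/(ratr c * zreg _).
  rewrite mulf_eq0 fmorph_eq0 => /orP[/eqP //|/eqP e].
  by case: (Rlt_irrefl 0); rewrite e in u0.
apply: peq_inR h; apply/peqP => M f.
by rewrite evalp_sub c0 evalp_scale scale0r subr0.
Qed.

End Numeric.

Theorem mainTheorem5 : KernelConjecture ->
  forall a b : nat,
    zeq (zeta (nseq a 2%N ++ 3%N :: nseq b 2%N))
        (flatten [seq pscale (cab a b r)
                     (psh (zeta [:: (2 * r + 1)%N]) (zeta (nseq (a + b + 1 - r) 2%N)))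
                 | r <- iota 1 (a + b + 1)]).
Proof. exact: Numeric.zagier_identity. Qed.
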